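(* Let $n\ge3$ and let $P_u$ be a flexible cross-polytope of the simplest type in $\mathbb{X}^n$ corresponding to data $(G,\boldsymbol\lambda,\mathbf{s})$ with $0<\lambda_1<\dots<\lambda_n$. Then one of the following two possibilities holds: (i) The cross-polytopes $P_{(1)},\dots,P_{(n)}$ are circumscribed about concentric $(n-2)$-dimensional spheres or orispheres $\Omega_1,\dots,\Omega_n$ respectively in $\mathbb{X}^{n-1}$, and moreover the spheres $\Omega_1,\dots,\Omega_n$ are not great spheres if $\mathbb{X}^{n-1}=\mathbb{S}^{n-1}$. (ii) There is a hyperplane $H\subset\mathbb{X}^{n-1}$ such that for each of the cross-polytopes $P_{(1)},\dots,P_{(n)}$ one of the following three conditions is fulfilled: (a) $P_{(k)}$ is circumscribed about an equidistant hypersurface $\Omega_k$ with base $H$; (b) (only in the case $\mathbb{X}^{n-1}=\Lambda^{n-1}$) the hyperplanes of all facets of $P_{(k)}$ are parallel to $H$; (c) the hyperplanes of all facets of $P_{(k)}$ intersect $H$ by the same angle $\alpha_k\in(0,\pi/2)$. Besides, for each $k$, the decomposition of the facets of $P_{(k)}$ into two classes given by $\Omega_k$ in cases (i) and (ii-a), and by $H$ in cases (ii-b) and (ii-c), is as follows: one of the classes consists of all facets $\Delta_{I,J}$ such that the set $J\setminus X_k$ has even cardinality, and the other class consists of all facets $\Delta_{I,J}$ such that $J\setminus X_k$ has odd cardinality.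
   Context: Spaces. $\mathbb{X}^n$ is Euclidean space $\mathbb{E}^n=\mathbb{R}^n$, or the unit sphere $\mathbb{S}^n\subset\mathbb{R}^{n+1}$, or the Lobachevsky space $\Lambda^n=\{\mathbf{x}\in\mathbb{R}^{n,1}:\langle\mathbf{x},\mathbf{x}\rangle=-1,\ x_0>0\}$, where $\langle\mathbf{x},\mathbf{y}\rangle=-x_0y_0+x_1y_1+\dots+x_ny_n$; $\mathbb{V}$ denotes $\mathbb{R}^n,\mathbb{R}^{n+1},\mathbb{R}^{n,1}$ respectively. Planes in $\mathbb{S}^n$ are great spheres. $[n]=\{1,\dots,n\}$, and $u\in\mathbb{R}\cup\{\infty\}$. Cross-polytopes. $K_n$ is the simplicial complex with vertices $\mathbf{a}_1,\dots,\mathbf{a}_n,\mathbf{b}_1,\dots,\mathbf{b}_n$ whose simplices are the vertex sets containing no pair $\{\mathbf{a}_i,\mathbf{b}_i\}$. A cross-polytope is a polyhedron $P\colon K_n\to\mathbb{X}^n$ of type $K_n$: each simplex is mapped homeomorphically onto the convex hull of the images of its vertices. It is non-degenerate if for every simplex the images of its vertices are independent, and $K_n$ is not the union of two $(n-1)$-dimensional subcomplexes whose intersection is mapped into an $(n-2)$-plane. Images of vertices are again denoted $\mathbf{a}_i,\mathbf{b}_i$. For disjoint $I,J\subset[n]$, $\Delta_{I,J}$ is the face spanned by $\mathbf{a}_i$ ($i\in I$) and $\mathbf{b}_j$ ($j\in J$). Flexible cross-polytopes of the simplest type. Data: a symmetric $n\times n$ matrix $G=(g_{ij})$ with units on the diagonal,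 all of whose principal minors of sizes $2\times2,\dots,(n-1)\times(n-1)$ are positive, with $\det G>0$, $=0$, $<0$ for $\mathbb{S}^n,\mathbb{E}^n,\Lambda^n$ respectively; a row $\boldsymbol\lambda=(\lambda_1,\dots,\lambda_n)$ with (standing assumption) $0<\lambda_1<\dots<\lambda_n$; a row of signs $\mathbf{s}=(s_1,\dots,s_n,s_1',\dots,s_n')$. Take $\mathbf{n}_1,\dots,\mathbf{n}_n\in\mathbb{V}$ with Gram matrix $G$ and $\mathbf{m}\in\mathbb{V}$ orthogonal to them with $\langle\mathbf{m},\mathbf{m}\rangle=1$. Put $h_{ii}=1$, $h_{ij}=\frac{2\lambda_i(\lambda_ig_{ij}-\lambda_j)}{\lambda_i^2-\lambda_j^2}$ for $i\ne j$. For $\mathbb{S}^n,\Lambda^n$: let $\mathbf{c}_1,\dots,\mathbf{c}_n$ be the basis of $\mathrm{span}(\mathbf{n}_1,\dots,\mathbf{n}_n)$ dual to $\mathbf{n}_1,\dots,\mathbf{n}_n$, let $\mathbf{d}_i(u)=\sum_jh_{ij}\mathbf{c}_j-\frac{2\lambda_i^2u^2}{\lambda_i^2u^2+1}\mathbf{n}_i+\frac{2\lambda_iu}{\lambda_i^2u^2+1}\mathbf{m}$, and $\mathbf{a}_i(u)=s_i\mathbf{c}_i/|\mathbf{c}_i|$, $\mathbf{b}_i(u)=s_i'\mathbf{d}_i(u)/|\mathbf{d}_i(u)|$ with $|\mathbf{x}|=\sqrt{|\langle\mathbf{x},\mathbf{x}\rangle|}$; the signs are arbitrary for $\mathbb{S}^n$,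 and for $\Lambda^n$ they are chosen so that the points lie in $\Lambda^n$ (the $\mathbf{d}_i(u)$ are required to be time-like). For $\mathbb{E}^n$: take a hyperplane $\Pi$ orthogonal to $\mathbf{m}$ and a simplex $[\mathbf{a}_1\dots\mathbf{a}_n]$ in $\Pi$ whose facet opposite to $\mathbf{a}_i$ is orthogonal to $\mathbf{n}_i$ for each $i$; $s_i=1$ if $\mathbf{n}_i$ is the interior normal to this facet (in $\Pi$), $s_i=-1$ if exterior; $a_i$ is $s_i$ times the altitude from $\mathbf{a}_i$; $b_i=\bigl(\sum_jh_{ij}/a_j\bigr)^{-1}$ (required to be well defined), $s_i'$ is the sign of $b_i$; $\mathbf{a}_i(u)=\mathbf{a}_i$, $\mathbf{b}_i(u)=b_i\Bigl(\sum_j\frac{h_{ij}\mathbf{a}_j}{a_j}-\frac{2\lambda_i^2u^2}{\lambda_i^2u^2+1}\mathbf{n}_i+\frac{2\lambda_iu}{\lambda_i^2u^2+1}\mathbf{m}\Bigr)$. At $u=\infty$ limits are taken. When everything is well defined and $P_u$ is non-degenerate for all but finitely many $u$, the polyhedron $P_u$ with these vertices has constant edge lengths and is called a flexible cross-polytope of the simplest type. $X_k=\{i\in[n]: (i<k\text{ and }s_is_i'=1)\text{ or }(i>k\text{ and }s_is_i'=-1)\}$ for $k\in[n]$. Flat position. $P_0$ is contained in the hyperplane $\mathbb{X}^{n-1}\subset\mathbb{X}^n$ orthogonal to $\mathbf{m}$ (the hyperplane $\Pi$ for $\mathbb{E}^n$). $P_{(k)}$ is the $(n-1)$-dimensional cross-polytope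 in $\mathbb{X}^{n-1}$ obtained from $P_0$ by removing the vertices $\mathbf{a}_k,\mathbf{b}_k$; its facets are the $(n-2)$-dimensional simplices $\Delta_{I,J}$ of $P_0$ with $I\sqcup J=[n]\setminus\{k\}$. Hypersurfaces in $\mathbb{X}^m$. An orisphere in $\Lambda^m$ is a hypersurface $\langle\mathbf{x},\mathbf{v}\rangle=\mathrm{const}$ for an isotropic vector $\mathbf{v}\in\mathbb{R}^{m,1}$; its centre is the point of the absolute corresponding to $\mathbf{v}$ (concentric means having the same centre). An equidistant hypersurface in $\Lambda^m$ or $\mathbb{S}^m$ with base a hyperplane $H$ is a connected component of the set of points at a fixed non-zero distance from $H$. Two hyperplanes of $\Lambda^m$ are parallel if they have no common points in $\Lambda^m$ and exactly one common point on the absolute. An $m$-dimensional cross-polytope $P$ in $\mathbb{X}^m$ is circumscribed about a sphere, orisphere or equidistant hypersurface $\Omega$ if the hyperplane of every facet of $P$ is tangent to $\Omega$ (the tangency point need not lie in the facet). Decompositions of facets. If $P$ is circumscribed about $\Omega$, choose orientations of $\Omega$ and of the polyhedral surface $P$; a facet gets the sign $+$ if the orientation of its hyperplane (induced by that of the facet) coincides with that of $\Omega$ at the tangency point and $-$ otherwise. The resulting decomposition of the facets into two (unlabelled) classes is the decomposition given by $\Omega$. If the hyperplanes of all facets of $P$ intersect $H$ by the same angle $\alpha\in(0,\pi/2)$, then orthogonal projection at an intersection point gives a correspondence between orientations of the hyperplane of a facet and of $H$, and one obtains in the same way the decomposition given by $H$; exactly in the same way (via orthogonal projection to $H$) the decomposition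 given by $H$ is defined when $\mathbb{X}^m=\Lambda^m$ and the hyperplanes of all facets are parallel to $H$.
   Formalization: It is also assumed that no P_(k) lies in a hyperplane of X^{n-1}; this fails only if g_{1j}=λ_1/λ_j for all j>1, when all facets of P_(1) lie in one hyperplane and the claim is false (e.g. S^3, λ=(1,2,3), g_12=1/2, g_13=1/3, g_23=3/10). *)

(* Defs.v *)
From HB Require Import structures.
From mathcomp Require Import all_boot all_order all_algebra.
From mathcomp Require Import all_classical all_reals all_analysis.

Set Implicit Arguments.
Unset Strict Implicit.
Unset Printing Implicit Defensive.

Import Order.TTheory GRing.Theory Num.Theory.
Import numFieldNormedType.Exports.

Local Open Scope classical_set_scope.
Local Open Scope ring_scope.

(** * The spaces X^n *)

Inductive geometry := Spherical | Euclidean | Lobachevsky.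

Definition vdim (X : geometry) (n : nat) : nat :=
  if X is Euclidean then n else n.+1.

(* The vector space V containing X^n: R^{n+1}, R^n and R^{n,1} respectively. *)
Notation vect R X n := 'rV[R]_(vdim X n).

Definition bsign (R : realType) (X : geometry) (j : nat) : R :=
  if X is Lobachevsky then (if j == 0%N then -1 else 1) else 1.

Definition bform (R : realType) (X : geometry) (n : nat)
    (x y : vect R X n) : R :=
  \sum_(j < vdim X n) bsign R X j * x 0 j * y 0 j.

Definition vnorm (R : realType) (X : geometry) (n : nat) (x : vect R X n) : R :=
  Num.sqrt `|bform x x|.

Definition Xspace (R : realType) (X : geometry) (n : nat) : set (vect R X n) :=
  [set x | match X with
           | Spherical => bform x x = 1
           | Euclidean => True
           | Lobachevsky =>
               bform x x = -1 /\
               forall j : 'I_(vdim X n), val j = 0%N -> 0 < x 0 j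
           end].

Definition arcosh (R : realType) (t : R) : R := ln (t + Num.sqrt (t ^+ 2 - 1)).

Definition dist (R : realType) (X : geometry) (n : nat)
    (x y : vect R X n) : R :=
  match X with
  | Spherical => acos (bform x y)
  | Euclidean => Num.sqrt (bform (x - y) (x - y))
  | Lobachevsky => arcosh (- bform x y)
  end.

Definition dist_to (R : realType) (X : geometry) (n : nat)
    (x : vect R X n) (A : set (vect R X n)) : R :=
  inf [set dist x y | y in A].

(* Homogeneous coordinates: in the Euclidean case a point x is sent to (1, x)
   and a vector x to (0, x), so that affine notions become linear ones. *)
Definition hom_pt (R : realType) (X : geometry) (n : nat) :
    vect R X n -> 'rV[R]_n.+1 :=
  match X return vect R X n -> 'rV[R]_n.+1 with
  | Euclidean => fun x => row_mx (1%:M : 'rV[R]_1) x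
  | _ => fun x => x
  end.

Definition hom_vec (R : realType) (X : geometry) (n : nat) :
    vect R X n -> 'rV[R]_n.+1 :=
  match X return vect R X n -> 'rV[R]_n.+1 with
  | Euclidean => fun x => row_mx (0 : 'rV[R]_1) x
  | _ => fun x => x
  end.

Definition hom_mx (R : realType) (X : geometry) (n p : nat)
    (f : 'I_p -> vect R X n) : 'M[R]_(p, n.+1) :=
  \matrix_(i < p) hom_pt (f i).

Definition independent (R : realType) (X : geometry) (n p : nat)
    (f : 'I_p -> vect R X n) : bool :=
  row_free (hom_mx f).

Definition span_plane (R : realType) (X : geometry) (n p : nat)
    (f : 'I_p -> vect R X n) : set (vect R X n) :=
  [set x | Xspace x /\ (hom_pt x <= hom_mx f)%MS].

(* A is a (p-1)-dimensional plane of X^n; p is the number of independent points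
   spanning it, so the hyperplanes of X^n are the planes with p = n. *)
Definition is_plane (R : realType) (X : geometry) (n p : nat)
    (A : set (vect R X n)) : Prop :=
  A !=set0 /\
  exists U : 'M[R]_(p, n.+1),
    row_free U /\ A = [set x | Xspace x /\ (hom_pt x <= U)%MS].

(** * Hypersurfaces: tangency, orientation, angles *)

(* The vectors tangent to A at x: velocities of curves in A through x. *)
Definition tangent_vector (R : realType) (X : geometry) (n : nat)
    (A : set (vect R X n)) (x xi : vect R X n) : Prop :=
  exists gamma : R -> vect R X n,
    [/\ gamma 0 = x, (\forall t \near (0 : R), A (gamma t))
      & is_derive (0 : R) (1 : R) gamma xi].

Definition tangent_at (R : realType) (X : geometry) (n : nat)
    (A B : set (vect R X n)) (x : vect R X n) : Prop :=
  [/\ A x, B x &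
      forall xi, tangent_vector A x xi <-> tangent_vector B x xi].

Definition unit_normal (R : realType) (X : geometry) (n : nat)
    (A : set (vect R X n)) (x nu : vect R X n) : Prop :=
  [/\ bform nu nu = 1,
      tangent_vector (@Xspace R X n) x nu &
      forall xi, tangent_vector A x xi -> bform nu xi = 0].

(* X^n being oriented in the standard way, an orientation of a hypersurface is
   a continuous field of unit normals: a tangent frame is positive if, preceded
   by the normal, it is a positive frame of X^n. *)
Definition orientation (R : realType) (X : geometry) (n : nat)
    (A : set (vect R X n)) (nu : vect R X n -> vect R X n) : Prop :=
  {within A, continuous nu} /\ forall x, A x -> unit_normal A x (nu x).

(* Compares, for an (n-1)-simplex with ordered vertices f, the orientation of
   its hyperplane given by this order with the one given by the normal nu. *)
Definition orient_sign (R : realType) (X : geometry) (n : nat)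
    (nu : vect R X n) (f : 'I_n -> vect R X n) : R :=
  Num.sg (\det (col_mx (hom_vec nu) (hom_mx f) : 'M[R]_n.+1)).

Definition meet_at_angle (R : realType) (X : geometry) (n : nat)
    (F H : set (vect R X n)) (alpha : R) : Prop :=
  F `&` H !=set0 /\
  forall x nu nu', F x -> H x -> unit_normal F x nu -> unit_normal H x nu' ->
    acos `|bform nu nu'| = alpha.

(* v represents a point of the absolute lying on the plane A of Lambda^n. *)
Definition ideal_point (R : realType) (X : geometry) (n : nat)
    (A : set (vect R X n)) (v : vect R X n) : Prop :=
  [/\ v != 0, bform v v = 0 &
      exists (p : nat) (f : 'I_p -> vect R X n),
        (forall i, A (f i)) /\ (v <= \matrix_(i < p) f i)%MS].

Definition parallel (R : realType) (X : geometry) (n : nat)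
    (F H : set (vect R X n)) : Prop :=
  F `&` H = set0 /\
  exists v, [/\ ideal_point F v, ideal_point H v &
    forall v', ideal_point F v' -> ideal_point H v' -> exists c, v' = c *: v].

(* The orthogonal projection of x to the hyperplane with unit normal w
   passing through h. *)
Definition orth_proj (R : realType) (X : geometry) (n : nat)
    (h w x : vect R X n) : vect R X n :=
  let y := x - bform (x - h) w *: w in
  if X is Euclidean then y else (vnorm y)^-1 *: y.

Definition sphere (R : realType) (X : geometry) (n : nat)
    (o : vect R X n) (r : R) : set (vect R X n) :=
  [set x | Xspace x /\ dist x o = r].

Definition sphere_radius (R : realType) (X : geometry) (r : R) : Prop :=
  0 < r /\ (X = Spherical -> r < pi).

Definition great_radius (R : realType) (X : geometry) (r : R) : Prop :=
  X = Spherical /\ r = pi / 2.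

Definition orisphere (R : realType) (X : geometry) (n : nat)
    (v : vect R X n) (c : R) : set (vect R X n) :=
  [set x | Xspace x /\ bform x v = c].

(* On the sphere r = pi / 2 is excluded: the points at this distance from H
   are its two poles. *)
Definition equidistant (R : realType) (X : geometry) (n : nat)
    (H Om : set (vect R X n)) : Prop :=
  X <> Euclidean /\
  exists r : R, [/\ 0 < r, (X = Spherical -> r < pi / 2) &
    let A := [set x | Xspace x /\ dist_to x H = r] in
    exists2 x, A x & Om = connected_component A x].

(** * Cross-polytopes *)

(* The facet Delta_{I,J} of a cross-polytope with vertices a_i, b_i is encoded
   by J, the set I being the complement of J; its vertices are ordered by their
   indices. *)
Definition facet (R : realType) (X : geometry) (n p : nat)
    (a b : 'I_p -> vect R X n) (J : {set 'I_p}) : 'I_p -> vect R X n :=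
  fun i => if i \in J then b i else a i.

(* An orientation of the polyhedral surface of type K_p; o J compares the
   orientation of the facet J with the order of its vertices. Neighbouring
   facets differ by replacing a_i with b_i at the same position, hence they
   induce opposite orientations on their common face iff their signs differ. *)
Definition coherent (R : realType) (p : nat) (o : {set 'I_p} -> R) : Prop :=
  (forall J, o J = 1 \/ o J = -1) /\
  forall (J : {set 'I_p}) (i : 'I_p), i \notin J -> o (i |: J)%SET = - o J.

Definition circumscribed (R : realType) (X : geometry) (n : nat)
    (a b : 'I_n -> vect R X n) (Om : set (vect R X n)) : Prop :=
  forall J, exists t, tangent_at (span_plane (facet a b J)) Om t.

(* The decomposition of the facets given by Om consists of the classes
   {J | P J} and {J | ~~ P J}; e tells which of them has the sign +. *)
Definition surface_decomposition (R : realType) (X : geometry) (n : nat)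
    (a b : 'I_n -> vect R X n) (Om : set (vect R X n))
    (P : pred {set 'I_n}) : Prop :=
  exists (nu : vect R X n -> vect R X n) (o : {set 'I_n} -> R) (e : bool),
    [/\ orientation Om nu, coherent o &
      forall J t, tangent_at (span_plane (facet a b J)) Om t ->
        o J * orient_sign (nu t) (facet a b J) = (-1) ^+ (e (+) P J)].

(* The same for a hyperplane H (whose unit normal is constant): the orientation
   of the hyperplane of a facet is carried to H by orthogonal projection. *)
Definition hyperplane_decomposition (R : realType) (X : geometry) (n : nat)
    (a b : 'I_n -> vect R X n) (H : set (vect R X n))
    (P : pred {set 'I_n}) : Prop :=
  exists (h w : vect R X n) (o : {set 'I_n} -> R) (e : bool),
    [/\ H h, orientation H (fun=> w), coherent o &
      forall J, o J * orient_sign w (fun i => orth_proj h w (facet a b J i))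
                = (-1) ^+ (e (+) P J)].

Definition vertex (R : realType) (X : geometry) (n : nat)
    (a b : 'I_n -> vect R X n) (v : 'I_n * bool) : vect R X n :=
  if v.2 then b v.1 else a v.1.

Definition cross_complex (n : nat) : {set {set 'I_n * bool}} :=
  [set sigma : {set 'I_n * bool} |
     [forall i, ~~ (((i, false) \in sigma) && ((i, true) \in sigma))]]%SET.

(* An (n-1)-dimensional subcomplex of K_n. *)
Definition full_subcomplex (n : nat) (K : {set {set 'I_n * bool}}) : Prop :=
  [/\ K \subset cross_complex n,
      (forall sigma tau : {set 'I_n * bool},
         sigma \in K -> tau \subset sigma -> tau \in K) &
      exists2 sigma, sigma \in K & #|sigma| = n].

(* Planes are convex, so a simplex is mapped into a plane as soon as its
   vertices are. *)
Definition cross_nondegenerate (R : realType) (X : geometry) (n : nat)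
    (a b : 'I_n -> vect R X n) : Prop :=
  (forall sigma, sigma \in cross_complex n ->
     independent (fun i : 'I_#|sigma| => vertex a b (enum_val i))) /\
  ~ exists K1 K2 : {set {set 'I_n * bool}},
      [/\ full_subcomplex K1, full_subcomplex K2,
          (K1 :|: K2)%SET = cross_complex n &
          exists A : set (vect R X n), is_plane n.-1 A /\
            forall sigma v, sigma \in (K1 :&: K2)%SET -> v \in sigma ->
              A (vertex a b v)].

(** * Flexible cross-polytopes of the simplest type *)

Definition gram_data (R : realType) (X : geometry) (n : nat)
    (G : 'M[R]_n) : Prop :=
  [/\ G^T = G, (forall i, G i i = 1),
      (forall p (f : 'I_p -> 'I_n), (2 <= p < n)%N ->
         {homo f : i j / (i < j)%N} -> 0 < \det (mxsub f f G)) &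
      match X with
      | Spherical => 0 < \det G
      | Euclidean => \det G = 0
      | Lobachevsky => \det G < 0
      end].

Definition hcoef (R : realType) (n : nat) (G : 'M[R]_n) (lam : 'I_n -> R)
    (i j : 'I_n) : R :=
  if i == j then 1
  else 2 * lam i * (lam i * G i j - lam j) / (lam i ^+ 2 - lam j ^+ 2).

(* The parameter u ranges over R and infinity (None), where the values are the
   limits as u tends to infinity. *)
Definition ncoef (R : realType) (l : R) (u : option R) : R :=
  if u is Some t then 2 * l ^+ 2 * t ^+ 2 / (l ^+ 2 * t ^+ 2 + 1) else 2.

Definition mcoef (R : realType) (l : R) (u : option R) : R :=
  if u is Some t then 2 * l * t / (l ^+ 2 * t ^+ 2 + 1) else 0.

Definition curved_vertices (R : realType) (X : geometry) (n : nat)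
    (G : 'M[R]_n) (lam s s' : 'I_n -> R)
    (nn : 'I_n -> vect R X n) (m : vect R X n)
    (a : 'I_n -> vect R X n) (b : option R -> 'I_n -> vect R X n) : Prop :=
  exists c : 'I_n -> vect R X n,
    let d u i := \sum_j hcoef G lam i j *: c j
                 - ncoef (lam i) u *: nn i + mcoef (lam i) u *: m in
    [/\ (forall i, (c i <= \matrix_(j < n) nn j)%MS /\
           forall j, bform (c i) (nn j) = (i == j)%:R),
        (X = Lobachevsky -> forall u i, bform (d u i) (d u i) < 0),
        (forall i, a i = (s i / vnorm (c i)) *: c i),
        (forall u i, b u i = (s' i / vnorm (d u i)) *: d u i) &
        forall u i, Xspace (a i) /\ Xspace (b u i)].

Definition euclidean_vertices (R : realType) (X : geometry) (n : nat)
    (G : 'M[R]_n) (lam s s' : 'I_n -> R)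
    (nn : 'I_n -> vect R X n) (m : vect R X n)
    (a : 'I_n -> vect R X n) (b : option R -> 'I_n -> vect R X n) : Prop :=
  let alt i := s i * dist_to (a i) (span_plane (fun j => a (lift i j))) in
  let binv i := \sum_j hcoef G lam i j / alt j in
  [/\ independent a /\ (forall i j, bform (a i - a j) m = 0),
      (forall i j k, j != i -> k != i -> bform (a j - a k) (nn i) = 0),
      (* s_i *: n_i is the interior normal of the facet opposite to a_i *)
      (forall i j, j != i -> 0 < s i * bform (a i - a j) (nn i)),
      (forall i, binv i != 0 /\ s' i = Num.sg (binv i)^-1) &
      forall u i, b u i = (binv i)^-1 *:
        (\sum_j (hcoef G lam i j / alt j) *: a j
         - ncoef (lam i) u *: nn i + mcoef (lam i) u *: m)].

Definition simplest_type (R : realType) (X : geometry) (n : nat)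
    (G : 'M[R]_n) (lam s s' : 'I_n -> R)
    (nn : 'I_n -> vect R X n) (m : vect R X n)
    (a : 'I_n -> vect R X n) (b : option R -> 'I_n -> vect R X n) : Prop :=
  [/\ gram_data X G,
      (forall i, 0 < lam i) /\ {homo lam : i j / (i < j)%N >-> i < j},
      (forall i, (s i = 1 \/ s i = -1) /\ (s' i = 1 \/ s' i = -1)),
      [/\ (forall i j, bform (nn i) (nn j) = G i j),
          (forall i, bform m (nn i) = 0) & bform m m = 1] &
      (if X is Euclidean then euclidean_vertices G lam s s' nn m a b
       else curved_vertices G lam s s' nn m a b) /\
      finite_set [set u : option R | ~ cross_nondegenerate a (b u)]].

Definition Xset (R : realType) (n : nat) (s s' : 'I_n -> R) (k : 'I_n) :
    {set 'I_n} :=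
  [set i : 'I_n | ((i < k)%N && (s i * s' i == 1))
               || ((k < i)%N && (s i * s' i == -1))]%SET.

(* The facets of P_(k) are indexed by subsets of 'I_n.-1, via the increasing
   bijection lift k from 'I_n.-1 onto the complement of k. *)
Definition odd_class (R : realType) (n : nat) (s s' : 'I_n -> R) (k : 'I_n) :
    pred {set 'I_n.-1} :=
  fun J => odd #|((lift k @: J) :\: Xset s s' k)%SET|.

(** * The flat position *)

(* x |-> x *m M + t identifies X^{n-1} isometrically with the hyperplane of X^n
   orthogonal to m and passing through the points a_i. *)
Definition flat_chart (R : realType) (X : geometry) (n : nat)
    (m : vect R X n) (a : 'I_n -> vect R X n)
    (M : 'M[R]_(vdim X n.-1, vdim X n)) (t : vect R X n) : Prop :=
  [/\ (X <> Euclidean -> t = 0),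
      (forall x y : vect R X n.-1, bform (x *m M) (y *m M) = bform x y) &
      [set x *m M + t | x in @Xspace R X n.-1] =
      [set y | Xspace y /\ forall i, bform (y - a i) m = 0]].

(* P_(k) has the vertices qa i, qb i with i != k and is (n-1)-dimensional, that
   is, it does not lie in a hyperplane of X^{n-1}. This can fail, only for the
   least lambda_k, when g_{kj} = lambda_k / lambda_j for all j: the vertices of
   P_u other than a_k and b_k lie then in a hyperplane of X^n for every u, and
   for u = 0 all facets of P_(k) have the same hyperplane. *)
Definition full_dimensional (R : realType) (X : geometry) (n : nat)
    (a b : 'I_n -> vect R X n) : Prop :=
  ~ exists F : set (vect R X n), is_plane n F /\ forall i, F (a i) /\ F (b i).

(* Main.v *)
Require Import Defs.
From mathcomp Require Import all_boot all_order all_algebra.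
From mathcomp Require Import fingroup perm.
From mathcomp Require Import all_classical all_reals all_analysis.
From mathcomp Require Import ring lra.

Set Implicit Arguments.
Unset Strict Implicit.
Unset Printing Implicit Defensive.

Import Order.TTheory GRing.Theory Num.Theory.
Import numFieldNormedType.Exports.

Local Open Scope classical_set_scope.
Local Open Scope ring_scope.

(** Rescale the vertices of the flat position: c_i is the multiple of a_i with
    <c_i, n_j> = delta_ij, and d_i = sum_j h_ij c_j is the corresponding multiple
    of b_i (in homogeneous coordinates for the Euclidean space). The facet
    Delta_{I,J} of P_(k) lies in the zero set of the functional nu = sum_l x_l n_l
    whose coordinates satisfy x_i = 0 for i in I and (Hx)_j = 0 for j in J. The
    whole theorem rests on two identities for H = (h_ij):
      h_ij + h_ji = 2 g_ij   and
      h_ij / lambda_i ^ 2 + h_ji / lambda_j ^ 2 = 2 / (lambda_i lambda_j).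
    Evaluated as quadratic forms at x, both keep on the left only the term with
    index k, since everywhere else x_i or (Hx)_i vanishes. Comparing them gives
    <nu, nu> = lambda_k ^ 2 <nu, o> ^ 2 for the vector o = sum_l c_l / lambda_l,
    which depends neither on J nor on k. So the unit normals of all facets of
    P_(k) have the same product 1 / lambda_k with o, up to sign
    ([facet_center_sqr]).

    What this means geometrically depends on o alone. If o represents a point of
    the space, this point is at the same distance from all facets; if o is
    isotropic, the facets touch an orisphere with centre o; if o is the normal of a
    hyperplane, the facets make with it the same angle, or are parallel to it, or
    touch an equidistant hypersurface, according to the value of the common
    product. In the curved spaces spheres, orispheres and equidistant
    hypersurfaces are all level sets of x |-> <x, o>, and one computation of
    tangent vectors and tangency points ([tangent_level], [tangent_at_level])
    serves them all. A facet lying in the hyperplane orthogonal to o would force all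
    the others into it ([facet_normal_proper]), and this is what excludes the
    limit cases of tangency and of the angle: P_(k) is full-dimensional.

    The decomposition compares the signs of det (o, f_1, ..., f_(n-1)) over the
    facets. Normalise x by x_k = 1. Up to the signs s_i, s_i' and a positive
    determinant this determinant is <nu, o>, so its sign must be shown to be the
    parity of the number of j in J with j < k. This goes by induction on J: adding
    j to J replaces nu by nu - theta nu', where nu' is the functional of J with j
    in the role of k, and a suitable combination of nu and nu' has a positive
    square equal to a positive multiple of
    (lambda_j ^ 2 - lambda_k ^ 2) <nu, o> <nu - theta nu', o>
    ([facet_center_step]). Positivity of such squares is the only input from the
    geometry: a functional that vanishes at a vertex, which is a point of the
    space, has a normal of positive square ([frame_pos]); as n >= 3, a third index always
    provides such a vertex. *)

(** * The pivot system of h_ij *)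

Lemma unitmx_injP (F : fieldType) n (A : 'M[F]_n) :
  (forall x : 'cV_n, A *m x = 0 -> x = 0) -> A \in unitmx.
Proof.
move=> Ainj; rewrite -unitmx_tr -row_free_unit -kermx_eq0; apply/eqP/row_matrixP=> i.
rewrite row0; apply: (can_inj trmxK); rewrite trmx0; apply: Ainj.
apply: (can_inj trmxK); rewrite trmx_mul trmxK trmx0 -row_mul mulmx_ker.
by rewrite row0.
Qed.

(** Cramer rule for rows. *)
Lemma det_row_replace (F : fieldType) n (A : 'M[F]_n) (k : 'I_n) (v : 'rV_n) :
  A \in unitmx ->
  \det (\matrix_i (if i == k then v else row i A)) =
  \det A * (v *m invmx A) 0 k.
Proof.
move=> uA; set w := v *m invmx A.
have -> : \matrix_i (if i == k then v else row i A) =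
    (\matrix_i (if i == k then w else delta_mx 0 i)) *m A.
  apply/row_matrixP=> i; rewrite row_mul !rowK.
  by case: eqP => _; rewrite /w ?mulmxKV// -rowE.
rewrite det_mulmx mulrC; congr (_ * _).
rewrite (expand_det_col _ k) (bigD1 k)//= big1 ?addr0 => [|i /negbTE ik].
  rewrite mxE eqxx /cofactor -signr_odd addnn odd_double expr0 mul1r.
  rewrite [X in \det X](_ : _ = 1%:M) ?det1 ?mulr1//.
  apply/matrixP=> i j; rewrite !mxE eq_sym (negPf (neq_lift _ _)) !mxE eqxx/=.
  by rewrite (inj_eq lift_inj) eq_sym.
by rewrite mxE ik mxE eqxx eq_sym ik mul0r.
Qed.

Section PivotSystem.
Variables (R : realType) (n : nat) (G : 'M[R]_n) (lam : 'I_n -> R).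
Hypothesis Gsym : G^T = G.
Hypothesis Gdiag : forall i, G i i = 1.
Hypothesis lam_gt0 : forall i, 0 < lam i.
Hypothesis lam_mono : {homo lam : i j / (i < j)%N >-> i < j}.

Definition hmatrix : 'M[R]_n := \matrix_(i, j) hcoef G lam i j.
Local Notation H := hmatrix.

Let lam_neq i j : i != j -> lam i ^+ 2 - lam j ^+ 2 != 0.
Proof.
move=> ij; have li := lam_gt0 i; have lj := lam_gt0 j.
rewrite subr_sqr mulf_neq0//; last by rewrite gt_eqF ?addr_gt0.
rewrite subr_eq0.
by case: (ltngtP i j) ij => [/lam_mono/lt_eqF->|/lam_mono/gt_eqF->|/val_inj->]//;
  rewrite ?eqxx.
Qed.

Let Gij i j : G i j = G j i. Proof. by rewrite -{1}Gsym mxE. Qed.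

(** The diagonal value h_ii = 1 is what makes both identities hold for i = j. *)
Lemma hmatrix_gram i j : H i j + H j i = 2 * G i j.
Proof.
rewrite !mxE /hcoef eq_sym; case: eqP => [->|/eqP ji]; first by rewrite Gdiag; ring.
have ij : i != j by rewrite eq_sym.
have lij := lam_neq ij; have lji := lam_neq ji; rewrite (Gij j i); field.
by apply/andP.
Qed.

Lemma hmatrix_center i j :
  H i j / lam i ^+ 2 + H j i / lam j ^+ 2 = 2 / (lam i * lam j).
Proof.
have li : lam i != 0 by rewrite gt_eqF.
have lj : lam j != 0 by rewrite gt_eqF.
rewrite !mxE /hcoef eq_sym; case: eqP => [->|/eqP ji]; first by field.
have ij : i != j by rewrite eq_sym.
have lij := lam_neq ij; have lji := lam_neq ji; rewrite (Gij j i); field.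
by apply/and4P.
Qed.

(** The value at o = sum_l c_l / lambda_l of the functional with coordinates x. *)
Definition center_val (x : 'cV[R]_n) : R := \sum_i x i 0 / lam i.

Definition gram_val (x y : 'cV[R]_n) : R := \sum_i x i 0 * (G *m y) i 0.

Lemma hmatrix_gramE (x y : 'cV[R]_n) :
  \sum_i x i 0 * (H *m y) i 0 + \sum_i y i 0 * (H *m x) i 0 = 2 * gram_val x y.
Proof.
rewrite /gram_val mulr_sumr.
under eq_bigr do rewrite mxE mulr_sumr.
under [X in _ + X]eq_bigr do rewrite mxE mulr_sumr.
rewrite [X in _ + X]exchange_big -big_split/=; apply: eq_bigr => i _.
rewrite [(G *m y) i 0]mxE !mulr_sumr -big_split/=; apply: eq_bigr => j _.
have := hmatrix_gram i j; move: (H i j) (H j i) (G i j) => p q r pqr.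
transitivity (x i 0 * y j 0 * (p + q)).
  ring.
by rewrite pqr; ring.
Qed.

Lemma hmatrix_centerE (x y : 'cV[R]_n) :
  \sum_i x i 0 / lam i ^+ 2 * (H *m y) i 0 +
  \sum_i y i 0 / lam i ^+ 2 * (H *m x) i 0 = 2 * center_val x * center_val y.
Proof.
rewrite /center_val -mulrA mulr_suml mulr_sumr.
under eq_bigr do rewrite mxE mulr_sumr.
under [X in _ + X]eq_bigr do rewrite mxE mulr_sumr.
rewrite [X in _ + X]exchange_big -big_split/=; apply: eq_bigr => i _.
rewrite !mulr_sumr -big_split/=; apply: eq_bigr => j _.
have := hmatrix_center i j; move: (H i j) (H j i) => p q pqr.
transitivity (x i 0 * y j 0 * (p / lam i ^+ 2 + q / lam j ^+ 2)).
  ring.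
rewrite pqr; field; by rewrite !gt_eqF.
Qed.

Lemma gram_valDl x y z : gram_val (x + y) z = gram_val x z + gram_val y z.
Proof. by rewrite -big_split; apply: eq_bigr => i _; rewrite mxE mulrDl. Qed.

Lemma gram_valZl c x z : gram_val (c *: x) z = c * gram_val x z.
Proof. by rewrite mulr_sumr; apply: eq_bigr => i _; rewrite mxE mulrA. Qed.

Lemma gram_valC (x y : 'cV[R]_n) : gram_val x y = gram_val y x.
Proof.
have two : 2 != 0 :> R by [].
by apply: (mulfI two); rewrite -!hmatrix_gramE addrC.
Qed.

Lemma center_valB c x y : center_val (x - c *: y) = center_val x - c * center_val y.
Proof.
rewrite /center_val mulr_sumr -sumrB; apply: eq_bigr => i _.
by rewrite !mxE; ring.
Qed.

(** Its rows are the coordinates, in the basis c, of the vertices of the face given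
    by J: d_i for i in J and c_i otherwise. *)
Definition pivot_mx (J : {set 'I_n}) : 'M[R]_n :=
  \matrix_(i, j) if i \in J then H i j else (i == j)%:R.

Lemma pivot_mxE (J : {set 'I_n}) (x : 'cV[R]_n) i :
  (pivot_mx J *m x) i 0 = if i \in J then (H *m x) i 0 else x i 0.
Proof.
rewrite mxE; case: ifP => iJ.
  by rewrite mxE; apply: eq_bigr => j _; rewrite !mxE iJ.
rewrite (bigD1 i)//= big1 => [|j ji]; rewrite mxE iJ ?eqxx ?mul1r ?addr0//.
by rewrite eq_sym (negbTE ji) mul0r.
Qed.

Hypothesis n_ge3 : (2 < n)%N.

Hypothesis gram_pos : forall x : 'cV[R]_n, x != 0 ->
  (exists i, x i 0 = 0 \/ (H *m x) i 0 = 0) -> 0 < gram_val x x.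

Lemma gram_hmatrix x : gram_val x x = \sum_i x i 0 * (H *m x) i 0.
Proof. have := hmatrix_gramE x x; lra. Qed.

(** For a vector of the kernel every product x_i (Hx)_i vanishes, hence so does the
    square of the normal. *)
Lemma pivot_unit (J : {set 'I_n}) : pivot_mx J \in unitmx.
Proof.
apply: unitmx_injP => x Jx; apply: contra_eq (erefl 0 : 0 = 0 :> R) => x0.
have Jxi i : (if i \in J then (H *m x) i 0 else x i 0) = 0.
  by rewrite -pivot_mxE Jx mxE.
have : 0 < gram_val x x.
  apply: gram_pos => //; exists (Ordinal (ltnW (ltnW n_ge3))).
  by have := Jxi (Ordinal (ltnW (ltnW n_ge3))); case: ifP => _; [right|left].
rewrite gram_hmatrix big1 ?ltxx// => i _.
by have := Jxi i; case: ifP => _ ->; rewrite ?mulr0 ?mul0r.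
Qed.

(** The functional equal to 1 at the vertex of index k and to 0 at all the others. *)
Definition facet_covector J k : 'cV[R]_n := invmx (pivot_mx J) *m delta_mx k 0.
Local Notation sol := facet_covector.

Lemma facet_covectorP (J : {set 'I_n}) k i :
  (if i \in J then (H *m sol J k) i 0 else sol J k i 0) = (i == k)%:R.
Proof. by rewrite -pivot_mxE mulKVmx ?pivot_unit// mxE eqxx andbT. Qed.

Lemma facet_covector_uniq (J : {set 'I_n}) k (x : 'cV[R]_n) :
  (forall i, (if i \in J then (H *m x) i 0 else x i 0) = (i == k)%:R) ->
  x = sol J k.
Proof.
move=> xP; apply: (can_inj (mulKmx (pivot_unit J))).
by apply/matrixP => i j; rewrite ord1 !pivot_mxE xP facet_covectorP.
Qed.

Lemma exists_third (j k : 'I_n) : exists2 i : 'I_n, i != j & i != k.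
Proof.
have : (0 < #|~: [set j; k]%SET|)%N.
  by rewrite cardsCs finset.setCK card_ord subn_gt0 cards2; apply: leq_ltn_trans n_ge3; case: (_ != _).
by case/card_gt0P=> i; rewrite !inE negb_or => /andP[]; exists i.
Qed.

Lemma facet_covector_neq0 (J : {set 'I_n}) k : k \notin J -> sol J k != 0.
Proof.
move=> kJ; apply/eqP => /matrixP/(_ k 0); have := facet_covectorP J k k.
by rewrite (negPf kJ) eqxx => ->; rewrite mxE => /eqP; rewrite oner_eq0.
Qed.

Lemma facet_gram_gt0 (J : {set 'I_n}) k : k \notin J -> 0 < gram_val (sol J k) (sol J k).
Proof.
move=> kJ; apply: gram_pos; first exact: facet_covector_neq0.
have [i ik _] := exists_third k k; exists i; have := facet_covectorP J k i.
by rewrite (negPf ik); case: ifP; [right|left].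
Qed.

(** Only the index k contributes: elsewhere either a coordinate of the functional
    or its value at the other vector vanishes. *)
Lemma sum_facet_covector (J : {set 'I_n}) k (w : 'I_n -> R) (x : 'cV[R]_n) : k \notin J ->
  (forall i, i \in J -> (H *m x) i 0 = 0) ->
  \sum_i sol J k i 0 * w i * (H *m x) i 0 = w k * (H *m x) k 0.
Proof.
move=> kJ xJ; rewrite (bigD1 k)//= big1 ?addr0 => [|i ik].
  by have := facet_covectorP J k k; rewrite (negPf kJ) eqxx => ->; rewrite mul1r.
have := facet_covectorP J k i; have := xJ i; case: ifP => iJ.
  by move=> ->//; rewrite mulr0.
by move=> _ ->; rewrite (negPf ik) !mul0r.
Qed.

Lemma facet_covector_in (J : {set 'I_n}) k i : k \notin J -> i \in J -> (H *m sol J k) i 0 = 0.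
Proof.
move=> kJ iJ; have := facet_covectorP J k i; rewrite iJ => ->.
by case: eqP iJ kJ => // -> ->.
Qed.

Lemma facet_gramE (J : {set 'I_n}) j k : j \notin J -> k \notin J ->
  2 * gram_val (sol J k) (sol J j) =
  (H *m sol J j) k 0 + (H *m sol J k) j 0.
Proof.
move=> jJ kJ; rewrite -hmatrix_gramE.
have := @sum_facet_covector J k (fun=> 1) (sol J j) kJ.
have := @sum_facet_covector J j (fun=> 1) (sol J k) jJ.
rewrite !mul1r; under eq_bigr do rewrite mulr1; move=> ->; last by move=> i /facet_covector_in->.
by under eq_bigr do rewrite mulr1; move=> ->// i /facet_covector_in->.
Qed.

Lemma facet_centerE (J : {set 'I_n}) j k : j \notin J -> k \notin J ->
  2 * center_val (sol J k) * center_val (sol J j) =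
  (H *m sol J j) k 0 / lam k ^+ 2 + (H *m sol J k) j 0 / lam j ^+ 2.
Proof.
move=> jJ kJ; rewrite -hmatrix_centerE.
have := @sum_facet_covector J k (fun i => (lam i ^+ 2)^-1) (sol J j) kJ.
have := @sum_facet_covector J j (fun i => (lam i ^+ 2)^-1) (sol J k) jJ.
move=> ->; last by move=> i /facet_covector_in->.
move=> ->; last by move=> i /facet_covector_in->.
by rewrite ![_^-1 * _]mulrC.
Qed.

(** The key relation: as quadratic forms at the functional, both identities for H
    keep on the left the single term of index k. *)
Lemma facet_center_sqr (J : {set 'I_n}) k : k \notin J ->
  gram_val (sol J k) (sol J k) = (lam k * center_val (sol J k)) ^+ 2.
Proof.
move=> kJ; have := facet_centerE kJ kJ; have := facet_gramE kJ kJ.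
have l0 : lam k != 0 by rewrite gt_eqF.
set g := gram_val _ _; set c := center_val _; set y := (H *m _) k 0 => e1 e2.
have -> : g = y by lra.
have -> : (lam k * c) ^+ 2 = lam k ^+ 2 / 2 * (2 * c * c) by field.
by rewrite e2; field.
Qed.

Lemma facet_center_neq0 (J : {set 'I_n}) k : k \notin J -> center_val (sol J k) != 0.
Proof.
move=> kJ; have := facet_gram_gt0 kJ; rewrite facet_center_sqr//.
by apply: contraTneq => ->; rewrite mulr0 expr0n ltxx.
Qed.

Lemma facet_pivot_gt0 (J : {set 'I_n}) j : j \notin J -> 0 < (H *m sol J j) j 0.
Proof.
move=> jJ; have := facet_gramE jJ jJ; have := facet_gram_gt0 jJ; lra.
Qed.

(** Passing from J minus j to J multiplies the determinant by the value (Hx)_j of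
    the functional of index j, which equals the square of its normal. *)
Lemma pivot_det_gt0 (J : {set 'I_n}) : 0 < \det (pivot_mx J).
Proof.
elim: {J}#|J| {-2}J (erefl #|J|) => [|p IH] J.
  move/eqP; rewrite cards_eq0 => /eqP->.
  rewrite [pivot_mx _](_ : _ = 1%:M) ?det1//.
  by apply/matrixP => i j; rewrite !mxE inE.
move=> Jp; have /card_gt0P[j jJ] : (0 < #|J|)%N by rewrite Jp.
have jJ' : j \notin (J :\ j)%SET by rewrite !inE eqxx.
have := cardsD1 j J; rewrite jJ Jp => -[/esym/IH J'pos].
rewrite [pivot_mx J](_ : _ = \matrix_i (if i == j then row j H
   else row i (pivot_mx (J :\ j)%SET))); last first.
  apply/row_matrixP => i; rewrite rowK; apply/rowP => l.
  case: eqP => [->|/eqP ij]; first by rewrite !mxE jJ.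
  by rewrite !mxE !inE ij.
rewrite det_row_replace ?pivot_unit// mulr_gt0//.
suff -> : (row j H *m invmx (pivot_mx (J :\ j)%SET)) 0 j =
          (H *m sol (J :\ j)%SET j) j 0 by exact: facet_pivot_gt0.
have -> : (row j H *m invmx (pivot_mx (J :\ j)%SET)) 0 j =
  (row j H *m invmx (pivot_mx (J :\ j)%SET) *m (delta_mx j 0 : 'cV_n)) 0 0.
  by rewrite -colE [RHS]mxE.
by rewrite -mulmxA -row_mul mxE.
Qed.

(** Orthogonality of all functionals to the vertices of J leaves a plane spanned by
    those of indices j and k; there the functional for j |: J is fixed by its
    vanishing at d_j. *)
Lemma facet_center_step (J : {set 'I_n}) j k : j \notin J -> k \notin J -> j != k ->
  0 < center_val (sol J k) * center_val (sol (j |: J)%SET k) * (lam j - lam k).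
Proof.
move=> jJ kJ jk.
have lj := lam_gt0 j; have lk := lam_gt0 k.
have lj0 : lam j != 0 by rewrite gt_eqF.
have lk0 : lam k != 0 by rewrite gt_eqF.
pose th := (H *m sol J k) j 0 / (H *m sol J j) j 0.
have yj := facet_pivot_gt0 jJ.
have kj : k != j by rewrite eq_sym.
have E : sol (j |: J)%SET k = sol J k - th *: sol J j.
  apply/esym/facet_covector_uniq => i; rewrite mulmxBr -scalemxAr !inE.
  have subE (v w : 'cV[R]_n) : (v - th *: w) i 0 = v i 0 - th * w i 0.
    by rewrite !mxE.
  rewrite !subE.
  have Pk := facet_covectorP J k i; have Pj := facet_covectorP J j i.
  case: eqP => [->|/eqP ij]/=.
    by rewrite /th divfK ?(gt_eqF yj)// subrr (negPf jk).
  case: ifP Pk Pj => iJ -> ->; by rewrite (negPf ij) mulr0 subr0.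
rewrite E center_valB {E}.
have g1 := facet_gramE jJ kJ; have c1 := facet_centerE jJ kJ.
have gk := facet_center_sqr kJ; have gj := facet_center_sqr jJ.
have gj2 := facet_gramE jJ jJ.
set x := sol J k in c1 gk g1 th *; set x' := sol J j in c1 gj gj2 g1 yj th *.
set U := center_val x in c1 gk *; set V := center_val x' in c1 gj *.
have V0 : V != 0 := facet_center_neq0 jJ.
set e := (H *m x) j 0 in c1 g1 th *; set f := (H *m x') k 0 in c1 g1.
(* Up to scale, lam_j times the normalised x minus lam_k times the normalised x',
   where a functional is normalised by its square being 1. *)
pose z := (lam j ^+ 2 * V) *: x - (lam k ^+ 2 * U) *: x'.
have zpos : 0 < gram_val z z.
  have lincE (v w : 'cV[R]_n) p q i : (p *: v - q *: w) i 0 = p * v i 0 - q * w i 0.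
    by rewrite !mxE.
  apply: gram_pos.
    apply/eqP => /matrixP/(_ k 0); rewrite lincE [RHS]mxE.
    have := facet_covectorP J k k; have := facet_covectorP J j k.
    rewrite (negPf kJ) eqxx (negPf kj) -/x -/x' => -> ->.
    by move/eqP; rewrite mulr1 mulr0 subr0 mulf_eq0 (negPf V0) expf_eq0 (negPf lj0).
  have [i ij ik] := exists_third j k; exists i.
  have := facet_covectorP J k i; have := facet_covectorP J j i.
  rewrite -/x -/x' (negPf ij) (negPf ik) /z mulmxBr -!scalemxAr.
  by case: ifP => _ e1 e2; [right|left]; rewrite lincE e1 e2 !mulr0 subrr.
have zE : gram_val z z = lam j ^+ 2 * lam k ^+ 2 * V ^+ 2 *
    (lam j ^+ 2 - lam k ^+ 2) * (U * (U - th * V)).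
  have -> : gram_val z z = (lam j ^+ 2 * V) ^+ 2 * gram_val x x
      + (lam k ^+ 2 * U) ^+ 2 * gram_val x' x'
      - (lam j ^+ 2 * V) * (lam k ^+ 2 * U) * (2 * gram_val x x').
    rewrite /z -scaleNr gram_valDl !gram_valZl.
    rewrite ![gram_val _ (_ + _)]gram_valC !gram_valDl !gram_valZl.
    rewrite [gram_val x' x]gram_valC; ring.
  have thV : th * V ^+ 2 = e / lam j ^+ 2.
    have -> : th = e / (lam j * V) ^+ 2.
      rewrite /th; congr (_ / _); rewrite -gj; lra.
    by field; rewrite V0 lj0.
  have fE : f = lam k ^+ 2 * (2 * U * V - e / lam j ^+ 2).
    by rewrite c1; field; rewrite lk0 lj0.
  rewrite gk gj g1 fE.
  transitivity (lam j ^+ 2 * lam k ^+ 2 * U * V * (lam j ^+ 2 - lam k ^+ 2) *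
      (U * V - e / lam j ^+ 2)); first by field.
  rewrite -thV; ring.
move: zpos; rewrite zE subr_sqr => zpos.
have C0 : 0 < lam j ^+ 2 * lam k ^+ 2 * V ^+ 2 * (lam j + lam k).
  rewrite mulr_gt0 ?addr_gt0// mulr_gt0 ?exprn_even_gt0//.
  by rewrite mulr_gt0 ?exprn_gt0.
rewrite -(pmulr_rgt0 _ C0); congr (_ < _): zpos; ring.
Qed.

Lemma facet_center_sign (J : {set 'I_n}) k : k \notin J ->
  0 < center_val (sol J k) * (-1) ^+ #|[set j in J | (j < k)%N]%SET|.
Proof.
elim: {J}#|J| {-2}J (erefl #|J|) => [|p IH] J.
  move/eqP; rewrite cards_eq0 => /eqP-> _.
  have -> : [set j in (finset.set0 : {set 'I_n}) | (j < k)%N]%SET = finset.set0.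
    by apply/setP => i; rewrite !inE.
  rewrite cards0 mulr1 /center_val (bigD1 k)//= big1 ?addr0 => [|i ik].
    by have := facet_covectorP finset.set0 k k; rewrite inE eqxx => ->; rewrite mul1r invr_gt0.
  by have := facet_covectorP finset.set0 k i; rewrite inE (negPf ik) => ->; rewrite mul0r.
move=> Jp kJ; have /card_gt0P[j jJ] : (0 < #|J|)%N by rewrite Jp.
have jJ' : j \notin (J :\ j)%SET by rewrite !inE eqxx.
have kJ' : k \notin (J :\ j)%SET by rewrite !inE (negPf kJ) andbF.
have jk : j != k by apply: contraNneq kJ => <-.
have := cardsD1 j J; rewrite jJ Jp => -[/esym/IH/(_ kJ') J'pos].
have := facet_center_step jJ' kJ' jk; rewrite finset.setD1K//.
set U := center_val (sol (J :\ j)%SET k) in J'pos *; set U' := center_val _.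
have -> : [set i in J | (i < k)%N]%SET = if (j < k)%N
    then (j |: [set i in (J :\ j)%SET | (i < k)%N])%SET
    else [set i in (J :\ j)%SET | (i < k)%N]%SET.
  case: ifP => jk'; apply/setP => i; rewrite !inE; case: eqP => [->|]//=.
    by rewrite jJ jk'.
  by rewrite jk' andbF.
move=> step.
have : 0 < (U * (-1) ^+ #|[set j0 in (J :\ j)%SET | (j0 < k)%N]%SET|) *
           (U * U' * (lam j - lam k)) by rewrite mulr_gt0.
set E := _ ^+ _; have U2 : 0 < U ^+ 2.
  rewrite lt_def sqr_ge0 sqrf_eq0 andbT; apply: contraTneq step => ->.
  by rewrite !mul0r ltxx.
have -> : U * E * (U * U' * (lam j - lam k)) = U ^+ 2 * (U' * E * (lam j - lam k)).
  by ring.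
rewrite pmulr_rgt0//.
have [/lam_mono jk'|/lam_mono jk'|/val_inj E0] := ltngtP j k.
- rewrite nmulr_lgt0 ?subr_lt0// => lt0.
  by rewrite cardsU1 !inE eqxx/= add1n exprS mulN1r mulrN oppr_gt0.
- by rewrite pmulr_lgt0 ?subr_gt0.
- by rewrite E0 eqxx in jk.
Qed.

End PivotSystem.

(** * The bilinear form and the Lobachevsky space *)

Section Form.
Variables (R : realType) (X : geometry) (n : nat).
Local Notation V := (vect R X n).
Implicit Types x y z : V.

Lemma bsign_sqr j : bsign R X j * bsign R X j = 1.
Proof. by rewrite /bsign; case: X; rewrite ?mulr1//; case: ifP => _; rewrite ?mulrNN mulr1. Qed.

Lemma bformC x y : bform x y = bform y x.
Proof. by apply: eq_bigr => j _; ring. Qed.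

Lemma bformDl x y z : bform (x + y) z = bform x z + bform y z.
Proof. by rewrite -big_split; apply: eq_bigr => j _; rewrite mxE /=; ring. Qed.

Lemma bformZl c x z : bform (c *: x) z = c * bform x z.
Proof. by rewrite mulr_sumr; apply: eq_bigr => j _; rewrite mxE /=; ring. Qed.

Lemma bformNl x z : bform (- x) z = - bform x z.
Proof. by rewrite -scaleN1r bformZl mulN1r. Qed.

Lemma bformBl x y z : bform (x - y) z = bform x z - bform y z.
Proof. by rewrite bformDl bformNl. Qed.

Lemma bform0l z : bform 0 z = 0.
Proof. by rewrite -(scale0r 0) bformZl mul0r. Qed.

Lemma bformDr x y z : bform z (x + y) = bform z x + bform z y.
Proof. by rewrite !(bformC z) bformDl. Qed.

Lemma bformZr c x z : bform z (c *: x) = c * bform z x.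
Proof. by rewrite !(bformC z) bformZl. Qed.

Lemma bformNr x z : bform z (- x) = - bform z x.
Proof. by rewrite !(bformC z) bformNl. Qed.

Lemma bformBr x y z : bform z (x - y) = bform z x - bform z y.
Proof. by rewrite !(bformC z) bformBl. Qed.

Lemma bform0r z : bform z 0 = 0.
Proof. by rewrite bformC bform0l. Qed.

Definition bformE := (bformDl, bformZl, bformBl, bformNl, bform0l,
  bformDr, bformZr, bformBr, bformNr, bform0r).

Lemma bform_suml (I : finType) (F : I -> V) z :
  bform (\sum_i F i) z = \sum_i bform (F i) z.
Proof.
elim/big_ind2: _ => [|x1 x2 y1 y2 <- <-|//]; first by rewrite bform0l.
by rewrite bformDl.
Qed.

Lemma bform_sumr (I : finType) (F : I -> V) z :
  bform z (\sum_i F i) = \sum_i bform z (F i).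
Proof. by rewrite bformC bform_suml; apply: eq_bigr => i _; rewrite bformC. Qed.

Definition bvec (xi : 'cV[R]_(vdim X n)) : V := \row_j (bsign R X j * xi j 0).

Lemma bvecE x xi : bform x (bvec xi) = (x *m xi) 0 0.
Proof.
rewrite mxE; apply: eq_bigr => j _; rewrite mxE.
transitivity (bsign R X j * bsign R X j * (x 0 j * xi j 0)); first by ring.
by rewrite bsign_sqr mul1r.
Qed.

Lemma bform_nondeg x : (forall y, bform x y = 0) -> x = 0.
Proof.
move=> x0; apply/rowP => j; have := x0 (bvec (delta_mx j 0)).
by rewrite bvecE -colE !mxE.
Qed.

Lemma bform_ge0 x : X <> Lobachevsky -> 0 <= bform x x.
Proof.
move=> XL; apply: sumr_ge0 => j _; rewrite /bsign.
by case: X XL x j => // _ x j; rewrite mul1r -expr2 sqr_ge0.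
Qed.

Lemma bform_eq0 x : X <> Lobachevsky -> bform x x = 0 -> x = 0.
Proof.
move=> XL xx; apply/rowP => j; rewrite mxE; move: xx; rewrite /bform.
have sq (i : 'I_(vdim X n)) : bsign R X i * x 0 i * x 0 i = (x 0 i) ^+ 2.
  by rewrite /bsign; case: X XL x i => // _ x i; rewrite mul1r -expr2.
under eq_bigr do rewrite sq.
move/psumr_eq0P => /(_ (fun i _ => sqr_ge0 _))/(_ j isT)/eqP.
by rewrite sqrf_eq0 => /eqP.
Qed.

Lemma bform_gt0 x : X <> Lobachevsky -> x != 0 -> 0 < bform x x.
Proof.
move=> XL x0; rewrite lt_def bform_ge0// andbT; apply: contra_neq x0.
exact: bform_eq0.
Qed.

End Form.

Section LorentzForm.
Variables (R : realType) (n : nat).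
Local Notation V := (vect R Lobachevsky n).
Local Notation bform := (@bform R Lobachevsky n).
Implicit Types x y z : V.

Definition time x : R := x 0 (ord0 : 'I_n.+1).

Lemma bform_time0 x : time x = 0 -> 0 <= bform x x /\ (bform x x = 0 -> x = 0).
Proof.
move=> x0; have E : bform x x = \sum_(j < n) (x 0 (lift ord0 j)) ^+ 2.
  rewrite /Defs.bform /= big_ord_recl; rewrite /time in x0; rewrite x0 mulr0 add0r.
  by apply: eq_bigr => j _; rewrite /bsign/= mul1r -expr2.
rewrite E; split; first by apply: sumr_ge0 => j _; exact: sqr_ge0.
move/psumr_eq0P => /(_ (fun i _ => sqr_ge0 _)) xj; apply/rowP => j; rewrite mxE.
case: (unliftP (ord0 : 'I_n.+1) j) => [i ->|->//]; apply/eqP.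
by rewrite -sqrf_eq0 xj.
Qed.

Lemma lobP x : Xspace x <-> bform x x = -1 /\ 0 < time x.
Proof.
split=> -[xx x0]; split => //; first exact: x0.
by move=> j j0; rewrite (_ : j = ord0)//; apply: val_inj.
Qed.

(** The combination of x and y with zero time coordinate is space-like. This
    replaces every use of the reversed Cauchy inequality. *)
Lemma time_form x y : 0 <= time y ^+ 2 * bform x x + time x ^+ 2 * bform y y
  - 2 * time x * time y * bform x y.
Proof.
have := (@bform_time0 (time y *: x - time x *: y) _).1.
rewrite !bformE [bform y x]bformC => /(_ _)/le_trans -> //.
  by rewrite /time !mxE mulrC subrr.
rewrite le_eqVlt; apply/orP; left; apply/eqP; ring.
Qed.

(** Light-like and time-like vectors lie in one of the two halves of the cone, and
    the product with a point of the space tells which one. *)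
Lemma cone_sign x z : Xspace x -> bform z z <= 0 -> z != 0 ->
  time z * bform x z < 0.
Proof.
move=> /lobP[xx x0] zz zn0; have := time_form x z; rewrite xx => H.
have z0 : time z != 0.
  apply: contra_neq zn0 => /bform_time0[z1 z2]; apply: z2.
  by apply/eqP; rewrite eq_le z1 zz.
have z2 : 0 < time z ^+ 2 by rewrite exprn_even_gt0.
have x2 : 0 < time x ^+ 2 by rewrite exprn_gt0.
have h : 0 < - (2 * time x) * (time z * bform x z).
  have -> : - (2 * time x) * (time z * bform x z) =
     - (2 * time x * time z * bform x z) by ring.
  have : time x ^+ 2 * bform z z <= 0 by rewrite pmulr_rle0.
  lra.
rewrite nmulr_rgt0// in h; lra.
Qed.

Lemma lob_form_le x y : Xspace x -> Xspace y -> bform x y <= -1.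
Proof.
move=> /lobP[xx x0] /lobP[yy y0]; have := time_form x y; rewrite xx yy => H.
have xy : 0 < 2 * time x * time y by rewrite !mulr_gt0.
have H2 : 0 <= (time x - time y) ^+ 2 by exact: sqr_ge0.
have : 0 <= 2 * time x * time y * (- 1 - bform x y) by lra.
rewrite pmulr_rge0//; lra.
Qed.

Lemma lob_future x z : Xspace x -> bform z z = -1 -> bform x z < 0 -> Xspace z.
Proof.
move=> Xx zz xz; apply/lobP; split=> //.
have zn0 : z != 0.
  by apply/eqP => z0; move: zz; rewrite z0 bform0l => /eqP; rewrite eq_sym oppr_eq0 oner_eq0.
have := cone_sign Xx (_ : bform z z <= 0) zn0; rewrite zz => /(_ _).
by rewrite nmulr_llt0//; apply; rewrite lerN10.
Qed.

Lemma lob_orth_pos x z : bform x x < 0 -> bform x z = 0 -> z != 0 -> 0 < bform z z.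
Proof.
move=> xx xz zn0; have := time_form x z; rewrite xz mulr0 subr0 => H.
have x0 : time x != 0.
  by apply/eqP => /bform_time0[]; rewrite leNgt xx.
have x2 : 0 < time x ^+ 2 by rewrite exprn_even_gt0.
have [/bform_time0[z1 z2]|z0] := eqVneq (time z) 0.
  by rewrite lt_def z1 andbT; apply: contra_neq zn0.
have z2 : 0 < time z ^+ 2 by rewrite exprn_even_gt0.
have : time z ^+ 2 * bform x x < 0 by rewrite pmulr_rlt0.
move=> h; rewrite -(pmulr_rgt0 _ x2); lra.
Qed.

End LorentzForm.

Section Curved.
Variables (R : realType) (X : geometry) (n : nat).
Hypothesis XE : X <> Euclidean.
Local Notation V := (vect R X n).
Implicit Types x y z : V.

(** The common value of <x, x> on the sphere and on the Lobachevsky space. *)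
Definition curv : R := if X is Lobachevsky then -1 else 1.

Lemma curv_sqr : curv * curv = 1.
Proof. by rewrite /curv; case: X; rewrite ?mulrNN mulr1. Qed.

Lemma Xspace_form x : Xspace x -> bform x x = curv.
Proof. by move: XE x; rewrite /curv; case: X => // _ x []. Qed.

Lemma Xspace_mem x z : Xspace x -> bform z z = curv ->
  (X = Lobachevsky -> bform x z < 0) -> Xspace z.
Proof.
move: XE x z; rewrite /curv; case: X => // _ x z Xx zz H.
exact: (lob_future Xx zz (H erefl)).
Qed.

(** The tangent spaces are Euclidean; every positivity argument below goes back to
    this. *)
Lemma orth_pos x z : Xspace x -> bform x z = 0 -> z != 0 -> 0 < bform z z.
Proof.
move: XE x z; case: X => // _ x z Xx xz z0; first exact: bform_gt0.
by apply: lob_orth_pos xz z0; have [-> _] := (lobP _).1 Xx; rewrite ltrN10.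
Qed.

End Curved.

(** * Curves and tangent vectors *)

Section Curves.
Variables (R : realType) (X : geometry) (n : nat).
Local Notation V := (vect R X n).

Lemma bform_cvg (T : Type) (F : set_system T) {FF : Filter F}
    (u v : T -> V) (x y : V) :
  u @ F --> x -> v @ F --> y -> bform (u i) (v i) @[i --> F] --> bform x y.
Proof.
move=> ux vy.
have coord (w : T -> V) (z : V) j : w @ F --> z -> w i 0 j @[i --> F] --> z 0 j.
  by move=> wz; apply: (@continuous_cvg _ _ _ F FF w (fun M : V => M 0 j)) wz; exact: coord_continuous.
apply: cvg_big => [|j _]; first exact: add_continuous.
apply: cvgM; last exact: coord.
by apply: cvgM; [exact: cvg_cst|exact: coord].
Qed.

Lemma derive_curve (t : V) (g : R -> V) : {for 0, continuous g} ->
  is_derive (0 : R) (1 : R) (fun s => t + s *: g s) (g 0).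
Proof.
move=> gc.
have H : (fun h => h^-1 *: ((fun s => t + s *: g s) (h *: 1 + 0) -
     (t + 0 *: g 0))) @ 0^' --> g 0.
  apply: cvg_trans; last exact: (cvg_within_filter (fun x => x != 0) gc).
  apply: near_eq_cvg; near=> h.
  have h0 : h != 0 by near: h; exact: nbhs_dnbhs_neq.
  rewrite /= addr0 scale0r addr0 [t + _]addrC addrK scalerA.
  by rewrite [h *: 1]mulr1 mulVf// scale1r.
apply: DeriveDef; first by apply/cvg_ex; exists (g 0).
exact: cvg_lim H.
Unshelve. all: by end_near. Qed.

Lemma derive_quotient (gamma : R -> V) (xi : V) :
  is_derive (0 : R) (1 : R) gamma xi ->
  h^-1 *: (gamma h - gamma 0) @[h --> 0^'] --> xi.
Proof.
case=> /cvg_ex[l gl] xiE.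
have := gl; rewrite (_ : (fun h => _) = (fun h => h^-1 *: (gamma h - gamma 0))) => [H|].
  by rewrite -xiE [derive _ _ _](cvg_lim _ gl).
by apply/funext => h; rewrite /= addr0 [h *: 1]mulr1.
Qed.

Lemma derive_level (gamma : R -> V) (xi w : V) (c : R) :
  is_derive (0 : R) (1 : R) gamma xi ->
  (\forall s \near (0 : R), bform (gamma s) w = c) -> bform xi w = 0.
Proof.
move=> /derive_quotient gxi gc.
have g0 : bform (gamma 0) w = c by exact: nbhs_singleton gc.
have H : bform (h^-1 *: (gamma h - gamma 0)) w @[h --> 0^'] --> bform xi w.
  by apply: bform_cvg gxi _; exact: cvg_cst.
suff H0 : bform (h^-1 *: (gamma h - gamma 0)) w @[h --> 0^'] --> (0 : R).
  exact: norm_cvg_unique H H0.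
apply: cvg_near_cst; near=> h.
rewrite bformZl bformBl g0.
rewrite (_ : bform (gamma h) w = c) ?subrr ?mulr0//.
by near: h; apply: cvg_within gc.
Unshelve. all: by end_near. Qed.

(** By polarisation <g(h) - w, g(h) - w> - <g(0) - w, g(0) - w> is h times the product
    of the difference quotient with a vector tending to 2 (g(0) - w). *)
Lemma derive_quadric (gamma : R -> V) (xi w : V) (c : R) :
  is_derive (0 : R) (1 : R) gamma xi ->
  (\forall s \near (0 : R), bform (gamma s - w) (gamma s - w) = c) ->
  bform xi (gamma 0 - w) = 0.
Proof.
move=> /derive_quotient gxi gc.
set q := (fun h => _) in gxi.
have g0 : bform (gamma 0 - w) (gamma 0 - w) = c by exact: nbhs_singleton gc.
have Hr : h *: q h + 2 *: (gamma 0 - w) @[h --> 0^'] --> 0 *: xi + 2 *: (gamma 0 - w).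
  apply: cvgD; last exact: cvg_cst.
  by apply: cvgZ gxi; apply: cvg_within.
have H : bform (q h) (h *: q h + 2 *: (gamma 0 - w)) @[h --> 0^'] -->
    bform xi (0 *: xi + 2 *: (gamma 0 - w)).
  by apply: bform_cvg gxi Hr.
have H0 : bform (q h) (h *: q h + 2 *: (gamma 0 - w)) @[h --> 0^'] --> (0 : R).
  apply: cvg_near_cst; near=> h.
  have h0 : h != 0 by near: h; exact: nbhs_dnbhs_neq.
  have gh : bform (gamma h - w) (gamma h - w) = c.
    by near: h; apply: cvg_within gc.
  apply: (mulfI h0); rewrite mulr0 -bformZl.
  have -> : h *: q h = (gamma h - w) - (gamma 0 - w).
    by rewrite /q scalerA divff// scale1r opprB addrA subrK.
  move: gh g0; move: (gamma h - w) (gamma 0 - w) => x y xx yy.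
  by rewrite !bformE xx yy (bformC y x); ring.
have E : bform xi (0 *: xi + 2 *: (gamma 0 - w)) = 0 by exact: norm_cvg_unique H H0.
move: E; rewrite scale0r add0r bformZr => /eqP.
by rewrite mulf_eq0 pnatr_eq0/= => /eqP.
Unshelve. all: by end_near. Qed.

End Curves.

Section CurvedTangents.
Variables (R : realType) (X : geometry) (n : nat).
Hypothesis XE : X <> Euclidean.
Local Notation V := (vect R X n).
Local Notation eps := (curv R X).
Implicit Types t xi w o : V.

(** A curve with velocity xi that stays in the space and may bend towards any
    direction w normal to xi and t; the choice of w decides on which hypersurface
    through t the curve lies. *)
Lemma curve_exists t xi w :
  Xspace t -> bform xi t = 0 -> bform w t = 0 -> bform w xi = 0 ->
  exists (gamma : R -> V) (d : R -> R),
    [/\ gamma 0 = t, forall s, gamma s = (1 - d s) *: t + s *: xi + d s *: w,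
     \forall s \near (0 : R), Xspace (gamma s) &
     is_derive (0 : R) (1 : R) gamma xi].
Proof.
move=> Xt xit wt wxi.
pose e := bform xi xi; pose A := eps + bform w w.
(* d = s ^ 2 h is the small root of A d ^ 2 - 2 eps d + s ^ 2 e = 0, written so that
   A = 0 needs no separate treatment. *)
pose r s := Num.sqrt (1 - A * e * (s * s)).
pose h s := eps * e / (1 + r s).
pose d s := s * (s * h s).
pose g s := xi + (s * h s) *: (w - t).
have h1 : 1 - A * e * (s * s) @[s --> 0] --> (1 - A * e * (0 * 0) : R).
  apply: cvgB; first exact: cvg_cst.
  by apply: cvgM; [exact: cvg_cst|apply: cvgM; exact: cvg_id].
have rc : r s @[s --> 0] --> (1 : R).
  rewrite [X in _ --> X](_ : _ = Num.sqrt (1 - A * e * (0 * 0))); last first.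
    by rewrite !mulr0 subr0 sqrtr1.
  by apply: continuous_cvg h1; exact: sqrt_continuous.
have hc : h s @[s --> 0] --> (eps * e / (1 + 1) : R).
  apply: cvgM; first exact: cvg_cst.
  by apply: cvgV; [rewrite -[1 + 1]/(2%:R) pnatr_eq0|apply: cvgD rc; exact: cvg_cst].
have shc : s * h s @[s --> 0] --> (0 * (eps * e / (1 + 1)) : R).
  by apply: cvgM hc; exact: cvg_id.
have dc : d s @[s --> 0] --> (0 : R).
  rewrite -[X in _ --> X](mul0r (0 * (eps * e / (1 + 1)))).
  by apply: cvgM shc; exact: cvg_id.
have gE s : t + s *: g s = (1 - d s) *: t + s *: xi + d s *: w.
  rewrite /g /d scalerDr scalerA scalerBr scalerBl scale1r.
  by rewrite -!addrA; congr (_ + _); rewrite addrCA; congr (_ + _); rewrite addrC.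
exists (fun s => t + s *: g s), d; split => //.
- by rewrite scale0r addr0.
- near=> s; rewrite gE.
  have d1 : d s < 1 by near: s; apply: (cvgr_lt 0 dc); exact: ltr01.
  have r0 : 0 < 1 - A * e * (s * s).
    by near: s; apply: (cvgr_gt _ h1); rewrite !mulr0 subr0 ltr01.
  have tt := Xspace_form XE Xt.
  apply: (Xspace_mem XE Xt).
    have rs : r s ^+ 2 = 1 - A * e * (s * s) by rewrite sqr_sqrtr// ltW.
    rewrite !bformE wt wxi xit (bformC t xi) xit (bformC t w) wt (bformC xi w) wxi.
    rewrite tt -/e.
    have rp : 1 + r s != 0 by rewrite gt_eqF// ltr_wpDr ?sqrtr_ge0.
    have dE : d s * (1 + r s) = eps * e * (s * s).
      by rewrite /d /h mulrA -[LHS]mulrA divfK//; ring.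
    have ee := curv_sqr R X.
    have ww : bform w w = A - eps by rewrite /A; ring.
    rewrite ww.
    suff Q : A * d s ^+ 2 - 2 * eps * d s + s * s * e = 0.
      transitivity (eps + (A * d s ^+ 2 - 2 * eps * d s + s * s * e)); first by ring.
      by rewrite Q addr0.
    apply: (mulIf rp); rewrite mul0r; apply: (mulIf rp); rewrite mul0r.
    transitivity (A * (d s * (1 + r s)) ^+ 2 - 2 * eps * (d s * (1 + r s)) * (1 + r s)
      + s * s * e * (1 + 2 * r s + r s ^+ 2)); first by ring.
    rewrite dE; transitivity (A * (eps * eps) * (e * (s * s)) ^+ 2
      - 2 * (eps * eps) * (e * (s * s)) * (1 + r s)
      + s * s * e * (1 + 2 * r s + r s ^+ 2)); first by ring.
    by rewrite ee rs; ring.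
  move=> XL; rewrite !bformE (bformC t xi) xit (bformC t w) wt tt !mulr0 !addr0.
  by rewrite /curv XL mulrN1 oppr_lt0 subr_gt0.
- rewrite [X in is_derive _ _ _ X](_ : _ = g 0); last by rewrite /g mul0r scale0r addr0.
  apply: derive_curve; rewrite /prop_for /continuous_at /g mul0r scale0r.
  apply: cvgD; first exact: cvg_cst.
  rewrite -[X in _ --> X](scale0r (w - t)); apply: cvgZr_tmp.
  rewrite -[X in _ --> X](mul0r (eps * e / (1 + 1))); exact: shc.
Unshelve. all: by end_near. Qed.

Lemma tangent_Xspace t xi : Xspace t ->
  tangent_vector (@Xspace R X n) t xi <-> bform xi t = 0.
Proof.
move=> Xt; split => [[gamma [g0 gX dg]]|xit].
  have := @derive_quadric _ _ _ gamma xi 0 eps dg; rewrite g0 subr0; apply.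
  by apply: filterS gX => s /(Xspace_form XE); rewrite subr0.
have [gamma [d [g0 _ gX dg]]] := curve_exists Xt xit (bform0l _) (bform0l _).
by exists gamma.
Qed.

(** In the curved spaces all hypersurfaces in question are of this form. In the
    Lobachevsky space the sign of <o, o> distinguishes spheres, orispheres and
    equidistant hypersurfaces, the latter with base at kap = 0. *)
Definition level (o : V) (kap : R) : set V :=
  [set x | Xspace x /\ bform x o = kap].

(** The normal of the level set at t is o - eps kap t, of square c ^ 2; as c <> 0,
    the curve can be bent along it just enough to keep the product with o. *)
Lemma tangent_level o kap c t xi :
  c != 0 -> bform o o - eps * kap ^+ 2 = c ^+ 2 -> level o kap t ->
  tangent_vector (level o kap) t xi <-> (bform xi t = 0 /\ bform xi o = 0).
Proof.
move=> c0 oc [Xt to]; have tt := Xspace_form XE Xt; split.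
  move=> [gamma [g0 gL dg]]; split.
    have := @derive_quadric _ _ _ gamma xi 0 eps dg; rewrite g0 subr0; apply.
    by apply: filterS gL => s [/(Xspace_form XE)]; rewrite subr0.
  by apply: derive_level dg _; apply: filterS gL => s []; eauto.
move=> [xit xio].
(* the multiple of the normal with <w, o> = kap *)
pose w := (kap / c ^+ 2) *: (o - (eps * kap) *: t).
have ee := curv_sqr R X.
have ot : bform o t = kap by rewrite bformC.
have wt : bform w t = 0.
  rewrite !bformE ot tt; transitivity (kap / c ^+ 2 * kap * (1 - eps * eps)); first by ring.
  by rewrite ee subrr mulr0.
have wxi : bform w xi = 0.
  by rewrite !bformE (bformC o) xio (bformC t) xit; ring.
have wo : bform w o = kap.
  rewrite !bformE to (_ : bform o o = c ^+ 2 + eps * kap ^+ 2); last by rewrite -oc; ring.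
  by field.
have [gamma [d [g0 gE gX dg]]] := curve_exists Xt xit wt wxi.
exists gamma; split => //; apply: filterS gX => s Xs; split => //.
by rewrite gE; clearbody w; rewrite !bformE to wo xio; ring.
Qed.

End CurvedTangents.

(** * Hyperplanes in homogeneous coordinates *)

Section HyperplaneAlgebra.
Variables (F : fieldType) (N : nat).

Lemma rank_col_ker (xi : 'cV[F]_N.+1) : xi != 0 -> \rank (kermx xi) = N.
Proof.
move=> xi0; rewrite mxrank_ker -mxrank_tr rank_rV.
by rewrite -(inj_eq (can_inj (@trmxK _ _ _))) trmxK trmx0 xi0 subn1.
Qed.

Lemma row_free_ker (B : 'M[F]_(N, N.+1)) (xi : 'cV[F]_N.+1) (x : 'rV[F]_N.+1) :
  row_free B -> xi != 0 -> B *m xi = 0 -> (x <= B)%MS = (x *m xi == 0).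
Proof.
move=> fB xi0 Bxi; rewrite -sub_kermx; apply/idP/idP => [xB|].
  by apply: submx_trans xB _; rewrite sub_kermx Bxi.
have BK : (B <= kermx xi)%MS by rewrite sub_kermx Bxi.
move=> xK; apply: submx_trans xK _.
by rewrite -(mxrank_leqif_sup BK) rank_col_ker// eq_sym -row_leq_rank leq_eqVlt -/(row_free B) fB.
Qed.

Lemma ker_basis (xi : 'cV[F]_N.+1) : xi != 0 ->
  exists U : 'M[F]_(N, N.+1), row_free U /\
    forall x : 'rV_N.+1, (x <= U)%MS = (x *m xi == 0).
Proof.
move=> xi0.
have cast p (E : p = N) (B : 'M[F]_(p, N.+1)) :
    exists U : 'M[F]_(N, N.+1), (U :=: B)%MS.
  by move: B; rewrite E => B; exists B.
have [U UE] := cast _ (rank_col_ker xi0) (row_base (kermx xi)).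
have fU : row_free U by rewrite /row_free UE eq_row_base rank_col_ker.
exists U; split => // x; apply: row_free_ker => //.
by apply/eqP; rewrite -sub_kermx UE eq_row_base.
Qed.

(** At a point t of the hyperplane of a facet this turns the orientation given by
    the normal a o + b t of a level set into the one given by o. *)
Lemma det_col_mx_affine (a : F) (r : 'rV[F]_N.+1) (u : 'rV[F]_N)
    (B : 'M[F]_(N, N.+1)) :
  \det (col_mx (a *: r + u *m B) B : 'M[F]_N.+1) = a * \det (col_mx r B : 'M[F]_N.+1).
Proof.
have -> : col_mx (a *: r + u *m B) B =
    (block_mx a%:M u 0 1%:M : 'M[F]_(1 + N)) *m col_mx r B.
  rewrite mul_block_col mul_scalar_mx mul0mx add0r.
  by rewrite mul_scalar_mx scale1r.
by rewrite det_mulmx (det_ublock (a%:M : 'M[F]_1)) det_scalar1 det1 mulr1.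
Qed.

(** Projecting the vertices of a facet along r and rescaling them does not change
    the orientation seen from r. *)
Lemma det_col_mx_proj (r : 'rV[F]_N.+1) (A B : 'M[F]_(N, N.+1))
    (d k : 'I_N -> F) :
  (forall i, row i A = d i *: (row i B + k i *: r)) ->
  \det (col_mx r A : 'M[F]_N.+1) = \prod_i d i * \det (col_mx r B : 'M[F]_N.+1).
Proof.
move=> AE; pose D := diag_mx (\row_i d i); pose K : 'cV_N := \col_i k i.
have -> : A = (D *m K) *m r + D *m B.
  apply/row_matrixP => i; rewrite AE -mulmxA -mulmxDr row_mul.
  rewrite [row i D](_ : _ = d i *: delta_mx 0 i); last first.
    by apply/rowP => j; rewrite !mxE eqxx/= eq_sym mulr_natr.
  rewrite -scalemxAl -rowE [row i (_ + _)]raddfD/= row_mul [row i K](_ : _ = (k i)%:M).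
    by rewrite mul_scalar_mx addrC.
  by apply/rowP => j; rewrite !mxE ord1.
have -> : col_mx r ((D *m K) *m r + D *m B) =
    (block_mx 1%:M 0 (D *m K) D : 'M[F]_(1 + N)) *m col_mx r B.
  by rewrite mul_block_col mul1mx mul0mx addr0.
rewrite det_mulmx (det_lblock (1%:M : 'M[F]_1)) det1 mul1r det_diag.
by under eq_bigr do rewrite mxE.
Qed.

End HyperplaneAlgebra.

Section HomCoordinates.
Variables (R : realType) (X : geometry) (N : nat).
Local Notation V := (vect R X N).
Implicit Types x y w : V.

Lemma hom_vecD x y : hom_vec (x + y) = hom_vec x + hom_vec y.
Proof.
case: X x y => //= x y.
by have := add_row_mx (0 : 'rV[R]_1) x 0 y; rewrite addr0 => /esym.
Qed.

Lemma hom_vecZ c x : hom_vec (c *: x) = c *: hom_vec x.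
Proof.
case: X x => //= x.
by have := scale_row_mx c (0 : 'rV[R]_1) x; rewrite scaler0 => /esym.
Qed.

Lemma hom_vecN x : hom_vec (- x) = - hom_vec x.
Proof. by rewrite -scaleN1r hom_vecZ scaleN1r. Qed.

Lemma hom_vecB x y : hom_vec (x - y) = hom_vec x - hom_vec y.
Proof. by rewrite hom_vecD hom_vecN. Qed.

Lemma hom_ptD x y : hom_pt (x + y) = hom_pt x + hom_vec y.
Proof.
case: X x y => //= x y.
by have := add_row_mx (1%:M : 'rV[R]_1) x 0 y; rewrite addr0 => /esym.
Qed.

Lemma hom_ptB x y : hom_vec (x - y) = hom_pt x - hom_pt y.
Proof. by have := hom_ptD y (x - y); rewrite addrC subrK => ->; rewrite addrAC subrr add0r. Qed.

Lemma hom_pt_curved x : X <> Euclidean -> hom_pt x = hom_vec x.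
Proof. by case: X x. Qed.

Lemma orient_sign_affine (f : 'I_N -> V) (a : R) (r : 'rV[R]_N.+1) (u : 'rV[R]_N) x :
  hom_vec x = a *: r + u *m hom_mx f ->
  orient_sign x f = Num.sg a * Num.sg (\det (col_mx r (hom_mx f) : 'M[R]_N.+1)).
Proof. by move=> E; rewrite /orient_sign E det_col_mx_affine sgrM. Qed.

Lemma sgr_sign (a : R) : a != 0 -> Num.sg a = (-1) ^+ (a < 0)%R.
Proof. by rewrite sgr_def => ->; rewrite mulr1n. Qed.

(** The coherent orientation of the cross-polytope in which the facet J = set0 has
    the order of its vertices. *)
Definition alternating (J : {set 'I_N}) : R := (-1) ^+ #|J|.

Lemma alternating_coherent : coherent alternating.
Proof.
split=> [J|J i iJ]; last by rewrite /alternating cardsU1 iJ exprS mulN1r.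
by rewrite /alternating -signr_odd; case: odd; [right|left].
Qed.

Lemma projection_decomposition (a b : 'I_N -> V) (P : pred {set 'I_N})
    (e : bool) (H : set V) (h w : V) :
  H h -> orientation H (fun=> w) ->
  (forall J i, exists d k, 0 < d /\
     hom_pt (orth_proj h w (facet a b J i)) =
     d *: (hom_pt (facet a b J i) + k *: hom_vec w)) ->
  (forall J : {set 'I_N}, (-1) ^+ #|J| *
  Num.sg (\det (col_mx (hom_vec w) (hom_mx (facet a b J)) : 'M[R]_N.+1)) =
    (-1) ^+ (e (+) P J)) ->
  hyperplane_decomposition a b H P.
Proof.
move=> Hh Hw proj signE; exists h, w, alternating, e; split=> //.
  exact: alternating_coherent.
move=> J; have [d dP] := choice (proj J); have [k kP] := choice dP.
rewrite -signE; congr (_ * _); rewrite /orient_sign.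
rewrite (@det_col_mx_proj _ _ _ _ (hom_mx (facet a b J)) d k); last first.
  by move=> i; rewrite !rowK; have [] := kP i.
by rewrite sgrM gtr0_sg ?mul1r// prodr_gt0// => i _; have [] := kP i.
Qed.

End HomCoordinates.

(** * Tangency with level sets *)

Section CurvedFacets.
Variables (R : realType) (X : geometry) (N : nat).
Hypothesis XE : X <> Euclidean.
Local Notation V := (vect R X N).
Local Notation eps := (curv R X).
Local Notation level := (@level R X N).

Lemma hom_form (w : V) : exists xi : 'cV[R]_N.+1,
  forall x : V, (hom_pt x *m xi) 0 0 = bform x w.
Proof.
case: X XE w => // _ w.
  exists (\col_(j < N.+1) (bsign R Spherical j * w 0 j)) => x; rewrite mxE.
  by apply: eq_bigr => j _; rewrite mxE /=; ring.
exists (\col_(j < N.+1) (bsign R Lobachevsky j * w 0 j)) => x; rewrite mxE.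
by apply: eq_bigr => j _; rewrite mxE /=; ring.
Qed.

Lemma level_plane (w : V) : w != 0 -> (level w 0) !=set0 ->
  is_plane N (level w 0).
Proof.
move=> w0 ne; split=> //; have [xi xiE] := hom_form w.
have xi0 : xi != 0.
  apply: contra_neq w0 => xi0; apply: bform_nondeg => y.
  by rewrite bformC -xiE xi0 mulmx0 mxE.
have [U [fU UE]] := ker_basis xi0; exists U; split => //.
apply/seteqP; split => x [Xx]; rewrite ?UE.
  move=> xw; split=> //; rewrite UE; apply/eqP/matrixP => i j.
  by rewrite !ord1 xiE xw mxE.
by move=> /eqP xw; split => //; rewrite -xiE xw mxE.
Qed.

Definition level_normal (o : V) (kap c : R) (x : V) : V :=
  c^-1 *: (o - (eps * kap) *: x).

Lemma level_orientation (o : V) (kap c : R) : c != 0 ->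
  bform o o - eps * kap ^+ 2 = c ^+ 2 ->
  orientation (level o kap) (level_normal o kap c).
Proof.
move=> c0 oc; have ee := curv_sqr R X; split.
  apply: continuous_subspaceT => x.
  have H : id y @[y --> (x : V)] --> (x : V) by exact: cvg_id.
  exact: cvgZl_tmp (cvgB (cvg_cst o) (cvgZl_tmp H)).
move=> x Lx; have [Xx xo] := Lx; have xx := Xspace_form XE Xx.
have ox : bform o x = kap by rewrite bformC.
split.
- rewrite /level_normal !bformE ox xx xo.
  have -> : bform o o = c ^+ 2 + eps * kap ^+ 2 by rewrite -oc; ring.
  transitivity (c^-1 * c^-1 * (c ^+ 2 + (eps * eps - 1) * eps * kap ^+ 2)); first by ring.
  by rewrite ee subrr !mul0r addr0; field.
- apply/(tangent_Xspace XE _ Xx); rewrite /level_normal !bformE ox xx.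
  transitivity (c^-1 * kap * (1 - eps * eps)); first by ring.
  by rewrite ee subrr mulr0.
- move=> xi /(tangent_level XE _ c0 oc Lx)[xix xio].
  by rewrite /level_normal bformC !bformE xix xio; ring.
Qed.

(** The part of v orthogonal to nu is itself a tangent vector, hence orthogonal to
    v, hence zero. *)
Lemma unit_normal_level (nu v x : V) : bform nu nu = 1 -> level nu 0 x ->
  unit_normal (level nu 0) x v -> v = nu \/ v = - nu.
Proof.
move=> nn Lx [vv vX vL]; have [Xx xnu] := Lx.
have oc : bform nu nu - eps * 0 ^+ 2 = 1 ^+ 2 by rewrite nn; ring.
have vx : bform v x = 0 by have := tangent_Xspace XE v Xx; case => + _; exact.
pose z := v - bform v nu *: nu.
have zx : bform x z = 0 by rewrite !bformE xnu bformC vx; ring.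
have znu : bform z nu = 0 by rewrite !bformE nn; ring.
have vz : bform v z = 0.
  apply: vL; apply/(tangent_level XE _ _ oc Lx); first exact: oner_neq0.
  by rewrite bformC zx.
have z0 : z = 0.
  apply/eqP; apply: contraT => /(orth_pos XE Xx zx).
  by rewrite {1}/z bformBl bformZl vz (bformC nu) znu mulr0 subrr ltxx.
have vE : v = bform v nu *: nu by apply/eqP; rewrite -subr_eq0 -/z z0.
move: vv; rewrite {1}vE bformZl {2}vE bformZr nn mulr1 => /eqP; rewrite -expr2 sqrf_eq1.
move: (bform v nu) vE => b -> {v vX vL vx z zx znu vz z0}.
by move=> /orP[]/eqP->; rewrite ?scale1r ?scaleN1r; [left|right].
Qed.

Lemma unit_normal_plane (w x : V) : bform w w = 1 -> level w 0 x ->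
  unit_normal (level w 0) x w.
Proof.
move=> ww Lx; have oc : bform w w - eps * 0 ^+ 2 = 1 ^+ 2 by rewrite ww; ring.
have [_ /(_ x Lx)] := level_orientation (oner_neq0 R) oc.
by rewrite /level_normal mulr0 scale0r subr0 invr1 scale1r.
Qed.

Section Facets.
Variables (a b : 'I_N -> V) (P : pred {set 'I_N}) (nu : {set 'I_N} -> V) (o : V) (c : R) (e : bool).
Hypothesis c0 : c != 0.
Hypothesis planeE : forall J, span_plane (facet a b J) = level (nu J) 0.
Hypothesis nu1 : forall J, bform (nu J) (nu J) = 1.
Hypothesis nuo : forall J, bform (nu J) o = c.
Hypothesis signE : forall J : {set 'I_N}, (-1) ^+ #|J| *
  Num.sg (\det (col_mx (hom_vec o) (hom_mx (facet a b J)) : 'M[R]_N.+1)) = (-1) ^+ (e (+) P J).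

(** The tangency point is where c nu is the normal o - eps kap t of the level set; then t and o span the same plane as t and nu, and the two tangent
    spaces agree. *)
Lemma tangent_at_level kap J : kap != 0 -> bform o o - eps * kap ^+ 2 = c ^+ 2 ->
  Xspace ((eps / kap) *: (o - c *: nu J)) ->
  tangent_at (span_plane (facet a b J)) (level o kap) ((eps / kap) *: (o - c *: nu J)).
Proof.
move=> k0 oc; set t := _ *: _ => Xt; have ee := curv_sqr R X; rewrite planeE.
have oo : bform o o = c ^+ 2 + eps * kap ^+ 2 by rewrite -oc; ring.
have onu : bform o (nu J) = c by rewrite bformC.
have tnu : bform t (nu J) = 0 by rewrite !bformE nu1 onu; ring.
have to : bform t o = kap.
  rewrite !bformE nuo oo; transitivity (eps * eps * kap ^+ 2 / kap); first by ring.
  by rewrite ee; field.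
have L1 : level (nu J) 0 t by [].
have L2 : level o kap t by [].
have oc1 : bform (nu J) (nu J) - eps * 0 ^+ 2 = 1 ^+ 2 by rewrite nu1; ring.
split=> // xi; rewrite (tangent_level XE _ (oner_neq0 R) oc1 L1) (tangent_level XE _ c0 oc L2).
have oE : o = (kap / eps) *: t + c *: nu J.
  have e0 : eps != 0.
    by apply: contra_eq_neq ee => ->; rewrite mulr0 eq_sym oner_eq0.
  rewrite scalerA (_ : kap / eps * (eps / kap) = 1) ?scale1r ?subrK//.
  by field; rewrite k0.
clearbody t; have xoE : bform xi t = 0 -> bform xi o = c * bform xi (nu J).
  by move=> xt; rewrite oE bformDr !bformZr xt mulr0 add0r.
split=> -[xt]; rewrite xoE//; first by move=> ->; rewrite mulr0.
by move/eqP; rewrite mulf_eq0 (negPf c0)/= => /eqP.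
Qed.

(** The normals of the level set differ from a multiple of o by a multiple of the
    tangency point, which lies in the hyperplane of the facet. *)
Lemma level_decomposition kap : bform o o - eps * kap ^+ 2 = c ^+ 2 ->
  surface_decomposition a b (level o kap) P.
Proof.
move=> oc; exists (level_normal o kap c), (@alternating R N), (e (+) (c < 0)); split.
- exact: level_orientation.
- exact: alternating_coherent.
- move=> J t [[Xt /submxP[u tu]] _ _].
  rewrite (@orient_sign_affine _ _ _ _ c^-1 (hom_vec o) ((- (c^-1 * (eps * kap))) *: u)).
    rewrite mulrCA signE sgr_sign ?invr_eq0// invr_lt0 -signr_addb.
    by rewrite addbA [(c < 0) (+) e]addbC.
  rewrite /level_normal scalerBr hom_vecB !hom_vecZ -(hom_pt_curved t XE) tu.
  by rewrite scaleNr mulNmx -scalemxAl !scalerA.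
Qed.

End Facets.

End CurvedFacets.

(** * Neighbouring facets and spherical cross-polytopes *)

Section Flips.
Variable N : nat.

(** Any facet is reached from any other one through neighbouring facets. *)
Lemma flip_connected (p : {set 'I_N} -> Prop) :
  (forall (J : {set 'I_N}) j, j \notin J -> p J <-> p (j |: J)%SET) ->
  forall J J', p J -> p J'.
Proof.
move=> flip; suff p0 J : p finset.set0 <-> p J.
  by move=> J J' /(p0 J).2/(p0 J').1.
elim: {J}#|J| {-2}J (erefl #|J|) => [|m IH] J.
  by move/eqP; rewrite cards_eq0 => /eqP->.
move=> Jm; have /card_gt0P[j jJ] : (0 < #|J|)%N by rewrite Jm.
have jJ' : j \notin (J :\ j)%SET by rewrite !inE eqxx.
have := cardsD1 j J; rewrite jJ Jm => -[/esym/IH ->].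
by have := flip _ j jJ'; rewrite finset.setD1K.
Qed.

(** Two neighbouring facets have a common vertex as soon as facets have at least two
    vertices. *)
Lemma flip_common (T : Type) (N2 : (1 < N)%N) (a b : 'I_N -> T) (J : {set 'I_N}) j :
  exists i, (if i \in J then b i else a i) =
    (if i \in (j |: J)%SET then b i else a i).
Proof.
have : (0 < #|~: [set j]%SET|)%N.
  by rewrite cardsCs finset.setCK card_ord cards1 subn_gt0.
by case/card_gt0P=> i; rewrite !inE => ij; exists i; rewrite !inE (negPf ij).
Qed.

End Flips.

Section RealFunctions.
Variable R : realType.

Lemma acos_lt_pihalf (y : R) : 0 < y -> y < 1 -> 0 < acos y < pi / 2.
Proof.
move=> y0 y1; rewrite acos_gt0 ?y1 ?andbT; last by lra.
have yI : -1 <= y <= 1 by apply/andP; split; lra.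
have yc : cos (acos y) = y by have [_ ->] := acos_def yI.
have := acos_ge0 yI; have := acos_lepi yI; have := pi_gt0 R => p0 ap a0.
rewrite -ltr_cos ?in_itv/= ?a0 ?ap//; last by apply/andP; split; lra.
by rewrite cos_pihalf yc.
Qed.

Lemma acos_inj (x y : R) : -1 <= x <= 1 -> -1 <= y <= 1 -> acos x = acos y -> x = y.
Proof. by move=> xI yI E; rewrite -[x]acosK ?in_itv//= E acosK ?in_itv. Qed.

Lemma arcosh_arg_gt0 (y : R) : 1 <= y -> 0 < y + Num.sqrt (y ^+ 2 - 1).
Proof. by move=> y1; rewrite ltr_wpDr ?sqrtr_ge0//; lra. Qed.

(** y + sqrt (y ^ 2 - 1) and its inverse y - sqrt (y ^ 2 - 1) have half-sum y. *)
Lemma arcosh_inj (x y : R) : 1 <= x -> 1 <= y -> arcosh x = arcosh y -> x = y.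
Proof.
move=> x1 y1 /ln_inj; rewrite !posrE !arcosh_arg_gt0// => /(_ isT isT) E.
have sq (z : R) : 1 <= z ->
    (z + Num.sqrt (z ^+ 2 - 1)) * (z - Num.sqrt (z ^+ 2 - 1)) = 1.
  by move=> z1; rewrite mulrC -subr_sqr sqr_sqrtr ?subKr// subr_ge0 exprn_ege1.
have := sq x x1; have := sq y y1; rewrite -E => e1 e2.
have g0 := arcosh_arg_gt0 x1.
have : y - Num.sqrt (y ^+ 2 - 1) = x - Num.sqrt (x ^+ 2 - 1).
  by apply: (mulfI (lt0r_neq0 g0)); rewrite e1 e2.
lra.
Qed.

Lemma ler_arcosh (x y : R) : 1 <= x -> x <= y -> arcosh x <= arcosh y.
Proof.
move=> x1 xy; have y1 : 1 <= y by lra.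
rewrite ler_ln ?posrE ?arcosh_arg_gt0// lerD// ler_sqrt ?subr_ge0 ?exprn_ege1//.
by rewrite lerB// ler_sqr ?nnegrE; lra.
Qed.

Lemma arcosh_gt0 (x : R) : 1 < x -> 0 < arcosh x.
Proof. by move=> x1; rewrite ln_gt0// ltr_wpDr ?sqrtr_ge0. Qed.

Lemma inf_attained (A : set R) m : A m -> lbound A m -> inf A = m.
Proof.
move=> Am mA; apply/eqP; rewrite eq_le; apply/andP; split.
  by apply: ge_inf => //; exists m.
by apply: lb_le_inf => //; exists m.
Qed.

End RealFunctions.

Section FacetVertices.
Variables (R : realType) (X : geometry) (N : nat).
Local Notation V := (vect R X N).

Lemma span_plane_vertex (f : 'I_N -> V) i : Xspace (f i) -> span_plane f (f i).
Proof.
move=> Xf; split => //; have <- : row i (hom_mx f) = hom_pt (f i) by rewrite rowK.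
exact: row_sub.
Qed.

Lemma facet_Xspace (a b : 'I_N -> V) J i : (forall i, Xspace (a i)) ->
  (forall i, Xspace (b i)) -> Xspace (facet a b J i).
Proof. by move=> Xa Xb; rewrite /facet; case: ifP. Qed.

Lemma full_dim_facets (a b : 'I_N -> V) (F : set V) : (forall i, Xspace (a i)) ->
  (forall i, Xspace (b i)) -> (forall J, span_plane (facet a b J) = F) ->
  is_plane N F -> ~ full_dimensional a b.
Proof.
move=> Xa Xb FE pF; apply; exists F; split => // i; split.
  rewrite -(FE finset.set0) (_ : a i = facet a b finset.set0 i); last by rewrite /facet inE.
  exact/span_plane_vertex/facet_Xspace.
rewrite -(FE finset.setT) (_ : b i = facet a b finset.setT i); last by rewrite /facet inE.
exact/span_plane_vertex/facet_Xspace.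
Qed.

End FacetVertices.

Section CurvedCases.
Variables (R : realType) (X : geometry) (N : nat).
Local Notation V := (vect R X N).
Local Notation eps := (curv R X).
Local Notation level := (@level R X N).

(** All that the metric part needs to know about P_(k): unit normals of the facets
    with the same product c with o, and the signs of the facets seen from o. *)
Definition curved_facets (a b : 'I_N -> V) (P : pred {set 'I_N}) (o : V) (c : R)
    (nu : {set 'I_N} -> V) (e : bool) : Prop :=
  [/\ c != 0, forall J, span_plane (facet a b J) = level (nu J) 0,
      forall J, bform (nu J) (nu J) = 1,
      forall J, bform (nu J) o = c &
      forall J : {set 'I_N}, (-1) ^+ #|J| *
        Num.sg (\det (col_mx (hom_vec o) (hom_mx (facet a b J)) : 'M[R]_N.+1)) =
        (-1) ^+ (e (+) P J)].

Lemma curved_facets_scale (a b : 'I_N -> V) P o c nu e r : r != 0 ->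
  curved_facets a b P o c nu e ->
  curved_facets a b P (r *: o) (r * c) nu (e (+) (r < 0)).
Proof.
move=> r0 [c0 pE nn no sE]; split=> //; first by rewrite mulf_neq0.
  by move=> J; rewrite bformZr no.
move=> J; have := @orient_sign_affine _ _ _ (facet a b J) r (hom_vec o) 0 (r *: o).
rewrite mul0mx addr0 hom_vecZ /orient_sign => /(_ erefl); rewrite hom_vecZ => ->.
by rewrite mulrCA sE sgr_sign// -signr_addb addbA [(r < 0) (+) e]addbC.
Qed.

Hypothesis XE : X <> Euclidean.
Hypothesis N2 : (1 < N)%N.
Variables (a b : 'I_N -> V) (P : pred {set 'I_N}).
Hypothesis Xa : forall i, Xspace (a i).
Hypothesis Xb : forall i, Xspace (b i).
Hypothesis full : full_dimensional a b.

Let i0 : 'I_N := Ordinal (ltnW N2).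

(** If one normal is proportional to o, then so is the normal of every neighbouring
    facet: their difference is orthogonal to a common vertex and isotropic. All
    facets would then lie in one hyperplane. *)
Lemma facet_normal_proper o c nu e : curved_facets a b P o c nu e ->
  bform o o = c ^+ 2 -> forall J, nu J != c^-1 *: o.
Proof.
move=> [c0 pE nn no sE] oc J; apply/eqP => nuJ.
have all_eq J' : nu J' = c^-1 *: o.
  move: J J' nuJ; apply: flip_connected => J j jJ.
  suff imp J1 J2 i : facet a b J1 i = facet a b J2 i -> nu J1 = c^-1 *: o ->
      nu J2 = c^-1 *: o.
    by have [i fi] := flip_common N2 a b J j; split; apply: imp; [exact: fi|exact: esym fi].
  move=> f12 n1; apply/eqP; rewrite -subr_eq0; apply: contraT => z0.
  have Xf : Xspace (facet a b J1 i) by exact: facet_Xspace.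
  have f1 : level (nu J1) 0 (facet a b J1 i) by rewrite -pE; exact: span_plane_vertex.
  have f2 : level (nu J2) 0 (facet a b J1 i) by rewrite -pE f12; apply: span_plane_vertex; rewrite -f12.
  have := orth_pos XE Xf _ z0; rewrite bformBr f2.2 -n1 f1.2 subrr => /(_ erefl).
  rewrite !bformE nn n1 !bformE no (bformC o) no oc.
  rewrite (_ : _ - _ = 0) ?ltxx//; by field.
apply: (full_dim_facets Xa Xb _ _ full) => [J'|].
  by rewrite pE all_eq -(all_eq finset.set0).
apply: level_plane => //.
  by apply: contra_eq_neq (nn finset.set0) => ->; rewrite bform0l eq_sym oner_eq0.
exists (facet a b finset.set0 i0); rewrite -pE.
exact/span_plane_vertex/facet_Xspace.
Qed.

Lemma facet_defect_form o c nu e J : curved_facets a b P o c nu e ->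
  bform (nu J - c *: o) (nu J - c *: o) = 1 - 2 * c ^+ 2 + c ^+ 2 * bform o o.
Proof.
by move=> [c0 pE nn no sE]; rewrite !bformE nn no (bformC o) no; ring.
Qed.

Lemma circumscribed_level o c nu e kap : curved_facets a b P o c nu e ->
  kap != 0 -> bform o o - eps * kap ^+ 2 = c ^+ 2 ->
  (X = Lobachevsky -> forall J, Xspace ((eps / kap) *: (o - c *: nu J))) ->
  circumscribed a b (level o kap).
Proof.
move=> [c0 pE nn no sE] k0 oc XL J; exists ((eps / kap) *: (o - c *: nu J)).
apply: (tangent_at_level XE c0 pE nn no k0 oc).
have [/XL//|XnL] := pselect (X = Lobachevsky).
have tt : bform ((eps / kap) *: (o - c *: nu J)) ((eps / kap) *: (o - c *: nu J)) = eps.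
  rewrite !bformE nn no (bformC o (nu J)) no (_ : bform o o = c ^+ 2 + eps * kap ^+ 2); last by rewrite -oc; ring.
  have ee := curv_sqr R X; transitivity (eps * eps * eps); last by rewrite ee mul1r.
  by field.
have i := facet_Xspace J i0 Xa Xb.
by apply: (Xspace_mem XE i tt).
Qed.

End CurvedCases.

Section SphericalCase.
Variables (R : realType) (N : nat).
Local Notation V := (vect R Spherical N).
Hypothesis N2 : (1 < N)%N.
Variables (a b : 'I_N -> V) (P : pred {set 'I_N}).
Hypothesis Xa : forall i, Xspace (a i).
Hypothesis Xb : forall i, Xspace (b i).
Hypothesis full : full_dimensional a b.

Let SE : Spherical <> Euclidean. Proof. by []. Qed.

Lemma sph_cauchy (x o : V) : Xspace x -> Xspace o -> -1 <= bform x o <= 1.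
Proof.
move=> /(Xspace_form SE) xx /(Xspace_form SE) oo.
have : 0 <= bform (x - bform x o *: o) (x - bform x o *: o) by exact: bform_ge0.
rewrite !bformE xx oo (bformC o x) /curv => H.
rewrite -ler_norml -(@expr_le1 _ 2)// -normrX ger0_norm ?sqr_ge0//; lra.
Qed.

Lemma sph_sphere (o : V) (kap : R) : Xspace o -> -1 <= kap <= 1 ->
  sphere o (acos kap) = level o kap.
Proof.
move=> Xo kI; apply/seteqP; split => x [Xx xo]; split=> //=; last by rewrite xo.
exact: acos_inj (sph_cauchy Xx Xo) kI xo.
Qed.

(** sin r = |c|, so the level is cos r = sqrt (1 - c ^ 2); it is positive because
    c ^ 2 = 1 would make all facets coincide with the polar hyperplane of o. *)
Lemma spherical_case (o : V) c nu e : Xspace o -> curved_facets a b P o c nu e ->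
  exists r : R, [/\ sphere_radius Spherical r, ~ great_radius Spherical r,
    circumscribed a b (sphere o r) & surface_decomposition a b (sphere o r) P].
Proof.
move=> Xo cf; have oo : bform o o = 1 := Xspace_form SE Xo.
have [c0 pE nn no sE] := cf.
have := facet_defect_form finset.set0 cf; rewrite oo => CS.
have c1 : c ^+ 2 <= 1.
  have : 0 <= bform (nu finset.set0 - c *: o) (nu finset.set0 - c *: o) by exact: bform_ge0.
  by rewrite CS; lra.
have c2 : c ^+ 2 < 1.
  rewrite lt_def c1 andbT; apply/eqP => c2.
  have := facet_normal_proper SE N2 Xa Xb full cf _ finset.set0.
  rewrite oo => /(_ c2)/eqP; apply; apply/eqP; rewrite -subr_eq0; apply/eqP.
  apply: (@bform_eq0 _ Spherical) => //.
  have -> : c^-1 = c by apply: (mulIf c0); rewrite mulVf// -expr2.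
  by rewrite CS -c2; ring.
pose kap := Num.sqrt (1 - c ^+ 2).
have k0 : 0 < kap by rewrite sqrtr_gt0 subr_gt0.
have k2 : kap ^+ 2 = 1 - c ^+ 2 by rewrite sqr_sqrtr// subr_ge0.
have k1 : kap < 1.
  rewrite -(@ltr_pXn2r _ 2) ?nnegrE ?ltW// expr1n k2.
  have : 0 < c ^+ 2 by rewrite exprn_even_gt0.
  lra.
have kI : -1 <= kap <= 1 by apply/andP; split; lra.
have oc : bform o o - curv R Spherical * kap ^+ 2 = c ^+ 2.
  by rewrite oo k2 /curv; ring.
have /andP[r0 r1] := acos_lt_pihalf k0 k1.
exists (acos kap); rewrite sph_sphere//; split.
- by split=> // _; have := pi_gt0 R; lra.
- by case=> _ r2; move: r1; rewrite r2 ltxx.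
- apply: (circumscribed_level SE N2 Xa Xb cf _ oc) => //; exact: lt0r_neq0.
- exact: (level_decomposition SE c0 sE oc).
Qed.

End SphericalCase.

(** * Distances and ideal points in the Lobachevsky space *)

Section LobachevskyGeometry.
Variables (R : realType) (N : nat).
Local Notation V := (vect R Lobachevsky N).
Local Notation bform := (@bform R Lobachevsky N).
Local Notation level := (@level R Lobachevsky N).

Let LE : Lobachevsky <> Euclidean. Proof. by []. Qed.

Lemma lob_form (x : V) : Xspace x -> bform x x = -1.
Proof. exact: Xspace_form. Qed.

(** The orthogonal projection of x to the hyperplane with unit normal o. *)
Definition foot (o x : V) : V :=
  (Num.sqrt (1 + bform x o ^+ 2))^-1 *: (x - bform x o *: o).

Let root_gt0 (k : R) : 0 < Num.sqrt (1 + k ^+ 2).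
Proof. by rewrite sqrtr_gt0 ltr_pwDl// sqr_ge0. Qed.

Let root_sqr (k : R) : Num.sqrt (1 + k ^+ 2) ^+ 2 = 1 + k ^+ 2.
Proof. by rewrite sqr_sqrtr// addr_ge0// sqr_ge0. Qed.

Lemma foot_form (o x y : V) : level o 0 y ->
  bform (foot o x) y = (Num.sqrt (1 + bform x o ^+ 2))^-1 * bform x y.
Proof. by move=> [_ yo]; rewrite /foot !bformE (bformC o) yo mulr0 subr0. Qed.

Lemma foot_level (o x : V) : bform o o = 1 -> Xspace x -> level o 0 (foot o x).
Proof.
move=> oo Xx; have xx := lob_form Xx; set k := bform x o.
have s0 := root_gt0 k; have s2 := root_sqr k.
split; last by rewrite /foot !bformE oo -/k; ring.
apply: (lob_future Xx).
  rewrite /foot !bformE xx oo (bformC o) -/k.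
  transitivity (- (1 + k ^+ 2) / Num.sqrt (1 + k ^+ 2) ^+ 2).
    by field; rewrite gt_eqF.
  by rewrite s2 mulNr divff// -s2 expf_neq0 ?gt_eqF.
rewrite /foot !bformE xx -/k pmulr_rlt0 ?invr_gt0//.
by have := sqr_ge0 k; lra.
Qed.

(** For y in the hyperplane, - <x, y> is sqrt (1 + <x, o> ^ 2) times - <foot, y>,
    and the latter is at least 1. *)
Lemma dist_plane (o x : V) : bform o o = 1 -> Xspace x ->
  dist_to x (level o 0) = arcosh (Num.sqrt (1 + bform x o ^+ 2)).
Proof.
move=> oo Xx; have fL := foot_level oo Xx; have xx := lob_form Xx.
set k := bform x o in fL *; have s0 := root_gt0 k; have s2 := root_sqr k.
have xf y : level o 0 y -> - bform x y = Num.sqrt (1 + k ^+ 2) * - bform (foot o x) y.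
  by move=> yL; rewrite foot_form// -/k mulrN mulVKf// gt_eqF.
have s1 : 1 <= Num.sqrt (1 + k ^+ 2).
  rewrite -(@ler_pXn2r _ 2) ?nnegrE ?ler01 ?(ltW s0)// expr1n s2.
  by rewrite lerDl sqr_ge0.
apply: inf_attained.
  exists (foot o x) => //=; rewrite /dist xf// (lob_form fL.1) opprK mulr1//.
move=> _ [y yL <-]; rewrite /dist; apply: ler_arcosh => //.
rewrite xf//; have := lob_form_le fL.1 yL.1.
by move=> h; rewrite -[leLHS]mulr1 ler_pM2l//; lra.
Qed.

(** An equidistant hypersurface is the image of its base under
    p |-> kap o + sqrt (1 + kap ^ 2) p, and in the base the normalised segment
    joins any two points. *)
Lemma level_path (o x y : V) (kap : R) : bform o o = 1 ->
  level o kap x -> level o kap y ->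
  exists C : set V, [/\ C x, C y, C `<=` level o kap & connected C].
Proof.
move=> oo [Xx xo] [Xy yo]; have xx := lob_form Xx; have yy := lob_form Xy.
pose p := foot o x; pose q := foot o y; pose s := Num.sqrt (1 + kap ^+ 2).
have [Xp po] : level o 0 p := foot_level oo Xx.
have [Xq qo] : level o 0 q := foot_level oo Xy.
have s0 : 0 < s := root_gt0 kap; have s2 : s ^+ 2 = 1 + kap ^+ 2 := root_sqr kap.
have xE : x = kap *: o + s *: p.
  by rewrite /p /foot xo -/s scalerA divff ?gt_eqF// scale1r addrC subrK.
have yE : y = kap *: o + s *: q.
  by rewrite /q /foot yo -/s scalerA divff ?gt_eqF// scale1r addrC subrK.
clearbody p q; have pp := lob_form Xp; have qq := lob_form Xq.
have pq := lob_form_le Xp Xq.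
pose z (r : R) : V := (1 - r) *: p + r *: q.
pose w (r : R) : R := - bform (z r) (z r).
have wE r : w r = (1 - r) ^+ 2 + r ^+ 2 - 2 * (r * (1 - r)) * bform p q.
  by rewrite /w /z !bformE pp qq (bformC q); ring.
have w0 r : 0 <= r <= 1 -> 0 < w r.
  move=> /andP[r0 r1]; rewrite wE.
  have : 0 <= r * (1 - r) * (- 1 - bform p q).
    by rewrite !mulr_ge0//; lra.
  have := sqr_ge0 r; have := sqr_ge0 (1 - r); nra.
pose g (r : R) : V := kap *: o + (s / Num.sqrt (w r)) *: z r.
exists (g @` `[0, 1]%classic); split.
- exists 0; first by rewrite /= in_itv/= lexx ler01.
  rewrite /g wE /z subr0 expr1n expr0n/= !mul0r mulr0 mul0r subr0 addr0 sqrtr1 divr1.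
  by rewrite scale1r scale0r addr0.
- exists 1; first by rewrite /= in_itv/= lexx ler01.
  rewrite /g wE /z subrr expr1n expr0n/= !mulr0 mul0r subr0 add0r sqrtr1 divr1.
  by rewrite scale1r scale0r add0r.
- move=> _ [r rI <-]; move: rI; rewrite /= in_itv/= => rI.
  have wr := w0 r rI; have sw : 0 < Num.sqrt (w r) by rewrite sqrtr_gt0.
  have sw2 : Num.sqrt (w r) ^+ 2 = w r by rewrite sqr_sqrtr// ltW.
  have zz : bform (z r) (z r) = - w r by rewrite opprK.
  have zo : bform (z r) o = 0 by rewrite /z !bformE po qo; ring.
  have pz : bform p (z r) < 0.
    rewrite /z !bformE pp; have /andP[r0 r1] := rI.
    have : r * bform p q <= r * -1 by rewrite ler_wpM2l.
    lra.
  rewrite /g; move: (z r) zz zo pz => zr zz zo pz.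
  split; last by rewrite !bformE oo zo; ring.
  apply: (lob_future Xp).
    rewrite !bformE oo zo (bformC o) zo zz.
    transitivity (kap ^+ 2 - s ^+ 2 * (w r / Num.sqrt (w r) ^+ 2)).
      by field; rewrite gt_eqF.
    by rewrite sw2 divff ?gt_eqF// s2; ring.
  by rewrite !bformE po mulr0 add0r pmulr_rlt0// divr_gt0.
- apply: connected_continuous_connected; first exact: segment_connected.
  apply: continuous_in_subspaceT => r; rewrite inE/= in_itv/= => rI.
  have wr := w0 r rI.
  have idr : r' @[r' --> r] --> r by exact: cvg_id.
  have zc : z r' @[r' --> r] --> z r.
    apply: cvgD; apply: cvgZr_tmp => //.
    by apply: cvgB => //; exact: cvg_cst.
  have wc : w r' @[r' --> r] --> w r.
    by apply: cvgN; exact: (bform_cvg zc zc).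
  have swc : Num.sqrt (w r') @[r' --> r] --> Num.sqrt (w r).
    by apply: continuous_cvg wc; exact: sqrt_continuous.
  apply: cvgD; first exact: cvg_cst.
  apply: cvgZ => //; apply: cvgM; first exact: cvg_cst.
  by apply: cvgV => //; rewrite gt_eqF// sqrtr_gt0.
Qed.

(** At the given distance from the base <x, o> is kap or - kap; a connected set on
    which both occur would contain a point with <x, o> = 0. *)
Lemma level_equidistant (o : V) (kap : R) : bform o o = 1 -> kap != 0 ->
  (level o kap) !=set0 -> equidistant (level o 0) (level o kap).
Proof.
move=> oo k0 [x0 x0L]; split=> //.
have h1 (k : R) : 1 <= Num.sqrt (1 + k ^+ 2).
  rewrite -(@ler_pXn2r _ 2) ?nnegrE ?ler01 ?(ltW (root_gt0 _))// expr1n root_sqr.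
  by rewrite lerDl sqr_ge0.
have sq x : Xspace x -> dist_to x (level o 0) = arcosh (Num.sqrt (1 + kap ^+ 2)) ->
    bform x o = kap \/ bform x o = - kap.
  move=> Xx; rewrite dist_plane// => /arcosh_inj => /(_ (h1 _) (h1 _)) E.
  have : bform x o ^+ 2 == kap ^+ 2.
    by apply/eqP/(addrI (1 : R)); rewrite -(root_sqr (bform x o)) -(root_sqr kap) E.
  by rewrite eqf_sqr => /orP[]/eqP; [left|right].
exists (arcosh (Num.sqrt (1 + kap ^+ 2))); split=> //.
  apply: arcosh_gt0; rewrite -(@ltr_pXn2r _ 2) ?nnegrE ?ltW// expr1n root_sqr.
  by rewrite ltrDl exprn_even_gt0.
set A := [set x | _]; have LA : level o kap `<=` A.
  by move=> x [Xx xo]; split=> //=; rewrite dist_plane// xo.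
exists x0; first exact: LA.
apply/seteqP; split=> x.
  move=> xL; have [C [C0 Cx CL cC]] := level_path oo x0L xL.
  by apply: connected_component_max Cx => //; exact: subset_trans LA.
set C := connected_component A x0 => Cx.
have [Xx xr] : A x by exact: connected_component_sub Cx.
split=> //; have [//|xk] := sq x Xx xr.
have cf : connected [set bform y o | y in C].
  apply: connected_continuous_connected; first exact: component_connected.
  apply: continuous_subspaceT => y.
  have idy : y' @[y' --> y] --> y by exact: cvg_id.
  exact: (bform_cvg idy (cvg_cst o)).
have Cx0 : C x0 by apply: connected_component_refl; exact: LA.
have I := (connected_intervalP _).1 cf.
have C1 : [set bform y o | y in C] kap by exists x0 => //; exact: x0L.2.
have C2 : [set bform y o | y in C] (- kap) by exists x.
have [y Cy y0] : [set bform y o | y in C] 0.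
  have [kp|kn] := ltP 0 kap.
    by apply: (I _ _ C2 C1); apply/andP; split; lra.
  by apply: (I _ _ C1 C2); apply/andP; split; lra.
have [Xy yr] : A y by exact: connected_component_sub Cy.
have [E|E] := sq y Xy yr; move: k0; first by rewrite -E y0 eqxx.
by rewrite -oppr_eq0 -E y0 eqxx.
Qed.

(** The ray from x towards v stays in the hyperplane, and v is a combination of x
    and another point of this ray. *)
Lemma ideal_point_level (w v x : V) : level w 0 x -> v != 0 -> bform v v = 0 ->
  bform v w = 0 -> ideal_point (level w 0) v.
Proof.
move=> [Xx xw] v0 vv vw; split=> //; have xx := lob_form Xx.
have xv : bform x v != 0.
  have := cone_sign Xx (_ : bform v v <= 0) v0; rewrite vv lexx => /(_ isT).
  by apply: contraTneq => ->; rewrite mulr0 ltxx.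
(* chosen so that <x + s v, x + s v> = - 2 *)
pose s := - (bform x v)^-1 / 2.
have s0 : s != 0 by rewrite mulf_neq0 ?oppr_eq0 ?invr_eq0// pnatr_eq0.
pose y := (Num.sqrt 2)^-1 *: (x + s *: v).
have q0 : 0 < Num.sqrt 2 :> R by rewrite sqrtr_gt0.
have q2 : Num.sqrt 2 ^+ 2 = 2 :> R by rewrite sqr_sqrtr.
have sxv : s * bform x v = - 2^-1 by rewrite /s; field.
have yL : level w 0 y.
  split; last by rewrite /y !bformE xw vw; ring.
  apply: (lob_future Xx).
    rewrite /y !bformE xx vv (bformC v x).
    transitivity ((2 * (s * bform x v) - 1) / Num.sqrt 2 ^+ 2).
      by field; rewrite gt_eqF.
    by rewrite sxv q2; field.
  by rewrite /y !bformE xx sxv pmulr_rlt0 ?invr_gt0//; lra.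
exists 2%N, (fun i : 'I_2 => if i == 0 then x else y); split.
  by move=> i; case: ifP.
set A := \matrix_i _.
have -> : v = (- s^-1) *: row 0 A + (s^-1 * Num.sqrt 2) *: row 1 A.
  rewrite !rowK /= /y scalerA mulfK ?gt_eqF// scalerDr scalerA mulVf// scale1r.
  by rewrite scaleNr addKr.
by apply: addmx_sub; apply: scalemx_sub; exact: row_sub.
Qed.

(** v' - r v with r making it orthogonal to x is space-like and isotropic. *)
Lemma isotropic_orth (v v' x : V) : Xspace x -> v != 0 -> bform v v = 0 ->
  bform v' v' = 0 -> bform v' v = 0 -> exists r, v' = r *: v.
Proof.
move=> Xx v0 vv v'v' v'v; have xv : bform x v != 0.
  have := cone_sign Xx (_ : bform v v <= 0) v0; rewrite vv lexx => /(_ isT).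
  by apply: contraTneq => ->; rewrite mulr0 ltxx.
exists (bform x v' / bform x v); apply/eqP; rewrite -subr_eq0; apply: contraT => z0.
have := orth_pos LE Xx _ z0; rewrite bformBr bformZr divfK// subrr => /(_ erefl).
set r := _ / _; have -> : bform (v' - r *: v) (v' - r *: v) = 0.
  by rewrite !bformE vv v'v' (bformC v v') v'v; ring.
by rewrite ltxx.
Qed.

End LobachevskyGeometry.

(** * Cross-polytopes in the Lobachevsky space *)

Section LobachevskyCases.
Variables (R : realType) (N : nat).
Local Notation V := (vect R Lobachevsky N).
Local Notation bform := (@bform R Lobachevsky N).
Local Notation level := (@level R Lobachevsky N).
Hypothesis N2 : (1 < N)%N.
Variables (a b : 'I_N -> V) (P : pred {set 'I_N}).
Hypothesis Xa : forall i, Xspace (a i).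
Hypothesis Xb : forall i, Xspace (b i).
Hypothesis full : full_dimensional a b.

Let LE : Lobachevsky <> Euclidean. Proof. by []. Qed.
Let i0 : 'I_N := Ordinal (ltnW N2).

Variables (o : V) (c : R) (nu : {set 'I_N} -> V) (e : bool).
Hypothesis cf : curved_facets a b P o c nu e.

Let c0 : c != 0. Proof. by case: cf. Qed.
Let nn J : bform (nu J) (nu J) = 1. Proof. by case: cf. Qed.
Let no J : bform (nu J) o = c. Proof. by case: cf. Qed.
Let pE J : span_plane (facet a b J) = level (nu J) 0. Proof. by case: cf. Qed.
Let c2 : 0 < c ^+ 2. Proof. by rewrite exprn_even_gt0. Qed.

Lemma lob_tangent_level kap : kap != 0 -> bform o o + kap ^+ 2 = c ^+ 2 ->
  (forall J, Xspace ((- kap^-1) *: (o - c *: nu J))) ->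
  circumscribed a b (level o kap) /\ surface_decomposition a b (level o kap) P.
Proof.
move=> k0 oc Xt.
have oc' : bform o o - curv R Lobachevsky * kap ^+ 2 = c ^+ 2.
  by rewrite -oc /curv; ring.
split; first apply: (circumscribed_level LE N2 Xa Xb cf k0 oc') => _ J.
  by rewrite /curv mulN1r.
by case: cf => *; apply: (level_decomposition LE c0 _ oc').
Qed.

Lemma tangency_form kap J : kap != 0 -> bform o o + kap ^+ 2 = c ^+ 2 ->
  bform ((- kap^-1) *: (o - c *: nu J)) ((- kap^-1) *: (o - c *: nu J)) = -1.
Proof.
move=> k0 oc; rewrite !bformE nn no (bformC o) no.
rewrite (_ : bform o o = c ^+ 2 - kap ^+ 2); last by rewrite -oc; ring.
by field.
Qed.

Lemma lob_sphere (x : V) (kap : R) : Xspace x -> 1 <= kap ->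
  sphere x (arcosh kap) = level x (- kap).
Proof.
move=> Xo k1; apply/seteqP; split => y [Xy yo]; split=> //=; last by rewrite yo opprK.
rewrite -[bform y x]opprK; congr (- _); apply: arcosh_inj => //.
by have := lob_form_le Xy Xo; lra.
Qed.

(** Here sinh r = |c|, so the level is - cosh r = - sqrt (1 + c ^ 2). *)
Lemma lob_sphere_case : Xspace o ->
  exists r : R, [/\ sphere_radius Lobachevsky r, ~ great_radius Lobachevsky r,
    circumscribed a b (sphere o r) & surface_decomposition a b (sphere o r) P].
Proof.
move=> Xo; have oo := lob_form Xo; pose k := Num.sqrt (1 + c ^+ 2).
have k2 : k ^+ 2 = 1 + c ^+ 2 by rewrite sqr_sqrtr// addr_ge0// ltW.
have k0 : 0 < k by rewrite sqrtr_gt0 addr_gt0.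
have k1 : 1 < k.
  by rewrite -(@ltr_pXn2r _ 2) ?nnegrE ?ler01 ?(ltW k0)// expr1n k2 ltrDl.
have kn : - k != 0 by rewrite oppr_eq0 gt_eqF.
have oc : bform o o + (- k) ^+ 2 = c ^+ 2 by rewrite oo sqrrN k2; ring.
have [|H1 H2] := lob_tangent_level kn oc.
  move=> J; apply: (lob_future Xo); first exact: tangency_form.
  rewrite invrN opprK !bformE oo (bformC o) no pmulr_rlt0 ?invr_gt0//.
  by have := c2; rewrite expr2; lra.
exists (arcosh k); rewrite lob_sphere ?ltW//; split=> //; last by case.
by split=> //; exact: arcosh_gt0.
Qed.

(** The level is c up to sign, and the sign is the one for which the points of the
    level set are future-directed. *)
Lemma lob_orisphere_case : o != 0 -> bform o o = 0 ->
  exists kap : R, circumscribed a b (orisphere o kap) /\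
     surface_decomposition a b (orisphere o kap) P.
Proof.
move=> o0 oo; have Xa0 := Xa i0.
have to : time o != 0.
  by apply: contra_neq o0 => /bform_time0[_]; exact.
pose kap := - Num.sg (time o) * `|c|.
have sg2 : Num.sg (time o) ^+ 2 = 1 by rewrite sqr_sg to.
have k0 : kap != 0 by rewrite mulf_neq0// ?oppr_eq0 ?sgr_eq0// normr_eq0.
have oc : bform o o + kap ^+ 2 = c ^+ 2.
  by rewrite oo add0r /kap exprMn sqrrN sg2 mul1r -normrX ger0_norm// sqr_ge0.
have tk : time o * kap < 0.
  have -> : time o * kap = - ((Num.sg (time o) * time o) * `|c|) by rewrite /kap; ring.
  by rewrite -normrEsg oppr_lt0 mulr_gt0// normr_gt0.
exists kap; apply: lob_tangent_level => // J; set t := _ *: _.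
have tt : bform t t = -1 := tangency_form J k0 oc.
have ot : bform o t = kap.
  rewrite /t !bformE oo (bformC o) no; move: oc; rewrite oo add0r => k2.
  transitivity (kap^-1 * c ^+ 2); first by ring.
  by rewrite -k2; field.
apply/lobP; split=> //; have := time_form o t; rewrite tt oo ot => H.
have t2 : 0 < time o ^+ 2 by rewrite exprn_even_gt0.
have : 0 < - (time o * kap) * time t by lra.
by rewrite pmulr_rgt0// oppr_gt0.
Qed.

Hypothesis oo : bform o o = 1.

(** For c ^ 2 > 1 the vector o - c nu is time-like, so its products with the vertices
    of the facet have one sign, and they are the products of o with the vertices. Common
    vertices carry this sign over to the neighbouring facets. An equidistant
    hypersurface is one component of the set of points at a given distance, so
    the tangency points must all lie on one side. *)
Lemma facets_side : 1 < c ^+ 2 -> exists sg : R, sg ^+ 2 = 1 /\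
  forall J i, 0 < sg * bform (facet a b J i) o.
Proof.
move=> c1; pose sg := Num.sg (bform (a i0) o).
have Xf J i : Xspace (facet a b J i) by exact: facet_Xspace.
have tf J i : bform (facet a b J i) (o - c *: nu J) = bform (facet a b J i) o.
  have : level (nu J) 0 (facet a b J i) by rewrite -pE; exact: span_plane_vertex.
  by case=> _ f0; rewrite bformBr bformZr f0 mulr0 subr0.
have zz J : bform (o - c *: nu J) (o - c *: nu J) < 0.
  have -> : bform (o - c *: nu J) (o - c *: nu J) = 1 - c ^+ 2.
    by rewrite !bformE oo nn (bformC o) no; ring.
  by rewrite subr_lt0.
have side J i : time (o - c *: nu J) * bform (facet a b J i) o < 0.
  rewrite -tf; apply: cone_sign => //; first exact: ltW.
  by apply: contraTneq (zz J) => ->; rewrite bform0l ltxx.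
have sidec J i i' s : 0 < s * bform (facet a b J i) o -> 0 < s * bform (facet a b J i') o.
  have := side J i; have := side J i'; move: (time _) => u h1 h2 h3.
  have : 0 < u ^+ 2 * (s * bform (facet a b J i) o).
    rewrite pmulr_rgt0// exprn_even_gt0//=; apply: contraTneq h1 => ->.
    by rewrite mul0r ltxx.
  have -> : u ^+ 2 * (s * bform (facet a b J i) o) =
    (u * s) * (u * bform (facet a b J i) o) by ring.
  rewrite nmulr_lgt0// => us.
  have : 0 < u * s * (u * bform (facet a b J i') o) by rewrite nmulr_lgt0.
  have -> : (u * s) * (u * bform (facet a b J i') o) =
    u ^+ 2 * (s * bform (facet a b J i') o) by ring.
  rewrite pmulr_rgt0// exprn_even_gt0//=; apply: contraTneq h1 => ->.
  by rewrite mul0r ltxx.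
have a0 : bform (a i0) o != 0.
  have := side finset.set0 i0; rewrite /facet inE; apply: contraTneq => ->.
  by rewrite mulr0 ltxx.
exists sg; split; first by rewrite sqr_sg a0.
suff H J J' : (forall i, 0 < sg * bform (facet a b J i) o) ->
    forall i, 0 < sg * bform (facet a b J' i) o.
  move=> J; apply: (H finset.set0) => i; apply: (sidec _ i0).
  by rewrite /facet inE /sg -normrEsg normr_gt0.
apply: (flip_connected (p := fun J => forall i, 0 < sg * bform (facet a b J i) o)).
move=> J1 j jJ; have [i fi] := flip_common N2 a b J1 j.
have {}fi : facet a b J1 i = facet a b (j |: J1)%SET i := fi.
split=> H i'; apply: (sidec _ i); first by rewrite -fi.
by rewrite fi.
Qed.

(** cosh of the distance is |c|, and the side of the facets gives the sign of the
    level. *)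
Lemma lob_equidistant_case : 1 < c ^+ 2 ->
  exists Om : set V, [/\ equidistant (level o 0) Om, circumscribed a b Om &
                 surface_decomposition a b Om P].
Proof.
move=> c1; have [sg [sg2 side]] := facets_side c1.
pose kap := sg * Num.sqrt (c ^+ 2 - 1).
have r0 : 0 < Num.sqrt (c ^+ 2 - 1) by rewrite sqrtr_gt0 subr_gt0.
have k2 : kap ^+ 2 = c ^+ 2 - 1.
  by rewrite exprMn sg2 mul1r sqr_sqrtr// subr_ge0 ltW.
have k0 : kap != 0.
  by rewrite -sqrf_eq0 k2 gt_eqF// subr_gt0.
have oc : bform o o + kap ^+ 2 = c ^+ 2 by rewrite oo k2; ring.
have Xt J : Xspace ((- kap^-1) *: (o - c *: nu J)).
  have Xf : Xspace (facet a b J i0) by exact: facet_Xspace.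
  apply: (lob_future Xf); first exact: tangency_form.
  have : level (nu J) 0 (facet a b J i0) by rewrite -pE; exact: span_plane_vertex.
  case=> _ f0; rewrite bformZr bformBr bformZr f0 mulr0 subr0 mulNr oppr_lt0.
  have k20 : 0 < kap ^+ 2 by rewrite exprn_even_gt0.
  rewrite -(pmulr_rgt0 _ k20) mulrA expr2 mulfK// /kap mulrAC.
  by rewrite mulr_gt0.
have [H1 H2] := lob_tangent_level k0 oc Xt.
exists (level o kap); split=> //; apply: level_equidistant => //.
have [t tt] := H1 finset.set0; exists t; by case: tt.
Qed.

Lemma lob_plane_point : level o 0 (foot o (a i0)).
Proof. exact: foot_level. Qed.

Lemma lob_plane : is_plane N (level o 0).
Proof.
apply: level_plane => //; last by exists (foot o (a i0)); exact: lob_plane_point.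
by apply: contra_eq_neq oo => ->; rewrite bform0l eq_sym oner_eq0.
Qed.

Lemma lob_projection : hyperplane_decomposition a b (level o 0) P.
Proof.
have [_ _ _ _ sE] := cf.
apply: (projection_decomposition lob_plane_point _ _ sE).
  split; first by apply: continuous_subspaceT => x; exact: cst_continuous.
  by move=> x Lx; exact: (unit_normal_plane LE oo).
move=> J i; set f := facet a b J i; have Xf : Xspace f by exact: facet_Xspace.
rewrite /orth_proj bformBl lob_plane_point.2 subr0; set y := f - _.
exists (vnorm y)^-1, (- bform f o).
have yy : bform y y < 0.
  rewrite /y !bformE oo (lob_form Xf) (bformC o).
  by have := sqr_ge0 (bform f o); rewrite expr2; lra.
split; first by rewrite invr_gt0 sqrtr_gt0 normr_gt0 lt_eqF.
by rewrite /y -scaleNr.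
Qed.

(** For c ^ 2 < 1 the normals of the facet and of the base span a Euclidean plane;
    the projection of a vertex of the facet along this plane is a common point. *)
Lemma lob_angle_case : c ^+ 2 < 1 -> exists alpha : R,
  [/\ 0 < alpha < pi / 2,
      (forall J, meet_at_angle (span_plane (facet a b J)) (level o 0) alpha) &
      hyperplane_decomposition a b (level o 0) P].
Proof.
move=> c1; have nc : `|c| < 1 by rewrite -(@expr_lt1 _ 2)// -normrX ger0_norm ?sqr_ge0.
exists (acos `|c|); split; last exact: lob_projection.
  by apply: acos_lt_pihalf => //; rewrite normr_gt0.
move=> J; rewrite pE; split; last first.
  move=> x v v' Fx Hx /(unit_normal_level LE (nn J) Fx) vE.
  move=> /(unit_normal_level LE oo Hx) vE'; congr acos.
  by case: vE => ->; case: vE' => ->; rewrite ?bformNl ?bformNr no ?opprK ?normrN.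
have Xf : Xspace (facet a b J i0) by exact: facet_Xspace.
have [_ fn] : level (nu J) 0 (facet a b J i0) by rewrite -pE; exact: span_plane_vertex.
set f := facet a b J i0 in Xf fn; have ff := lob_form Xf.
pose o' := (Num.sqrt (1 - c ^+ 2))^-1 *: (o - c *: nu J).
have s0 : 0 < Num.sqrt (1 - c ^+ 2) by rewrite sqrtr_gt0 subr_gt0.
have s2 : Num.sqrt (1 - c ^+ 2) ^+ 2 = 1 - c ^+ 2 by rewrite sqr_sqrtr// subr_ge0 ltW.
have o'o' : bform o' o' = 1.
  rewrite !bformE oo nn (bformC o) no.
  transitivity ((1 - c ^+ 2) / Num.sqrt (1 - c ^+ 2) ^+ 2); first by field; rewrite gt_eqF.
  by rewrite s2 divff// gt_eqF// subr_gt0.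
have o'n : bform o' (nu J) = 0 by rewrite !bformE nn (bformC o) no; ring.
have [Xp po'] := foot_level o'o' Xf.
have pn : bform (foot o' f) (nu J) = 0.
  by rewrite /foot bformZl bformBl bformZl fn o'n; ring.
exists (foot o' f); split; split => //.
have oE : o = Num.sqrt (1 - c ^+ 2) *: o' + c *: nu J.
  by rewrite scalerA divff ?gt_eqF// scale1r subrK.
by clearbody o'; rewrite oE bformDr !bformZr po' pn; ring.
Qed.

(** For c ^ 2 = 1 the vector nu - c o is isotropic and orthogonal to both normals,
    and nonzero since no facet lies in the base: it is the common ideal point. *)
Lemma lob_parallel_case : c ^+ 2 = 1 ->
  (forall J, parallel (span_plane (facet a b J)) (level o 0)) /\
  hyperplane_decomposition a b (level o 0) P.
Proof.
move=> c1; split; last exact: lob_projection.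
move=> J; rewrite pE.
have Xf : Xspace (facet a b J i0) by exact: facet_Xspace.
have fL : level (nu J) 0 (facet a b J i0) by rewrite -pE; exact: span_plane_vertex.
have ci : c^-1 = c by apply: (mulIf c0); rewrite mulVf// -expr2 c1.
pose v := nu J - c *: o.
have v0 : v != 0.
  by rewrite subr_eq0 -{1}ci (facet_normal_proper LE N2 Xa Xb full cf)// oo c1.
have vv : bform v v = 0 by rewrite (facet_defect_form _ cf) oo c1; ring.
have vn : bform v (nu J) = 0.
  by rewrite !bformE nn (bformC o) no -expr2 c1 subrr.
have vo : bform v o = 0 by rewrite !bformE no oo; ring.
split.
  rewrite -subset0 => x [[Xx xn] [_ xo]].
  have xv : bform x v = 0 by rewrite !bformE xn xo; ring.
  by have := orth_pos LE Xx xv v0; rewrite vv ltxx.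
exists v; split.
- exact: ideal_point_level fL _ _ _.
- exact: ideal_point_level lob_plane_point _ _ _.
move=> v' [v'0 v'v' [p1 [f1 [F1 /submxP[u1 E1]]]]] [_ _ [p2 [f2 [F2 /submxP[u2 E2]]]]].
have ker (w : V) p (f : 'I_p -> V) u : (forall i, level w 0 (f i)) ->
    v' = u *m \matrix_i f i -> bform v' w = 0.
  move=> fw ->; rewrite mulmx_sum_row bform_suml big1// => i _.
  by rewrite rowK bformZl (fw i).2 mulr0.
have v'v : bform v' v = 0; last exact: isotropic_orth Xf v0 vv v'v' v'v.
by rewrite !bformE (ker _ _ _ _ F1 E1) (ker _ _ _ _ F2 E2); ring.
Qed.

End LobachevskyCases.

(** * Cross-polytopes in the Euclidean space *)

Section EuclideanTangents.
Variables (R : realType) (N : nat).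
Local Notation V := (vect R Euclidean N).
Local Notation bform := (@bform R Euclidean N).
Local Notation hom_pt := (@hom_pt R Euclidean N).
Local Notation hom_vec := (@hom_vec R Euclidean N).

Definition affine_plane (xi : 'cV[R]_N.+1) : set V :=
  [set x | Xspace x /\ (hom_pt x *m xi) 0 0 = 0].

Lemma line_tangent (A : set V) (t v : V) : (forall s, A (t + s *: v)) ->
  tangent_vector A t v.
Proof.
move=> At; exists (fun s => t + s *: v); split.
- by rewrite scale0r addr0.
- by apply: filterE => s; exact: At.
- by apply: (derive_curve t (g := fun=> v)); exact: cst_continuous.
Qed.

Variables (xi : 'cV[R]_N.+1) (nu : V).
Hypothesis xinu : forall v, (hom_vec v *m xi) 0 0 = bform v nu.

Lemma affine_planeD x v : (hom_pt (x + v) *m xi) 0 0 = (hom_pt x *m xi) 0 0 + bform v nu.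
Proof. by rewrite hom_ptD mulmxDl mxE xinu. Qed.

Lemma tangent_affine_plane t v : affine_plane xi t ->
  tangent_vector (affine_plane xi) t v <-> bform v nu = 0.
Proof.
move=> [_ t0]; split=> [[gamma [g0 gA dg]]|vn].
  apply: (derive_level (c := bform (gamma 0) nu) dg).
  apply: filterS gA => s [_ gs]; apply/eqP; rewrite -subr_eq0 -bformBl -xinu hom_ptB.
  by rewrite mulmxBl mxE [(- _ : 'M[R]_1) _ _]mxE gs g0 t0 subrr.
by apply: line_tangent => s; split=> //; rewrite affine_planeD t0 bformZl vn; ring.
Qed.

Hypothesis nn : bform nu nu = 1.

Lemma affine_plane_unit_normal t : affine_plane xi t ->
  unit_normal (affine_plane xi) t nu.
Proof.
move=> tF; split=> //; first exact: line_tangent.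
by move=> v /tangent_affine_plane => /(_ tF); rewrite bformC.
Qed.

Lemma unit_normal_affine_plane t v : affine_plane xi t ->
  unit_normal (affine_plane xi) t v -> v = nu \/ v = - nu.
Proof.
move=> tF [vv _ vF]; pose z := v - bform v nu *: nu.
have zn : bform z nu = 0 by rewrite !bformE nn; ring.
have vz : bform v z = 0 by apply: vF; apply/tangent_affine_plane.
have z0 : z = 0.
  apply: bform_eq0 => //; rewrite {1}/z bformBl bformZl vz (bformC nu) zn; ring.
have vE : v = bform v nu *: nu by apply/eqP; rewrite -subr_eq0 -/z z0.
move: vv; rewrite {1}vE bformZl {2}vE bformZr nn mulr1 => /eqP; rewrite -expr2 sqrf_eq1.
move: (bform v nu) vE => k -> {v vF z zn vz z0}.
by move=> /orP[]/eqP->; rewrite ?scale1r ?scaleN1r; [left|right].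
Qed.

Lemma affine_plane_is_plane : affine_plane xi !=set0 -> is_plane N (affine_plane xi).
Proof.
move=> ne; split => //; have xi0 : xi != 0.
  apply: contra_eq_neq nn => xi0; rewrite -xinu xi0 mulmx0 mxE eq_sym; exact: oner_neq0.
have [U [fU UE]] := ker_basis xi0; exists U; split => //.
apply/seteqP; split => x [Xx]; rewrite ?UE.
  by move=> xw; split=> //; rewrite UE; apply/eqP/matrixP => i j; rewrite !ord1 xw mxE.
by move=> /eqP xw; split => //; rewrite xw mxE.
Qed.

End EuclideanTangents.

Section EuclideanSphere.
Variables (R : realType) (N : nat).
Local Notation V := (vect R Euclidean N).
Local Notation bform := (@bform R Euclidean N).
Variables (p : V) (c : R).
Hypothesis c0 : 0 < c.

Lemma euclid_sphereE (x : V) : sphere p c x <-> bform (x - p) (x - p) = c ^+ 2.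
Proof.
split=> [[_ <-]|xp]; first by rewrite sqr_sqrtr// bform_ge0.
by split=> //; rewrite /dist xp sqrtr_sqr gtr0_norm.
Qed.

(** The curve p + sqrt (1 - A s ^ 2) (t - p) + s v stays on the sphere. *)
Lemma tangent_euclid_sphere (t v : V) : sphere p c t ->
  tangent_vector (sphere p c) t v <-> bform v (t - p) = 0.
Proof.
move=> /euclid_sphereE tp; split=> [[gamma [g0 gA dg]]|vt].
  have := @derive_quadric _ _ _ gamma v p (c ^+ 2) dg; rewrite g0; apply.
  by apply: filterS gA => s /euclid_sphereE.
pose A := bform v v / c ^+ 2.
pose r s := Num.sqrt (1 - A * (s * s)).
pose h s := - (A * s / (1 + r s)).
pose g s := v + h s *: (t - p).
have h1 : 1 - A * (s * s) @[s --> 0] --> (1 - A * (0 * 0) : R).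
  apply: cvgB; first exact: cvg_cst.
  by apply: cvgM; [exact: cvg_cst|apply: cvgM; exact: cvg_id].
have rc : r s @[s --> 0] --> (1 : R).
  rewrite [X in _ --> X](_ : _ = Num.sqrt (1 - A * (0 * 0))); last first.
    by rewrite !mulr0 subr0 sqrtr1.
  by apply: continuous_cvg h1; exact: sqrt_continuous.
have hc : h s @[s --> 0] --> (- (A * 0 / (1 + 1)) : R).
  apply: cvgN; apply: cvgM; first by apply: cvgM; [exact: cvg_cst|exact: cvg_id].
  by apply: cvgV; [rewrite -[1 + 1]/(2%:R) pnatr_eq0|apply: cvgD rc; exact: cvg_cst].
exists (fun s => t + s *: g s); split.
- by rewrite scale0r addr0.
- near=> s; apply/euclid_sphereE.
  have r0 : 0 < 1 - A * (s * s).
    by near: s; apply: (cvgr_gt _ h1); rewrite !mulr0 subr0 ltr01.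
  have rs : r s ^+ 2 = 1 - A * (s * s) by rewrite sqr_sqrtr// ltW.
  have rp : 1 + r s != 0 by rewrite gt_eqF// ltr_wpDr ?sqrtr_ge0.
  have -> : t + s *: g s - p = r s *: (t - p) + s *: v.
    have -> : r s = 1 + s * h s.
      apply: (mulIf rp); rewrite /h; transitivity (1 + r s - A * (s * s)).
        by rewrite -[RHS]addr0; move: rs; rewrite expr2; lra.
      by field.
    rewrite /g scalerDr scalerA [in RHS]scalerDl scale1r addrAC -!addrA.
    by congr (_ + _); congr (_ + _); rewrite addrC.
  rewrite !bformE; rewrite !bformE in tp vt.
  have ve : bform v v = A * c ^+ 2 by rewrite divfK// expf_neq0// gt_eqF.
  have pv : bform v p = bform v t by apply/eqP; rewrite eq_sym -subr_eq0 vt.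
  rewrite !(bformC t v) !(bformC p v) pv ve.
  transitivity (r s ^+ 2 * (bform t t - bform t p - (bform p t - bform p p)) + s ^+ 2 * (A * c ^+ 2)).
    ring.
  by rewrite tp rs; ring.
- rewrite [X in is_derive _ _ _ X](_ : _ = g 0); last first.
    by rewrite /g /h mulr0 mul0r oppr0 scale0r addr0.
  apply: derive_curve; rewrite /prop_for /continuous_at /g {2}/h.
  apply: cvgD; first exact: cvg_cst.
  apply: cvgZr_tmp; have := hc; rewrite mulr0 !mul0r; exact.
Unshelve. all: by end_near. Qed.

Lemma euclid_sphere_orientation :
  orientation (sphere p c) (fun x => c^-1 *: (x - p)).
Proof.
split.
  apply: continuous_subspaceT => x.
  have H : id y @[y --> (x : V)] --> (x : V) by exact: cvg_id.
  exact: cvgZl_tmp (cvgB H (cvg_cst p)).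
move=> x xS; have /euclid_sphereE xp := xS; split.
- rewrite bformZl bformZr xp; field; exact: lt0r_neq0.
- exact: line_tangent.
- move=> v /(tangent_euclid_sphere _ xS) vx.
  by rewrite bformZl bformC vx mulr0.
Qed.

End EuclideanSphere.

Section EuclideanCases.
Variables (R : realType) (N : nat).
Local Notation V := (vect R Euclidean N).
Local Notation bform := (@bform R Euclidean N).
Local Notation hom_pt := (@hom_pt R Euclidean N).
Local Notation hom_vec := (@hom_vec R Euclidean N).
Hypothesis N2 : (1 < N)%N.
Variables (a b : 'I_N -> V) (P : pred {set 'I_N}).
Hypothesis full : full_dimensional a b.
Let i0 : 'I_N := Ordinal (ltnW N2).

(** The Euclidean counterpart of the description of facets by normals: the
    hyperplane of a facet is the zero set of an affine functional xi with linear
    part nu, and o is given in homogeneous coordinates. *)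
Definition euclid_facets (o : 'rV[R]_N.+1) (c : R)
    (nu : {set 'I_N} -> V) (xi : {set 'I_N} -> 'cV[R]_N.+1) (e : bool) : Prop :=
  [/\ c != 0, forall J, span_plane (facet a b J) = affine_plane (xi J),
      forall J, bform (nu J) (nu J) = 1 /\
        forall v, (hom_vec v *m xi J) 0 0 = bform v (nu J),
      forall J, (o *m xi J) 0 0 = c &
      forall J : {set 'I_N}, (-1) ^+ #|J| *
        Num.sg (\det (col_mx o (hom_mx (facet a b J)) : 'M[R]_N.+1)) =
        (-1) ^+ (e (+) P J)].

Lemma euclid_facets_scale o c nu xi e r : r != 0 ->
  euclid_facets o c nu xi e ->
  euclid_facets (r *: o) (r * c) nu xi (e (+) (r < 0)).
Proof.
move=> r0 [c0 pE nn no sE]; split=> //; first by rewrite mulf_neq0.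
  by move=> J; rewrite -scalemxAl mxE no.
move=> J; have := det_col_mx_affine r o 0 (hom_mx (facet a b J)).
rewrite mul0mx addr0 => ->; rewrite sgrM.
by rewrite mulrCA sE sgr_sign// -signr_addb addbA [(r < 0) (+) e]addbC.
Qed.

(** The functional xi is the signed distance to the facet, and it has the value c
    at p. *)
Lemma euclid_sphere_case (p : V) c nu xi e :
  euclid_facets (hom_pt p) c nu xi e ->
  exists r : R, [/\ sphere_radius Euclidean r, ~ great_radius Euclidean r,
    circumscribed a b (sphere p r) & surface_decomposition a b (sphere p r) P].
Proof.
move=> [c0 pE nn no sE]; have r0 : 0 < `|c| by rewrite normr_gt0.
exists `|c|; split; [by split|by case| |].
  move=> J; have [nJ xJ] := nn J; exists (p - c *: nu J); rewrite pE.
  have tF : affine_plane (xi J) (p - c *: nu J).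
    by split=> //; rewrite -scaleNr (affine_planeD xJ) no bformZl nJ; ring.
  have tS : sphere p `|c| (p - c *: nu J).
    apply/(euclid_sphereE _ r0).
    rewrite addrAC subrr add0r !bformE nJ -normrX ger0_norm ?sqr_ge0//; ring.
  split=> // v; rewrite (tangent_affine_plane xJ _ tF) (tangent_euclid_sphere r0 _ tS).
  rewrite addrAC subrr add0r bformNr bformZr; split=> [->|/eqP]; first by rewrite mulr0 oppr0.
  by rewrite oppr_eq0 mulf_eq0 (negPf c0) => /eqP.
exists (fun x => `|c|^-1 *: (x - p)), (@alternating R N), (e (+) true); split.
- exact: euclid_sphere_orientation.
- exact: alternating_coherent.
- move=> J t [[_ /submxP[u tu]] _ _].
  rewrite (@orient_sign_affine _ _ _ _ (- `|c|^-1) (hom_pt p) (`|c|^-1 *: u)).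
    rewrite mulrCA sE sgr_sign ?oppr_eq0 ?invr_eq0 ?gt_eqF//.
    by rewrite oppr_lt0 invr_gt0 r0 -signr_addb addbA [true (+) e]addbC.
  rewrite hom_vecZ hom_ptB tu -scalemxAl scalerBr scaleNr addrC; congr (_ + _).
Qed.

Definition central_plane (w : V) : set V := affine_plane (col_mx (0 : 'M[R]_1) w^T).

Lemma central_planeP (w v : V) : (hom_vec v *m col_mx (0 : 'M[R]_1) w^T) 0 0 = bform v w.
Proof.
rewrite /Defs.hom_vec (mul_row_col (0 : 'M[R]_1)) mulmx0 add0r mxE; apply: eq_bigr => j _.
by rewrite mxE /bsign mul1r.
Qed.

Lemma central_plane0 (w : V) : central_plane w 0.
Proof.
split=> //; have -> : hom_pt (0 : V) = hom_pt 0 + hom_vec 0 by rewrite -hom_ptD addr0.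
rewrite mulmxDl mxE central_planeP bform0l addr0 /Defs.hom_pt (mul_row_col (1%:M : 'M[R]_1)).
by rewrite mulmx0 mul0mx addr0 mxE.
Qed.

(** When o is a direction, all hyperplanes orthogonal to it make the same angles
    with the facets; the one through the origin is taken. *)
Lemma euclid_angle_case (w : V) c nu xi e :
  euclid_facets (hom_vec w) c nu xi e -> bform w w = 1 ->
  exists alpha : R,
  [/\ 0 < alpha < pi / 2,
      (forall J, meet_at_angle (span_plane (facet a b J)) (central_plane w) alpha) &
      hyperplane_decomposition a b (central_plane w) P].
Proof.
move=> [c0 pE nn no sE] ww.
have nw J : bform (nu J) w = c by rewrite bformC -(nn J).2 no.
have fF J i : affine_plane (xi J) (facet a b J i) by rewrite -pE; exact: span_plane_vertex.
have CS J : bform (nu J - c *: w) (nu J - c *: w) = 1 - c ^+ 2.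
  by rewrite !bformE (nn J).1 ww nw (bformC w) nw; ring.
have c1 : c ^+ 2 < 1.
  rewrite lt_neqAle -subr_ge0 -(CS finset.set0) bform_ge0// andbT.
  apply/eqP => c1; have nE J : nu J = c *: w.
    by apply/eqP; rewrite -subr_eq0; apply/eqP/bform_eq0 => //; rewrite CS c1 subrr.
  have FE J : span_plane (facet a b J) = span_plane (facet a b finset.set0).
    apply: (flip_connected (p := fun J => span_plane (facet a b J) =
      span_plane (facet a b finset.set0))) (erefl (span_plane (facet a b finset.set0))).
    move=> {}J j jJ; suff -> : span_plane (facet a b J) = span_plane (facet a b (j |: J)%SET) by [].
    have [i fi] := flip_common N2 a b J j.
    have {}fi : facet a b J i = facet a b (j |: J)%SET i := fi.
    rewrite !pE; have [_ f1] := fF J i; have [_] := fF (j |: J)%SET i; rewrite -fi => f2.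
    have pt J' x : (hom_pt (facet a b J i) *m xi J') 0 0 = 0 ->
       (hom_pt x *m xi J') 0 0 = bform (x - facet a b J i) (c *: w).
      move=> f0; rewrite -(nE J') -(nn J').2 hom_ptB mulmxBl.
      by rewrite [RHS]mxE [X in _ + X]mxE f0 subr0.
    by apply/seteqP; split=> x [_ x0]; split=> //; move: x0; rewrite (pt _ _ f1) (pt _ _ f2).
  apply: (full_dim_facets _ _ FE _ full) => //.
  rewrite pE; apply: (affine_plane_is_plane (nn finset.set0).2 (nn finset.set0).1).
  by exists (facet a b finset.set0 i0).
have nc : `|c| < 1 by rewrite -(@expr_lt1 _ 2)// -normrX ger0_norm ?sqr_ge0.
have wP := central_planeP w.
exists (acos `|c|); split.
- by apply: acos_lt_pihalf => //; rewrite normr_gt0.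
- move=> J; have [nJ xJ] := nn J; rewrite pE; split; last first.
    move=> x v v' Fx Hx /(unit_normal_affine_plane xJ nJ Fx) vE.
    move=> /(unit_normal_affine_plane wP ww Hx) vE'; congr acos.
    by case: vE => ->; case: vE' => ->; rewrite ?bformNl ?bformNr nw ?opprK ?normrN.
  have [_ f0] := fF J i0; set f := facet a b J i0 in f0.
  pose k := (hom_pt f *m col_mx (0 : 'M[R]_1) w^T) 0 0.
  have d0 : 1 - c ^+ 2 != 0 by rewrite gt_eqF// subr_gt0.
  exists (f + (- (k / (1 - c ^+ 2))) *: (w - c *: nu J)); split; split=> //.
    by rewrite (affine_planeD xJ) f0 !bformE nJ (bformC w) nw; ring.
  by rewrite (affine_planeD wP) -/k !bformE ww nw; field.
- have H0 := central_plane0 w.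
  apply: (projection_decomposition H0 _ _ sE).
    split; first by apply: continuous_subspaceT => x; exact: cst_continuous.
    by move=> x Hx; exact: (affine_plane_unit_normal wP ww).
  move=> J i; exists 1, (- bform (facet a b J i - 0) w); split=> //.
  by rewrite /orth_proj -scaleNr hom_ptD hom_vecZ scale1r.
Qed.

End EuclideanCases.

(** * The facets of P_(k) *)

Section Signs.
Variable R : realType.

Lemma sign_card (I : finType) (A : {set I}) (p : pred I) :
  (-1) ^+ #|[set j in A | p j]%SET| = \prod_(j in A) (-1) ^+ (p j) :> R.
Proof.
rewrite -sum1_card (big_morph _ (exprD (-1)) (expr0 (-1))).
rewrite (eq_bigl (fun j => (j \in A) && p j)); last by move=> j; rewrite inE.
by rewrite big_mkcondr; apply: eq_bigr => j _; case: (p j).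
Qed.

(** The definition of X_k records exactly when, for a vertex of index i, the signs
    - 1 of the coherent orientation, s_i s_i' and the sign for i < k multiply to
    1. *)
Lemma odd_class_sign N (s s' : 'I_N.+1 -> R) (k : 'I_N.+1) (J : {set 'I_N}) :
  (forall i, s i * s' i = 1 \/ s i * s' i = -1) ->
  (-1) ^+ #|J| * (-1) ^+ #|[set j in (lift k @: J)%SET | (j < k)%N]%SET| *
    \prod_(i in J) (s (lift k i) * s' (lift k i)) =
  (-1) ^+ (@odd_class R N.+1 s s' k J).
Proof.
move=> ss; rewrite /odd_class signr_odd finset.setDE.
have -> : (lift k @: J :&: ~: Xset s s' k)%SET =
    [set j in (lift k @: J)%SET | j \notin Xset s s' k]%SET.
  by apply/setP => j; rewrite !inE.
rewrite !sign_card !(big_imset _ (in2W lift_inj))/= -prodr_const -!big_split/=.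
have neg1 : (-1 == 1 :> R) = false by rewrite eq_sym -subr_eq0 opprK -[1 + 1]/(2%:R) pnatr_eq0.
apply: eq_bigr => i _; have lk := neq_lift k i; have := ss (lift k i); rewrite inE.
have [h|h|/val_inj E] := ltngtP (lift k i) k; last by rewrite E eqxx in lk.
- rewrite /=; by case=> ->; rewrite ?eqxx ?neg1 ?orbF/= ?expr1 ?expr0 ?mulr1 ?mulrN1 ?mulrNN ?mulN1r ?opprK.
- by case=> ->; rewrite /= ?eqxx ?neg1 ?(eq_sym 1) ?neg1/= ?expr1 ?expr0 ?mulr1 ?mulrN1 ?mulrNN ?mulN1r ?opprK.
Qed.

End Signs.

Section Frame.
Variables (R : realType) (X : geometry) (N : nat).
Local Notation V := (vect R X N).
Variables (G : 'M[R]_N.+1) (lam s s' : 'I_N.+1 -> R) (qa qb : 'I_N.+1 -> V).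
Variables (T : 'M[R]_N.+1) (alpha beta : 'I_N.+1 -> R) (Nrm : 'I_N.+1 -> V).
Hypothesis N2 : (1 < N)%N.
Hypothesis Gsym : G^T = G.
Hypothesis Gdiag : forall i, G i i = 1.
Hypothesis lam_gt0 : forall i, 0 < lam i.
Hypothesis lam_mono : {homo lam : i j / (i < j)%N >-> i < j}.
Hypothesis signs : forall i, (s i = 1 \/ s i = -1) /\ (s' i = 1 \/ s' i = -1).
Hypothesis Xqa : forall i, Xspace (qa i).
Hypothesis Xqb : forall i, Xspace (qb i).
Local Notation H := (hmatrix G lam).

(** The rows of T are the rescaled vertices c_i in homogeneous coordinates, and
    Nrm l is the linear part of the dual functional, that is, n_l seen in
    X^{n-1}. *)
Definition frame : Prop :=
  [/\ T \in unitmx,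
      forall i, hom_pt (qa i) = alpha i *: row i T /\ Num.sg (alpha i) = s i,
      forall i, hom_pt (qb i) = beta i *: row i (H *m T) /\ Num.sg (beta i) = s' i,
      forall v l, (hom_vec v *m invmx T) 0 l = bform v (Nrm l) &
      forall i j, bform (Nrm i) (Nrm j) = G i j].

Hypothesis fr : frame.

Let uT : T \in unitmx. Proof. by case: fr. Qed.
Let n3 : (2 < N.+1)%N. Proof. by []. Qed.

Definition normal (x : 'cV[R]_N.+1) : V := \sum_l x l 0 *: Nrm l.

Lemma normal_functional x v : (hom_vec v *m (invmx T *m x)) 0 0 = bform v (normal x).
Proof.
have [_ _ _ dual _] := fr; rewrite mulmxA mxE bform_sumr; apply: eq_bigr => l _.
by rewrite dual bformZr mulrC.
Qed.

Lemma normal_form x : bform (normal x) (normal x) = gram_val G x x.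
Proof.
have [_ _ _ _ gram] := fr; rewrite {1}/normal bform_suml /gram_val; apply: eq_bigr => i _.
rewrite bformZl /normal bform_sumr mxE; congr (_ * _); apply: eq_bigr => j _.
by rewrite bformZr gram mulrC.
Qed.

Lemma functional_qa (x : 'cV[R]_N.+1) i : (hom_pt (qa i) *m (invmx T *m x)) 0 0 = alpha i * x i 0.
Proof.
have [_ qaE _ _ _] := fr; rewrite (qaE i).1 -scalemxAl mxE; congr (_ * _).
by rewrite -row_mul mulKVmx// mxE.
Qed.

Lemma functional_qb (x : 'cV[R]_N.+1) i : (hom_pt (qb i) *m (invmx T *m x)) 0 0 = beta i * (H *m x) i 0.
Proof.
have [_ _ qbE _ _] := fr; rewrite (qbE i).1 -scalemxAl mxE; congr (_ * _).
by rewrite -row_mul -mulmxA mulKVmx// mxE.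
Qed.

Lemma hom_span (p : V) (w : 'rV[R]_N.+1) : exists v r, w = hom_vec (v : V) + r *: hom_pt p.
Proof.
case: X p => p; [by exists w, 0; rewrite scale0r addr0| |by exists w, 0; rewrite scale0r addr0].
pose w1 : 'rV[R]_(1 + N) := w.
exists (rsubmx w1 - (lsubmx w1 0 0) *: p), (lsubmx w1 0 0).
set u := rsubmx w1; set r := lsubmx w1 0 0.
have E0 : hom_pt p = hom_vec p + row_mx (1%:M : 'rV[R]_1) 0 :> 'rV_N.+1.
  by have E := add_row_mx (0 : 'rV[R]_1) p 1%:M 0; rewrite addr0 add0r in E; exact: esym E.
rewrite hom_vecB hom_vecZ E0 scalerDr addrA subrK.
have E1 := scale_row_mx r (1%:M : 'rV[R]_1) (0 : 'rV[R]_N).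
have E2 := add_row_mx (0 : 'rV[R]_1) u (r *: 1%:M) (r *: 0).
rewrite -E1 in E2; apply: etrans (esym E2); rewrite scaler0 addr0 add0r.
rewrite -[LHS](hsubmxK w1); congr row_mx.
by apply/rowP => j; rewrite ord1 [RHS]mxE [1%:M _ _]mxE eqxx mulr1.
Qed.

(** Points and vectors together span the homogeneous coordinates. *)
Lemma functional_eq0 (p : V) (y : 'cV[R]_N.+1) : (hom_pt p *m y) 0 0 = 0 ->
  (forall v : V, (hom_vec v *m y) 0 0 = 0) -> y = 0.
Proof.
move=> py vy; apply/colP => j; rewrite mxE.
have -> : y j 0 = ((delta_mx 0 j : 'rV[R]_N.+1) *m y) 0 0 by rewrite -rowE mxE.
have [v [r ->]] := hom_span p (delta_mx 0 j).
by rewrite mulmxDl mxE vy -scalemxAl mxE py mulr0 addr0.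
Qed.

(** The functional vanishes at a vertex, which is a point of the space. In the
    curved spaces its normal is therefore tangent to the space; in the Euclidean
    space it is enough that the normal is nonzero. *)
Lemma frame_pos (x : 'cV[R]_N.+1) : x != 0 ->
  (exists i, x i 0 = 0 \/ (H *m x) i 0 = 0) -> 0 < gram_val G x x.
Proof.
move=> x0 xi; pose y := invmx T *m x.
have [p Xp py] : exists2 p : V, Xspace p & (hom_pt p *m y) 0 0 = 0.
  case: xi => i [xi|xi]; [exists (qa i) => //|exists (qb i) => //].
    by rewrite functional_qa xi mulr0.
  by rewrite functional_qb xi mulr0.
have n0 : normal x != 0.
  apply: contra_neq x0 => nx; have : y = 0.
    apply: functional_eq0 py _ => v; by rewrite normal_functional nx bform0r.
  by move/(congr1 (mulmx T)); rewrite mulKVmx// mulmx0.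
rewrite -normal_form; have [XE|XE] := pselect (X = Euclidean).
  by apply: bform_gt0 => //; rewrite XE.
apply: (orth_pos XE Xp) => //.
by rewrite -normal_functional -(hom_pt_curved p XE).
Qed.

(** The vector o common to all P_(k). *)
Definition center : 'rV[R]_N.+1 := (\row_l (lam l)^-1) *m T.

Section Facet.
Variable k : 'I_N.+1.
Local Notation pa := (fun i : 'I_N => qa (lift k i)).
Local Notation pb := (fun i : 'I_N => qb (lift k i)).
Variable J : {set 'I_N}.
Let JJ := (lift k @: J)%SET.
Let kJ : k \notin JJ.
Proof. by apply/imsetP => -[i _ E]; have := neq_lift k i; rewrite -E eqxx. Qed.
Let x := facet_covector G lam JJ k.
Let rho := lam k * center_val lam x.

Let rho0 : rho != 0.
Proof.
rewrite mulf_neq0//; first by rewrite gt_eqF.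
by rewrite (facet_center_neq0 Gsym Gdiag lam_gt0 lam_mono n3 frame_pos).
Qed.

(** Divided by rho, the functional has a unit linear part and the value
    1 / lambda_k at o. *)
Definition facet_functional : 'cV[R]_N.+1 := rho^-1 *: (invmx T *m x).
Definition facet_nu : V := rho^-1 *: normal x.

Lemma facet_nu_functional v : (hom_vec v *m facet_functional) 0 0 = bform v facet_nu.
Proof. by rewrite -scalemxAr mxE normal_functional bformZr. Qed.

Lemma facet_nu_unit : bform facet_nu facet_nu = 1.
Proof.
rewrite bformZl bformZr normal_form.
rewrite (facet_center_sqr Gsym Gdiag lam_gt0 lam_mono n3 frame_pos kJ) -/rho.
by move: rho rho0 => r r0; field.
Qed.

Lemma facet_functional_center : (center *m facet_functional) 0 0 = (lam k)^-1.
Proof.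
rewrite -scalemxAr mxE /center -mulmxA mulKVmx// mxE.
have -> : \sum_j (\row_l (lam l)^-1) 0 j * x j 0 = center_val lam x.
  by apply: eq_bigr => l _; rewrite mxE mulrC.
rewrite /rho; field; move: rho0; rewrite /rho mulf_eq0 negb_or => /andP[-> ->] //.
Qed.

Let d (i : 'I_N) : R := if i \in J then beta (lift k i) else alpha (lift k i).

Lemma facet_row i : row i (hom_mx (facet pa pb J)) =
  d i *: (row (lift k i) (pivot_mx G lam JJ) *m T).
Proof.
have [_ qaE qbE _ _] := fr; rewrite rowK /facet /d.
have iJ : (lift k i \in JJ) = (i \in J) by rewrite mem_imset//; exact: lift_inj.
case: ifP => iJ'; [rewrite (qbE _).1|rewrite (qaE _).1]; congr (_ *: _).
  rewrite row_mul; congr (_ *m _); apply/rowP => j; by rewrite !mxE iJ iJ'.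
rewrite [row _ T]rowE; congr (_ *m _); apply/rowP => j; by rewrite !mxE iJ iJ' eqxx/= eq_sym.
Qed.

Lemma facet_functional_vertex : hom_mx (facet pa pb J) *m facet_functional = 0.
Proof.
apply/row_matrixP => i; rewrite row_mul facet_row row0 /facet_functional.
rewrite -scalemxAl -scalemxAr -mulmxA mulKVmx//; apply/matrixP => i1 j1.
rewrite !ord1 -row_mul !mxE.
have := pivot_mxE G lam JJ x (lift k i); rewrite mxE => ->.
have := facet_covectorP Gsym Gdiag lam_gt0 lam_mono n3 frame_pos JJ k (lift k i).
by rewrite -/x => ->; rewrite eq_sym (negPf (neq_lift _ _)) !mulr0.
Qed.

(** In the basis c the matrix is, up to the scaling of the vertices and the
    permutation that puts row k first, the pivot matrix with row k replaced by
    the coordinates of o. *)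
Lemma facet_det : \det (col_mx center (hom_mx (facet pa pb J)) : 'M[R]_N.+1) =
  \prod_i d i * ((-1) ^+ odd_perm (lift_perm ord0 k (1%g : {perm 'I_N})) *
   (\det (pivot_mx G lam JJ) * center_val lam x)) * \det T.
Proof.
pose B := \matrix_(i < N) row (lift k i) (pivot_mx G lam JJ).
rewrite (@det_col_mx_proj _ _ _ _ (B *m T) d (fun=> 0)); last first.
  by move=> i; rewrite facet_row scale0r addr0 row_mul rowK.
rewrite -mulrA; congr (_ * _).
rewrite /center -mul_col_mx det_mulmx; congr (_ * _).
pose Z := \matrix_i (if i == k then \row_l (lam l)^-1 else row i (pivot_mx G lam JJ)).
have -> : col_mx (\row_l (lam l)^-1) B = row_perm (lift_perm ord0 k 1%g) Z :> 'M[R]_(1 + N).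
  apply/matrixP => i j; rewrite [RHS]mxE.
  case: (unliftP (ord0 : 'I_(1 + N)) i) => [i1|] ->.
    rewrite lift_perm_lift perm1 [RHS]mxE eq_sym (negPf (neq_lift _ _)).
    have -> : lift ord0 i1 = rshift 1 i1 by apply: val_inj.
    by rewrite col_mxEd mxE.
  rewrite lift_perm_id [RHS]mxE eqxx.
  have -> : (ord0 : 'I_(1 + N)) = lshift N 0 by apply: val_inj.
  by rewrite col_mxEu.
rewrite row_permE det_mulmx det_perm; congr (_ * _).
rewrite /Z det_row_replace; last first.
  exact: (pivot_unit Gsym Gdiag lam_gt0 lam_mono n3 frame_pos).
congr (_ * _).
transitivity ((\row_l (lam l)^-1 *m x) 0 0).
  by rewrite /x /facet_covector mulmxA -colE [RHS]mxE.
by rewrite mxE; apply: eq_bigr => l _; rewrite mxE mulrC.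
Qed.

Lemma facet_vertices_free : row_free (hom_mx (facet pa pb J)).
Proof.
set B := hom_mx _; set M : 'M[R]_(1 + N) := col_mx center B.
have uM : M \in unitmx.
  rewrite unitmxE unitfE /M facet_det; have [_ qaE qbE _ _] := fr.
  have dn0 i : d i != 0.
    have [ss ss'] := signs (lift k i); rewrite -sgr_eq0 /d; case: ifP => _.
      by rewrite (qbE _).2; case: ss' => ->; rewrite ?oppr_eq0 oner_eq0.
    by rewrite (qaE _).2; case: ss => ->; rewrite ?oppr_eq0 oner_eq0.
  rewrite !mulf_neq0 ?signr_eq0//.
  - by apply/prodf_neq0 => i _; exact: dn0.
  - by rewrite gt_eqF// (pivot_det_gt0 Gsym Gdiag lam_gt0 lam_mono n3 frame_pos).
  - exact: (facet_center_neq0 Gsym Gdiag lam_gt0 lam_mono n3 frame_pos).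
  - by rewrite -unitfE -unitmxE.
apply/row_freeP; exists (invmx M *m col_mx 0 1%:M).
have -> : B = dsubmx M by rewrite col_mxKd.
by rewrite mul_dsub_mx mulmxA mulmxV// mul1mx col_mxKd.
Qed.

Lemma facet_span : span_plane (facet pa pb J) =
  [set p | Xspace p /\ (hom_pt p *m facet_functional) 0 0 = 0].
Proof.
have f0 : facet_functional != 0.
  have := facet_functional_center; apply: contra_eq_neq => ->.
  by rewrite mulmx0 mxE eq_sym invr_eq0 gt_eqF.
have E p := row_free_ker (hom_pt p) facet_vertices_free f0 facet_functional_vertex.
apply/seteqP; split=> p [Xp]; first by rewrite E => /eqP p0; split=> //; rewrite p0 mxE.
by move=> pf; split=> //; rewrite E; apply/eqP/matrixP => i j; rewrite !ord1 pf mxE.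
Qed.

Definition base_sign : R := Num.sg (\det T) *
  (-1) ^+ odd_perm (lift_perm ord0 k (1%g : {perm 'I_N})) * \prod_i s (lift k i).

(** The sign for j < k comes from the value of the functional at o, the signs s_i,
    s_i' from the scaling of the vertices; all the rest is independent of J. *)
Lemma facet_sign : (-1) ^+ #|J| *
    Num.sg (\det (col_mx center (hom_mx (facet pa pb J)) : 'M[R]_N.+1)) =
  base_sign * (-1) ^+ (@odd_class R N.+1 s s' k J).
Proof.
have [_ qaE qbE _ _] := fr.
have sq (u : R) : u = 1 \/ u = -1 -> u * u = 1.
  by case=> ->; rewrite ?mulr1 ?mulrNN ?mulr1.
have sg_prod : Num.sg (\prod_i d i) =
    (\prod_i s (lift k i)) * \prod_(i in J) (s (lift k i) * s' (lift k i)).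
  rewrite (big_morph _ (@sgrM R) (sgr1 R)) [X in _ * X]big_mkcond -big_split/=.
  apply: eq_bigr => i _; rewrite /d; case: ifP => _; last by rewrite (qaE _).2 mulr1.
  by rewrite (qbE _).2 mulrA sq ?mul1r//; have [] := signs (lift k i).
have cv := facet_center_sign Gsym Gdiag lam_gt0 lam_mono n3 frame_pos kJ.
rewrite facet_det !sgrM sg_prod sgrX sgrN1 (gtr0_sg (pivot_det_gt0 Gsym Gdiag lam_gt0 lam_mono n3 frame_pos _)).
have -> : Num.sg (center_val lam x) = (-1) ^+ #|[set j in JJ | (j < k)%N]%SET|.
  have := gtr0_sg cv; rewrite sgrM sgrX sgrN1 => E.
  move: E; set S := _ ^+ _ => E; have S0 : S != 0 by rewrite signr_eq0.
  by apply: (mulIf S0); rewrite E -expr2 sqrr_sign.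
have ss i : s i * s' i = 1 \/ s i * s' i = -1.
  by have [[]->] := signs i; case=> ->; rewrite ?mulr1 ?mulrN1 ?opprK; [left|right|right|left].
have O := odd_class_sign k J ss.
have ac (p q r t u v : R) : p * (q * t * (r * (1 * u)) * v) = v * r * q * (p * u * t) by ring.
by rewrite ac /base_sign; congr (_ * _); exact: O.
Qed.

End Facet.

Lemma base_sign_bool k : base_sign k = (-1) ^+ (base_sign k < 0)%R.
Proof.
rewrite -sgr_sign; last first.
  rewrite /base_sign !mulf_neq0 ?signr_eq0 ?sgr_eq0//; first by rewrite -unitfE -unitmxE.
  by apply/prodf_neq0 => i _; have [[]-> _] := signs (lift k i); rewrite ?oppr_eq0 oner_eq0.
rewrite /base_sign !sgrM sgr_id sgrX sgrN1; congr (_ * _).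
rewrite (big_morph _ (@sgrM R) (sgr1 R)); apply: eq_bigr => i _.
by have [[]-> _] := signs (lift k i); rewrite ?sgrN1 ?sgr1.
Qed.

Lemma frame_curved_facets (o : V) k : X <> Euclidean -> hom_vec o = center ->
  curved_facets (fun i => qa (lift k i)) (fun i => qb (lift k i))
    (@odd_class R N.+1 s s' k) o (lam k)^-1 (facet_nu k) (base_sign k < 0).
Proof.
move=> XE oE; split.
- by rewrite invr_eq0 gt_eqF.
- move=> J; rewrite facet_span; apply/seteqP; split=> p [Xp p0]; split=> //.
    by rewrite -facet_nu_functional -(hom_pt_curved p XE).
  by rewrite (hom_pt_curved p XE) facet_nu_functional.
- exact: facet_nu_unit.
- by move=> J; rewrite bformC -facet_nu_functional oE facet_functional_center.
- by move=> J; rewrite oE facet_sign base_sign_bool -signr_addb -base_sign_bool.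
Qed.

End Frame.

(** * The flat position in the chart *)

Section HomSums.
Variables (R : realType) (X : geometry) (N : nat).
Local Notation V := (vect R X N).

Lemma hom_vec_sum (I : finType) (c : I -> R) (p : I -> V) :
  hom_vec (\sum_i c i *: p i) = \sum_i c i *: hom_vec (p i).
Proof.
have h0 : hom_vec (0 : V) = 0 by rewrite -(scale0r (0 : V)) hom_vecZ scale0r.
rewrite (big_morph _ (@hom_vecD R X N) h0).
by apply: eq_bigr => i _; rewrite hom_vecZ.
Qed.

Lemma hom_pt_sum (I : finType) (c : I -> R) (p : I -> V) : \sum_i c i = 1 ->
  hom_pt (\sum_i c i *: p i) = \sum_i c i *: hom_pt (p i).
Proof.
move=> c1; have hE (x : V) : hom_pt x = hom_pt (0 : V) + hom_vec x by rewrite -hom_ptD add0r.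
rewrite hE hom_vec_sum; under [RHS]eq_bigr do rewrite hE scalerDr.
by rewrite big_split/= -scaler_suml c1 scale1r.
Qed.

End HomSums.

Section CurvedFrame.
Variables (R : realType) (X : geometry) (N : nat).
Hypothesis XE : X <> Euclidean.
Variables (G : 'M[R]_N.+1) (lam s s' : 'I_N.+1 -> R).
Variables (nn : 'I_N.+1 -> vect R X N.+1) (m : vect R X N.+1)
  (a : 'I_N.+1 -> vect R X N.+1) (b : option R -> 'I_N.+1 -> vect R X N.+1)
  (M : 'M[R]_(vdim X N, vdim X N.+1)) (qa qb : 'I_N.+1 -> vect R X N).
Hypothesis signs : forall i, (s i = 1 \/ s i = -1) /\ (s' i = 1 \/ s' i = -1).
Hypothesis gram : forall i j, bform (nn i) (nn j) = G i j.
Hypothesis verts : curved_vertices G lam s s' nn m a b.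
Hypothesis isom : forall x y : vect R X N, bform (x *m M) (y *m M) = bform x y.
Hypothesis qaM : forall i, qa i *m M = a i.
Hypothesis qbM : forall i, qb i *m M = b (Some 0) i.

Let sgn_div (u v : R) : u = 1 \/ u = -1 -> 0 < v -> Num.sg (u / v) = u.
Proof. by move=> uE v0; rewrite sgrM sgrV (gtr0_sg v0) mulr1; case: uE => ->; rewrite ?sgrN1 ?sgr1. Qed.

Let vnorm_gt0 n (u : R) (w x : vect R X n) : x = (u / vnorm w) *: w -> Xspace x -> 0 < vnorm w.
Proof.
move=> xE /(Xspace_form XE) xx; rewrite lt_def sqrtr_ge0 andbT.
apply: contraTneq (oner_neq0 R) => w0; rewrite negbK.
have := curv_sqr R X; rewrite -xx xE w0 invr0 mulr0 scale0r bform0l mul0r => <-.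
by rewrite eqxx.
Qed.

(** The vectors c_i are the images of the rescaled points qa_i, and
    n_l = sum_j g_lj c_j, because the matrix expressing c in terms of n is inverse
    to G. So everything can be pulled back through the isometric chart. *)
Lemma curved_frame : exists T alpha beta Nrm, frame G lam s s' qa qb T alpha beta Nrm.
Proof.
have [c [cP _ aE bE Xab]] := verts.
pose d u i : vect R X N.+1 := \sum_j hcoef G lam i j *: c j
  - ncoef (lam i) u *: nn i + mcoef (lam i) u *: m.
have {}bE u i : b u i = (s' i / vnorm (d u i)) *: d u i := bE u i.
have [K KE] := choice (fun i => submxP (cP i).1).
pose NN := \matrix_(j < N.+1) nn j; pose KK : 'M[R]_N.+1 := \matrix_i K i.
have KG : KK *m G = 1%:M.
  apply/matrixP => i j; rewrite [RHS]mxE -(cP i).2 KE mulmx_sum_row bform_suml mxE.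
  by apply: eq_bigr => l _; rewrite rowK bformZl gram mxE.
have GK := mulmx1C KG.
have nnE l : nn l = \sum_j G l j *: c j.
  have -> : nn l = row l (G *m KK *m NN) by rewrite GK mul1mx rowK.
  rewrite -mulmxA row_mul mulmx_sum_row; apply: eq_bigr => j _.
  by rewrite [row l G 0 j]mxE row_mul rowK -KE.
pose alpha i := s i / vnorm (c i); pose beta i := s' i / vnorm (d (Some 0) i).
have sa i : Num.sg (alpha i) = s i.
  by apply: sgn_div; [have [] := signs i|exact: vnorm_gt0 (aE i) (Xab (Some 0) i).1].
have sb i : Num.sg (beta i) = s' i.
  by apply: sgn_div; [have [] := signs i|exact: vnorm_gt0 (bE _ i) (Xab (Some 0) i).2].
have a0 i : alpha i != 0.
  by rewrite -sgr_eq0 sa; have [[]-> _] := signs i; rewrite ?oppr_eq0 oner_eq0.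
pose C i : vect R X N := (alpha i)^-1 *: qa i.
have CM i : C i *m M = c i.
  by rewrite /C -scalemxAl qaM aE scalerA mulVf// scale1r.
pose Nrm l : vect R X N := \sum_j G l j *: C j.
have NM l : Nrm l *m M = nn l.
  rewrite nnE /Nrm mulmx_suml; apply: eq_bigr => j _.
  by rewrite -scalemxAl CM.
have CN i l : bform (C i) (Nrm l) = (i == l)%:R by rewrite -isom CM NM (cP i).2.
have [xi xiE] := choice (fun l => hom_form XE (Nrm l)).
pose D : 'M[R]_N.+1 := \matrix_(p, l) xi l p 0.
pose T : 'M[R]_N.+1 := \matrix_i hom_vec (C i).
have DE (v : vect R X N) l : (hom_vec v *m D) 0 l = bform v (Nrm l).
  by rewrite -xiE (hom_pt_curved v XE) !mxE; apply: eq_bigr => p _; rewrite mxE.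
have TD : T *m D = 1%:M.
  by apply/row_matrixP => i; apply/rowP => l; rewrite row_mul rowK DE CN !mxE.
have uT : T \in unitmx by have [] := mulmx1_unit TD.
have TE : invmx T = D by rewrite -[D]mul1mx -(mulVmx uT) -mulmxA TD mulmx1.
exists T, alpha, beta, Nrm; split => //.
- move=> i; split=> //.
  by rewrite rowK /C hom_vecZ scalerA divff// scale1r (hom_pt_curved _ XE).
- move=> i; split=> //; rewrite (hom_pt_curved _ XE).
  have -> : qb i = beta i *: \sum_j hcoef G lam i j *: C j.
    apply/eqP; rewrite -subr_eq0; apply/eqP; apply: bform_nondeg => y.
    rewrite -isom mulmxBl qbM (_ : b (Some 0) i = beta i *: d (Some 0) i)// -scalemxAl mulmx_suml.
    have -> : d (Some 0) i = \sum_j (hcoef G lam i j *: C j) *m M.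
      rewrite /d /ncoef /mcoef !mulr0 expr0n/= !mulr0 !mul0r !scale0r subr0 addr0.
      by apply: eq_bigr => j _; rewrite -scalemxAl CM.
    by rewrite subrr bform0l.
  rewrite hom_vecZ hom_vec_sum row_mul mulmx_sum_row; congr (_ *: _).
  by apply: eq_bigr => j _; rewrite rowK [row i _ 0 j]mxE mxE.
- by move=> v l; rewrite TE DE.
- by move=> i j; rewrite -isom !NM gram.
Qed.

End CurvedFrame.

Section EuclideanForm.
Variables (R : realType) (N : nat).
Local Notation V := (vect R Euclidean N).
Local Notation bform := (@bform R Euclidean N).

Lemma bform_mul (x y : V) : bform x y = (x *m y^T) 0 0.
Proof. by rewrite mxE; apply: eq_bigr => j _; rewrite mxE /bsign mul1r. Qed.

Lemma hom_pt_euclid (x : V) : hom_pt x = row_mx (1%:M : 'rV[R]_1) x. Proof. by []. Qed.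

(** Used with linear part n_i and a point of the facet opposite to a_i. *)
Lemma affine_functional (w p : V) : exists xi : 'cV[R]_N.+1,
  (forall v : V, (hom_vec v *m xi) 0 0 = bform v w) /\
  forall x : V, (hom_pt x *m xi) 0 0 = bform (x - p) w.
Proof.
pose xi : 'cV[R]_(1 + N) := col_mx (- bform p w)%:M w^T.
have vE (v : V) : (hom_vec v *m xi) 0 0 = bform v w.
  by rewrite /hom_vec (mul_row_col (0 : 'M[R]_1)) mul0mx add0r bform_mul.
exists xi; split=> // x; have -> : x = p + (x - p) by rewrite addrC subrK.
rewrite hom_ptD mulmxDl mxE vE addrAC subrr add0r.
rewrite hom_pt_euclid (mul_row_col (1%:M : 'M[R]_1)) mul1mx mxE -bform_mul.
by rewrite mxE eqxx mulr1n addNr add0r.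
Qed.

End EuclideanForm.

Section EuclideanFrame.
Variables (R : realType) (N : nat).
Local Notation V := (vect R Euclidean N).
Local Notation W := (vect R Euclidean N.+1).
Hypothesis N2 : (1 < N)%N.
Variables (G : 'M[R]_N.+1) (lam s s' : 'I_N.+1 -> R).
Variables (nn : 'I_N.+1 -> W) (m : W) (a : 'I_N.+1 -> W) (b : option R -> 'I_N.+1 -> W)
  (M : 'M[R]_(N, N.+1)) (t : W) (qa qb : 'I_N.+1 -> V).
Hypothesis Gdiag : forall i, G i i = 1.
Hypothesis signs : forall i, (s i = 1 \/ s i = -1) /\ (s' i = 1 \/ s' i = -1).
Hypothesis gram : forall i j, bform (nn i) (nn j) = G i j.
Hypothesis mn : forall i, bform m (nn i) = 0.
Hypothesis mm : bform m m = 1.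
Hypothesis verts : euclidean_vertices G lam s s' nn m a b.
Hypothesis isom : forall x y : V, @bform R Euclidean N.+1 (x *m M) (y *m M) = bform x y.
Hypothesis chartm : forall (x : V) i, @bform R Euclidean N.+1 (x *m M + t - a i) m = 0.
Hypothesis qaM : forall i, qa i *m M + t = a i.
Hypothesis qbM : forall i, qb i *m M + t = b (Some 0) i.
Local Notation bV := (@bform R Euclidean N).
Local Notation bW := (@bform R Euclidean N.+1).

Let j0 : 'I_N := Ordinal (ltnW N2).

Lemma chart_orth : M *m M^T = 1%:M.
Proof.
apply/matrixP => i j; have := isom (delta_mx 0 i) (delta_mx 0 j).
rewrite !bform_mul trmx_delta mul_delta_mx_cond -!rowE => E.
transitivity ((row i M *m (row j M)^T) 0 0).
  by rewrite !mxE; apply: eq_bigr => l _; rewrite !mxE.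
by rewrite E mulmxnE !mxE.
Qed.

Lemma chart_normal : M *m m^T = 0.
Proof.
apply/row_matrixP => i; rewrite row_mul row0; apply/matrixP => p q; rewrite !ord1 [RHS]mxE -bform_mul.
have := chartm (delta_mx 0 i) ord0; have := chartm 0 ord0.
by rewrite mul0mx add0r -rowE !bformBl bformDl => h1 h2; lra.
Qed.

(** The rows of M and m form an orthonormal basis. *)
Lemma chart_complete (z : W) : bform z m = 0 -> z *m M^T *m M = z.
Proof.
move=> zm; pose Q : 'M[R]_(1 + N, N.+1) := col_mx m M.
have mm1 : m *m m^T = 1%:M.
  by apply/matrixP => p q; rewrite !ord1 -bform_mul mm mxE eqxx.
have mM : m *m M^T = 0 by rewrite -[LHS]trmxK trmx_mul trmxK chart_normal trmx0.
have QQ : Q *m Q^T = 1%:M.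
  rewrite tr_col_mx mul_col_row mm1 mM chart_normal chart_orth.
  by rewrite -scalar_mx_block.
have := mulmx1C QQ; rewrite tr_col_mx mul_row_col => /(congr1 (mulmx z)).
rewrite mulmx1 mulmxDr !mulmxA => {2}<-; rewrite (_ : z *m m^T = 0) ?mul0mx ?add0r//.
by apply/matrixP => p q; rewrite !ord1 -bform_mul zm mxE.
Qed.

(** As n_l is orthogonal to m, the adjoint of the chart recovers its preimage. *)
Definition chart_nrm (l : 'I_N.+1) : V := nn l *m M^T.

Lemma chart_nrmE l : chart_nrm l *m M = nn l.
Proof. by rewrite chart_complete// bformC mn. Qed.

Lemma chart_nrm_form (v : V) l : bform v (chart_nrm l) = bW (v *m M) (nn l).
Proof. by rewrite !bform_mul /chart_nrm trmx_mul trmxK mulmxA. Qed.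

Lemma chart_inj (x y : V) : x *m M = y *m M -> x = y.
Proof. by move/(congr1 (mulmx^~ M^T)); rewrite -!mulmxA chart_orth !mulmx1. Qed.

Lemma chart_diff i j : (qa i - qa j) *m M = a i - a j.
Proof. by rewrite mulmxBl -!qaM opprD addrACA subrr addr0. Qed.

(** The signed altitude from a_i; any other vertex may be taken for the base point,
    see [altitudeE]. *)
Definition altitude i : R := bW (a i - a (lift i j0)) (nn i).

Lemma altitudeE i j : j != i -> bV (qa i - qa j) (chart_nrm i) = altitude i.
Proof.
have [_ orth _ _ _] := verts; move=> ji.
rewrite chart_nrm_form chart_diff /altitude.
have -> : a i - a j = (a i - a (lift i j0)) - (a j - a (lift i j0)).
  by rewrite opprB addrA subrK.
by rewrite bformBl (orth i j (lift i j0)) ?subr0// eq_sym neq_lift.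
Qed.

Lemma altitude_opp i j l : j != i -> l != i -> bV (qa j - qa l) (chart_nrm i) = 0.
Proof. by have [_ orth _ _ _] := verts; move=> ji li; rewrite chart_nrm_form chart_diff orth. Qed.

Lemma altitude_sign i : 0 < s i * altitude i.
Proof. by have [_ _ pos _ _] := verts; apply: pos; rewrite eq_sym neq_lift. Qed.

Lemma altitude_neq0 i : altitude i != 0.
Proof. by have := altitude_sign i; apply: contraTneq => ->; rewrite mulr0 ltxx. Qed.

Definition frame_mx : 'M[R]_N.+1 := \matrix_i ((altitude i)^-1 *: hom_pt (qa i)).

Lemma hom_chart (x : V) : @hom_pt R Euclidean N.+1 (x *m M + t) =
  hom_pt x *m (block_mx 1%:M t 0 M : 'M[R]_(1 + N, 1 + N.+1)).
Proof.
rewrite !hom_pt_euclid (mul_row_block (1%:M : 'M[R]_1)) mulmx1 mulmx0 addr0 mul1mx.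
by rewrite addrC.
Qed.

Lemma frame_mx_unit : frame_mx \in unitmx.
Proof.
have [[indep _] _ _ _ _] := verts.
have -> : frame_mx = diag_mx (\row_i (altitude i)^-1) *m hom_mx qa.
  by apply/matrixP => i j; rewrite mul_diag_mx !mxE.
rewrite unitmx_mul; apply/andP; split.
  rewrite unitmxE det_diag unitfE; apply/prodf_neq0 => i _.
  by rewrite mxE invr_eq0 altitude_neq0.
rewrite -row_free_unit /row_free eqn_leq rank_leq_row /=.
have := indep; rewrite /independent.
have -> : hom_mx a = hom_mx qa *m (block_mx 1%:M t 0 M : 'M[R]_(1 + N, 1 + N.+1)).
  by apply/row_matrixP => i; rewrite row_mul !rowK -qaM hom_chart.
by rewrite -row_leq_rank => /leq_trans; apply; exact: mxrankM_maxl.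
Qed.

(** Coordinates with respect to the rescaled vertices are the values of the affine
    functionals with linear part n_i vanishing on the opposite facet. *)
Lemma frame_mx_dual (w : 'rV[R]_N.+1) (xi : 'cV[R]_N.+1) (i : 'I_N.+1) :
  (forall x : V, (hom_pt x *m xi) 0 0 = bV (x - qa (lift i j0)) (chart_nrm i)) ->
  (w *m invmx frame_mx) 0 i = (w *m xi) 0 0.
Proof.
move=> xiE; have E : frame_mx *m xi = delta_mx i 0.
  apply/matrixP => l p; rewrite ord1.
  transitivity (((altitude l)^-1 *: hom_pt (qa l) *m xi) 0 0).
    by rewrite -(rowK (fun l => (altitude l)^-1 *: hom_pt (qa l)) l) -row_mul [RHS]mxE.
  rewrite -scalemxAl mxE xiE mxE eqxx andbT.
  have [->|li] := eqVneq l i.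
    by rewrite altitudeE 1?eq_sym ?neq_lift// mulVf// altitude_neq0.
  by rewrite altitude_opp ?mulr0// eq_sym neq_lift.
have -> : xi = invmx frame_mx *m delta_mx i 0 by rewrite -E mulKmx// frame_mx_unit.
by rewrite mulmxA -colE [RHS]mxE.
Qed.

Lemma frame_mx_vec (v : V) i :
  (hom_vec v *m invmx frame_mx) 0 i = bform v (chart_nrm i).
Proof.
have [xi [vE pE]] := affine_functional (chart_nrm i) (qa (lift i j0)).
by rewrite (frame_mx_dual _ pE) vE.
Qed.

(** The foot a_i - A n_i of the altitude A lies in the plane of the opposite facet,
    since its i-th barycentric coordinate vanishes. *)
Lemma altitude_dist i :
  s i * dist_to (a i) (span_plane (fun j => a (lift i j))) = altitude i.
Proof.
have gi : bform (nn i) (nn i) = 1 by rewrite gram.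
have ss : s i * s i = 1 by have [[]-> _] := signs i; rewrite ?mulrNN mulr1.
suff -> : dist_to (a i) (span_plane (fun j => a (lift i j))) = `|altitude i|.
  have -> : `|altitude i| = s i * altitude i.
    rewrite -[RHS]ger0_norm; last exact: ltW (altitude_sign i).
    by rewrite normrM; have [[]-> _] := signs i; rewrite ?normrN normr1 mul1r.
  by rewrite mulrA ss mul1r.
have [xi [vE pE]] := affine_functional (nn i) (a (lift i j0)).
apply: inf_attained; last first.
  move=> _ [y [_ /submxP[u yu]] <-]; rewrite /dist -sqrtr_sqr ler_wsqrtr//.
  have ya : bform (y - a (lift i j0)) (nn i) = 0.
    rewrite -pE yu -mulmxA.
    have -> : hom_mx (fun j : 'I_N => a (lift i j)) *m xi = 0; last by rewrite mulmx0 mxE.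
    apply/row_matrixP => j; rewrite row_mul rowK row0; apply/matrixP => p q.
    rewrite !ord1 pE mxE; have [_ orth _ _ _] := verts.
    by apply: orth; rewrite eq_sym neq_lift.
  have za : bform (a i - y) (nn i) = altitude i.
    rewrite /altitude; have -> : a i - a (lift i j0) = (a i - y) + (y - a (lift i j0)).
      by rewrite addrA subrK.
    by rewrite [RHS]bformDl ya addr0.
  have : 0 <= bW (a i - y - altitude i *: nn i) (a i - y - altitude i *: nn i).
    exact: bform_ge0.
  rewrite [X in 0 <= X]bformBl [bW (a i - y) _]bformBr [bW (altitude i *: nn i) _]bformBr.
  by rewrite !bformZl !bformZr gi za (bformC (nn i)) za; lra.
pose q : V := qa i - altitude i *: chart_nrm i.
have qE : q *m M + t = a i - altitude i *: nn i.
  by rewrite /q mulmxBl -scalemxAl chart_nrmE addrAC qaM.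
exists (a i - altitude i *: nn i); last first.
  rewrite /dist opprB addrC subrK [bform _ _]bformZl bformZr gi mulr1.
  by rewrite -expr2 sqrtr_sqr.
split=> //; rewrite -qE hom_chart.
have [xi' [_ pE']] := affine_functional (chart_nrm i) (qa (lift i j0)).
pose z := hom_pt q *m invmx frame_mx.
have zi : z 0 i = 0.
  rewrite (frame_mx_dual _ pE') pE' /q addrAC [bform _ _]bformBl bformZl.
  rewrite altitudeE 1?eq_sym ?neq_lift//.
  by rewrite chart_nrm_form chart_nrmE gi mulr1 subrr.
have -> : hom_pt q = z *m frame_mx by rewrite mulmxKV// frame_mx_unit.
rewrite -mulmxA mulmx_sum_row; apply: summx_sub => l _.
have [->|li] := eqVneq l i; first by rewrite zi scale0r sub0mx.
apply: scalemx_sub; rewrite row_mul rowK -scalemxAl -hom_chart qaM.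
apply: scalemx_sub; have [j ->|E] := unliftP i l; last by rewrite E eqxx in li.
have -> : hom_pt (a (lift i j)) = row j (hom_mx (fun j : 'I_N => a (lift i j))) by rewrite rowK.
exact: row_sub.
Qed.

Lemma euclidean_frame : exists alpha beta,
  @frame R Euclidean N G lam s s' qa qb frame_mx alpha beta chart_nrm.
Proof.
have [_ _ _ bin bE] := verts.
pose binv i := \sum_j hcoef G lam i j / altitude j.
have alt_sum i : \sum_j hcoef G lam i j /
    (s j * dist_to (a j) (span_plane (fun l => a (lift j l)))) = binv i.
  by apply: eq_bigr => j _; rewrite altitude_dist.
have b0 i : binv i != 0 by have [] := bin i; rewrite alt_sum.
exists altitude, (fun i => (binv i)^-1); split.
- exact: frame_mx_unit.
- move=> i; rewrite rowK scalerA divff ?altitude_neq0// scale1r; split=> //.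
  have := gtr0_sg (altitude_sign i); rewrite sgrM; have [[]-> _] := signs i.
    by rewrite sgr1 mul1r.
  by rewrite sgrN1 mulN1r => <-; rewrite opprK.
- move=> i; split; last by have [_ ->] := bin i; rewrite alt_sum.
  have c1 : \sum_j (binv i)^-1 * (hcoef G lam i j / altitude j) = 1.
    by rewrite -mulr_sumr mulVf.
  have -> : qb i = \sum_j ((binv i)^-1 * (hcoef G lam i j / altitude j)) *: qa j.
    apply: chart_inj; apply: (addIr t); rewrite qbM bE alt_sum.
    rewrite /ncoef /mcoef !mulr0 expr0n/= !mulr0 !mul0r !scale0r subr0 addr0.
    rewrite mulmx_suml -[t in RHS]scale1r -c1 scaler_suml -big_split/= scaler_sumr.
    apply: eq_bigr => j _; rewrite altitude_dist -qaM scalerA -scalemxAl.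
    by rewrite scalerDr.
  rewrite hom_pt_sum// row_mul mulmx_sum_row scaler_sumr; apply: eq_bigr => j _.
  by rewrite rowK [row i _ 0 j]mxE mxE !scalerA mulrA.
- exact: frame_mx_vec.
- by move=> i j; rewrite chart_nrm_form chart_nrmE gram.
Qed.

End EuclideanFrame.

(** * The alternatives for o *)

Section Conclusions.
Variables (R : realType) (N : nat).
Hypothesis N2 : (1 < N)%N.
Variables (G : 'M[R]_N.+1) (lam s s' : 'I_N.+1 -> R).
Hypothesis Gsym : G^T = G.
Hypothesis Gdiag : forall i, G i i = 1.
Hypothesis lam_gt0 : forall i, 0 < lam i.
Hypothesis lam_mono : {homo lam : i j / (i < j)%N >-> i < j}.
Hypothesis signs : forall i, (s i = 1 \/ s i = -1) /\ (s' i = 1 \/ s' i = -1).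
Variables (T : 'M[R]_N.+1) (alpha beta : 'I_N.+1 -> R).
Local Notation cls := (@odd_class R N.+1 s s').

Local Notation vertices q k := (fun i : 'I_N => q (lift (k : 'I_N.+1) i)).

(** On the sphere o can always be normalised to a point. *)
Lemma spherical_conclusion (qa qb Nrm : 'I_N.+1 -> vect R Spherical N) :
  frame G lam s s' qa qb T alpha beta Nrm ->
  (forall i, Xspace (qa i)) -> (forall i, Xspace (qb i)) ->
  (forall k, full_dimensional (vertices qa k) (vertices qb k)) ->
  exists2 o : vect R Spherical N, Xspace o &
    forall k, exists r : R,
        [/\ sphere_radius Spherical r, ~ great_radius Spherical r,
            circumscribed (vertices qa k) (vertices qb k) (sphere o r) &
            surface_decomposition (vertices qa k) (vertices qb k) (sphere o r) (cls k)].
Proof.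
move=> fr Xa Xb full; pose o : vect R Spherical N := center lam T.
have SE : Spherical <> Euclidean by [].
have oE : hom_vec o = center lam T by [].
have cf k := frame_curved_facets N2 Gsym Gdiag lam_gt0 lam_mono signs Xa Xb fr k SE oE.
have o0 : o != 0.
  have [c0 _ _ no _] := cf ord0.
  by apply: contra_neq c0 => o0; rewrite -(no finset.set0) o0 bform0r.
have oo : 0 < @bform R Spherical N o o by exact: bform_gt0.
have r0 : (Num.sqrt (@bform R Spherical N o o))^-1 != 0.
  by rewrite invr_eq0 gt_eqF// sqrtr_gt0.
set r := _^-1 in r0.
have Xo : @Xspace R Spherical N (r *: o).
  rewrite /Xspace/= !bformE /r mulrA -invfM -expr2 sqr_sqrtr ?ltW// mulVf//.
  by rewrite gt_eqF.
exists (r *: o) => // k.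
exact: (spherical_case N2 (fun i => Xa _) (fun i => Xb _) (full k) Xo
  (curved_facets_scale r0 (cf k))).
Qed.

(** The sign of <o, o> separates spheres, orispheres and the hyperplane H; in the
    last case c ^ 2 is compared with <o, o>. *)
Lemma lobachevsky_conclusion (qa qb Nrm : 'I_N.+1 -> vect R Lobachevsky N) :
  frame G lam s s' qa qb T alpha beta Nrm ->
  (forall i, Xspace (qa i)) -> (forall i, Xspace (qb i)) ->
  (forall k, full_dimensional (vertices qa k) (vertices qb k)) ->
  ((exists2 o : vect R Lobachevsky N, Xspace o &
    forall k, exists r : R,
        [/\ sphere_radius Lobachevsky r, ~ great_radius Lobachevsky r,
            circumscribed (vertices qa k) (vertices qb k) (sphere o r) &
            surface_decomposition (vertices qa k) (vertices qb k) (sphere o r) (cls k)]) \/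
   (exists v : vect R Lobachevsky N, [/\ v != 0, bform v v = 0 &
      forall k, exists c : R,
        circumscribed (vertices qa k) (vertices qb k) (orisphere v c) /\
        surface_decomposition (vertices qa k) (vertices qb k) (orisphere v c) (cls k)])) \/
  (exists2 H : set (vect R Lobachevsky N), is_plane N H &
     forall k,
       [\/ exists Om : set (vect R Lobachevsky N),
             [/\ equidistant H Om, circumscribed (vertices qa k) (vertices qb k) Om &
                 surface_decomposition (vertices qa k) (vertices qb k) Om (cls k)],
            (forall J, parallel (span_plane (facet (vertices qa k) (vertices qb k) J)) H) /\
               hyperplane_decomposition (vertices qa k) (vertices qb k) H (cls k) |
           exists ang : R,
             [/\ 0 < ang < pi / 2,
                 (forall J, meet_at_angle
                    (span_plane (facet (vertices qa k) (vertices qb k) J)) H ang) &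
                 hyperplane_decomposition (vertices qa k) (vertices qb k) H (cls k)]]).
Proof.
move=> fr Xa Xb full; pose o : vect R Lobachevsky N := center lam T.
have LE : Lobachevsky <> Euclidean by [].
have oE : hom_vec o = center lam T by [].
have cf k := frame_curved_facets N2 Gsym Gdiag lam_gt0 lam_mono signs Xa Xb fr k LE oE.
have o0 : o != 0.
  have [c0 _ _ no _] := cf ord0.
  by apply: contra_neq c0 => o0; rewrite -(no finset.set0) o0 bform0r.
clearbody o; move: oE => _.
pose q := @bform R Lobachevsky N o o.
have [q0|q0|q0] := ltgtP q 0.
- left; left.
  have qn : 0 < - q by rewrite oppr_gt0.
  have to : time o != 0.
    by apply: contraTneq q0 => /bform_time0[]; rewrite -leNgt.
  pose r := Num.sg (time o) / Num.sqrt (- q).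
  have r0 : r != 0 by rewrite mulf_neq0 ?sgr_eq0// invr_eq0 gt_eqF// sqrtr_gt0.
  have Xo : Xspace (r *: o).
    apply/lobP; split.
      rewrite !bformE -/q /r mulrA -expr2 exprMn sqr_sg to mul1r exprVn.
      by rewrite sqr_sqrtr ?ltW// invrN mulNr mulVf// lt_eqF.
    rewrite /time mxE -/(time o) /r mulrAC -normrEsg divr_gt0 ?normr_gt0//.
    by rewrite sqrtr_gt0.
  exists (r *: o) => // k.
  exact: (lob_sphere_case N2 (fun i => Xa _) (fun i => Xb _)
    (curved_facets_scale r0 (cf k)) Xo).
- right; have r0 : (Num.sqrt q)^-1 != 0 by rewrite invr_eq0 gt_eqF// sqrtr_gt0.
  set r := _^-1 in r0.
  have oo : @bform R Lobachevsky N (r *: o) (r *: o) = 1.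
    by rewrite !bformE -/q /r mulrA -invfM -expr2 sqr_sqrtr ?ltW// mulVf// gt_eqF.
  have cfr k := curved_facets_scale r0 (cf k).
  exists (level (r *: o) 0).
    exact: (lob_plane N2 (fun i => Xa (lift ord0 i)) oo).
  move=> k; have [c1|c1|c1] := ltgtP ((r * (lam k)^-1) ^+ 2) 1.
  + by constructor 3; exact: (lob_angle_case N2 (fun i => Xa _) (fun i => Xb _) (cfr k) oo c1).
  + by constructor 1; exact: (lob_equidistant_case N2 (fun i => Xa _) (fun i => Xb _) (cfr k) oo c1).
  + by constructor 2; exact: (lob_parallel_case N2 (fun i => Xa _) (fun i => Xb _) (full k) (cfr k) oo c1).
- left; right; exists o; split=> // k.
  exact: (lob_orisphere_case N2 (fun i => Xa _) (fun i => Xb _) (cf k) o0 q0).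
Qed.

(** The sum of the homogeneous weights of o decides whether o is a point or a
    direction. *)
Lemma euclidean_conclusion (qa qb Nrm : 'I_N.+1 -> vect R Euclidean N) :
  frame G lam s s' qa qb T alpha beta Nrm ->
  (forall k, full_dimensional (vertices qa k) (vertices qb k)) ->
  (exists2 o : vect R Euclidean N, Xspace o &
    forall k, exists r : R,
        [/\ sphere_radius Euclidean r, ~ great_radius Euclidean r,
            circumscribed (vertices qa k) (vertices qb k) (sphere o r) &
            surface_decomposition (vertices qa k) (vertices qb k) (sphere o r) (cls k)]) \/
  (exists2 H : set (vect R Euclidean N), is_plane N H &
     forall k, exists ang : R,
             [/\ 0 < ang < pi / 2,
                 (forall J, meet_at_angle
                    (span_plane (facet (vertices qa k) (vertices qb k) J)) H ang) &
                 hyperplane_decomposition (vertices qa k) (vertices qb k) H (cls k)]).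
Proof.
move=> fr full.
have Xa i : Xspace (qa i) by []. have Xb i : Xspace (qb i) by [].
have ef k : euclid_facets (vertices qa k) (vertices qb k) (cls k) (center lam T)
    (lam k)^-1 (facet_nu G lam Nrm k) (facet_functional G lam T k)
    (base_sign s T k < 0).
  split.
  - by rewrite invr_eq0 gt_eqF.
  - move=> J.
    exact: (facet_span N2 Gsym Gdiag lam_gt0 lam_mono signs Xa Xb fr).
  - move=> J; split.
      exact: (facet_nu_unit N2 Gsym Gdiag lam_gt0 lam_mono Xa Xb fr).
    exact: (facet_nu_functional fr).
  - move=> J; exact: (facet_functional_center N2 Gsym Gdiag lam_gt0 lam_mono Xa Xb fr).
  - move=> J; rewrite (facet_sign N2 Gsym Gdiag lam_gt0 lam_mono signs Xa Xb fr).
    by rewrite (base_sign_bool signs fr) -signr_addb -(base_sign_bool signs fr).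
pose w : 'rV[R]_(1 + N) := center lam T.
pose r := lsubmx w 0 0; pose u : vect R Euclidean N := rsubmx w.
have wE : center lam T = row_mx (r%:M : 'rV[R]_1) u.
  apply: etrans (esym (hsubmxK w)) _; congr row_mx; apply/rowP => j.
  by rewrite ord1 [RHS]mxE eqxx mulr1n.
have [r0|r0] := eqVneq r 0.
  right; have uE : center lam T = hom_vec u.
    have E : ((0 : R)%:M : 'rV[R]_1) = 0 by apply/rowP => j; rewrite !mxE mul0rn.
    by rewrite wE r0 E.
  have u0 : u != 0.
    have [c0 _ _ no _] := ef ord0; apply: contra_neq c0 => u0.
    rewrite -(no finset.set0) uE u0 (facet_nu_functional fr) bform0l//.
  have uu : 0 < @bform R Euclidean N u u by exact: bform_gt0.
  pose p := (Num.sqrt (@bform R Euclidean N u u))^-1.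
  have p0 : p != 0 by rewrite invr_eq0 gt_eqF// sqrtr_gt0.
  have pp : @bform R Euclidean N (p *: u) (p *: u) = 1.
    rewrite [bform _ _]bformZl bformZr /p mulrA -invfM -expr2 sqr_sqrtr ?ltW// mulVf//.
    by rewrite gt_eqF.
  exists (central_plane (p *: u)).
    apply: (affine_plane_is_plane (central_planeP _) pp).
    by exists 0; exact: central_plane0.
  move=> k; apply: (euclid_angle_case N2 (full k) _ pp).
  by have := euclid_facets_scale p0 (ef k); rewrite uE -hom_vecZ; exact.
left; exists (r^-1 *: u) => // k.
apply: euclid_sphere_case.
have := euclid_facets_scale (invr_neq0 r0) (ef k).
have -> : r^-1 *: center lam T = hom_pt (r^-1 *: u); last exact.
have E := scale_row_mx r^-1 (r%:M : 'rV[R]_1) u.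
by rewrite wE; apply: etrans E _; rewrite scale_scalar_mx mulVf.
Qed.

End Conclusions.
Theorem theorem6p1 (R : realType) (X : geometry) (n : nat)
  (G : 'M[R]_n) (lam s s' : 'I_n -> R)
  (nn : 'I_n -> vect R X n) (m : vect R X n)
  (a : 'I_n -> vect R X n) (b : option R -> 'I_n -> vect R X n)
  (M : 'M[R]_(vdim X n.-1, vdim X n)) (t : vect R X n)
  (qa qb : 'I_n -> vect R X n.-1)
  (hn : (3 <= n)%N)
  (hP : simplest_type G lam s s' nn m a b)
  (hchart : flat_chart m a M t)
  (hq : forall i, [/\ Xspace (qa i), Xspace (qb i),
                      qa i *m M + t = a i & qb i *m M + t = b (Some 0) i]) :
  let pa k := fun i : 'I_n.-1 => qa (lift k i) in
  let pb k := fun i : 'I_n.-1 => qb (lift k i) in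
  (forall k, full_dimensional (pa k) (pb k)) ->
  (* (i) *)
  ((exists2 o, Xspace o &
      forall k, exists r : R,
        [/\ sphere_radius X r, ~ great_radius X r,
            circumscribed (pa k) (pb k) (sphere o r) &
            surface_decomposition (pa k) (pb k) (sphere o r)
              (odd_class s s' k)])
   \/
   (X = Lobachevsky /\
    exists v : vect R X n.-1, [/\ v != 0, bform v v = 0 &
      forall k, exists c : R,
        circumscribed (pa k) (pb k) (orisphere v c) /\
        surface_decomposition (pa k) (pb k) (orisphere v c)
          (odd_class s s' k)]))
  \/
  (* (ii) *)
  (exists2 H : set (vect R X n.-1), is_plane n.-1 H &
     forall k,
       [\/ exists Om : set (vect R X n.-1),
             [/\ equidistant H Om, circumscribed (pa k) (pb k) Om &
                 surface_decomposition (pa k) (pb k) Om (odd_class s s' k)],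
           [/\ X = Lobachevsky,
               (forall J, parallel (span_plane (facet (pa k) (pb k) J)) H) &
               hyperplane_decomposition (pa k) (pb k) H (odd_class s s' k)] |
           exists alpha : R,
             [/\ 0 < alpha < pi / 2,
                 (forall J, meet_at_angle
                    (span_plane (facet (pa k) (pb k) J)) H alpha) &
                 hyperplane_decomposition (pa k) (pb k) H
                   (odd_class s s' k)]]).
Proof.
destruct n as [|N]; first by [].
have N2 : (1 < N)%N by [].
have [[Gsym Gdiag _ _] [lam0 lam_mono] signs [gram mn mm] [verts _]] := hP.
have [t0 isom chart] := hchart.
have Xqa i : Xspace (qa i) by have [] := hq i.
have Xqb i : Xspace (qb i) by have [] := hq i.
have qaE i : qa i *m M + t = a i by have [] := hq i.
have qbE i : qb i *m M + t = b (Some 0) i by have [] := hq i.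
move=> pa pb full.
destruct X.
- have {}t0 : t = 0 by exact: t0.
  have qaM i : qa i *m M = a i by rewrite -qaE t0 addr0.
  have qbM i : qb i *m M = b (Some 0) i by rewrite -qbE t0 addr0.
  have SE : Spherical <> Euclidean by [].
  have [T [al [be [Nrm fr]]]] := curved_frame SE signs gram verts isom qaM qbM.
  left; left.
  exact: (spherical_conclusion N2 Gsym Gdiag lam0 lam_mono signs fr Xqa Xqb full).
- have chartm (x : vect R Euclidean N) i : @bform R Euclidean N.+1 (x *m M + t - a i) m = 0.
    have : [set x *m M + t | x in @Xspace R Euclidean N] (x *m M + t) by exists x.
    by rewrite chart => -[_]; exact.
  have [al [be fr]] := euclidean_frame N2 Gdiag signs gram mn mm verts isom chartm qaE qbE.
  have [c|[H HP c]] := euclidean_conclusion N2 Gsym Gdiag lam0 lam_mono signs fr full.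
    by left; left.
  by right; exists H => // k; constructor 3; exact: c.
- have {}t0 : t = 0 by exact: t0.
  have qaM i : qa i *m M = a i by rewrite -qaE t0 addr0.
  have qbM i : qb i *m M = b (Some 0) i by rewrite -qbE t0 addr0.
  have LE : Lobachevsky <> Euclidean by [].
  have [T [al [be [Nrm fr]]]] := curved_frame LE signs gram verts isom qaM qbM.
  have [[c|c]|[H HP c]] := lobachevsky_conclusion N2 Gsym Gdiag lam0 lam_mono signs fr Xqa Xqb full.
  + by left; left.
  + by left; right.
  + right; exists H => // k; have [c1|[c1 c2]|c1] := c k.
    * by constructor 1.
    * by constructor 2.
    * by constructor 3.
Qed.
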